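(* Let $2\le p\le\infty$. There exist constants $C_1,C_2,C_3,c_1,c_2>0$ such that for $k\le c_1 n$ and $0<\lambda\le 1/4$, the event that \[\left|\mathcal{L}^{n,k}_{a,p}u(x)-\rho(x)^{-2/d}\Delta_p u(x)\right|\le C_1\left(\|u\|_{C^2(B_k)}^2|\nabla u(x)|^{-1}\theta^{-1}\left(\tfrac kn\right)^{1/d}+\|u\|_{C^3(B_k)}\left(\lambda+\left(\tfrac kn\right)^{1/d}\right)\right)\] holds for all $u\in C^3(\overline\Omega)$ and all $x\in\Omega_{c_2(k/n)^{1/d}}\cap\mathcal{X}_n$, where $B_k=B(x,c_2(k/n)^{1/d})$, has probability at least \[1-C_2n^3\exp\left(-C_3\left(\tfrac kn\right)^{1/2}k\lambda^{d/2}\right)-C_2n^3\exp\left(-C_3\left(\tfrac kn\right)^{2/d}k\lambda^2\right).\]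
   Context: Setting: $\Omega\subset\mathbb{R}^d$ is an open, bounded, connected domain with smooth boundary; $X_1,X_2,\dots$ are i.i.d. random variables on $\Omega$ with probability density $\rho\in C^2(\overline\Omega)$ satisfying $\beta\le\rho\le\beta^{-1}$ on $\Omega$ for some $\beta>0$; $\mathcal{X}_n=\{X_1,\dots,X_n\}$. For $r>0$, $\partial_r\Omega=\{x\in\Omega:\mathrm{dist}(x,\partial\Omega)\le r\}$ and $\Omega_r=\Omega\setminus\partial_r\Omega$. $B(x,r)$ is the closed ball. $\alpha(d)$ is the volume of the unit ball of $\mathbb{R}^d$. $\|u\|_{C^j(B)}$ is the usual $C^j$ norm. Kernel: $\eta:[0,\infty)\to[0,\infty)$ is smooth and nonincreasing, $\eta(t)\ge1$ for $0\le t\le\frac12$, $\eta(t)=0$ for $t>1$, $\int_{B(0,1)}\eta(|z|)\,dz=1$, and there exist $r_0\in(0,1)$, $\theta>0$ with $r\eta(r)+\theta(r-r_0)^2\le r_0\eta(r_0)$ for all $0\le r\le1$. Set $\eta_\varepsilon(t)=\eta(t/\varepsilon)$ and $\sigma_\eta=\int_{\mathbb{R}^d}|z_1|^2\eta(|z|)\,dz$. For an integer $1\le k\le n$ let $N_\varepsilon(x)$ be the number of points of $\mathcal{X}_n$ in $B(x,\varepsilon)$ and $\varepsilon_k(x)=\min\{\varepsilon>0:N_\varepsilon(x)\ge k\}$. Let $d^{n,\varepsilon}(x)=\sum_{y\in\mathcal{X}_n}\eta_\varepsilon(|x-y|)$. Nonsymmetric $k$-nearest neighbor operators: \[\mathcal{L}^{n,k}_{a,rw}u(x)=\frac{2}{\sigma_\eta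 d^{n,\varepsilon_k(x)}(x)}\left(\frac{n\alpha(d)}{k}\right)^{2/d}\sum_{y\in\mathcal{X}_n}\eta_{\varepsilon_k(x)}(|x-y|)(u(y)-u(x)),\] \[\mathcal{L}^{n,k}_{a,\infty}u(x)=\frac{1}{r_0^2\eta(r_0)}\left(\frac{n\alpha(d)}{k}\right)^{2/d}\Big(\min_{y\in\mathcal{X}_n}\{\eta_{\varepsilon_k(x)}(|x-y|)(u(y)-u(x))\}+\max_{y\in\mathcal{X}_n}\{\eta_{\varepsilon_k(x)}(|x-y|)(u(y)-u(x))\}\Big),\] \[\mathcal{L}^{n,k}_{a,p}u(x)=\tfrac1p\mathcal{L}^{n,k}_{a,rw}u(x)+\left(1-\tfrac2p\right)\mathcal{L}^{n,k}_{a,\infty}u(x)\] (with $1/p=0$ if $p=\infty$). Continuum operator: $\Delta_\infty u=\frac{1}{|\nabla u|^2}\sum_{i,j=1}^d u_{x_ix_j}u_{x_i}u_{x_j}$ and $\Delta_p u=\frac1p\rho^{-2}\mathrm{div}(\rho^2\nabla u)+\left(1-\tfrac2p\right)\Delta_\infty u$. Convention: the right-hand side of the error bound is interpreted as $+\infty$ when $\nabla u(x)=0$. The constants may depend on $d,\Omega,\rho,\eta,p$ but not on $n,k,\lambda,u,x$. *)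

(* Defs.v *)
From HB Require Import structures.
From mathcomp Require Import all_boot all_order all_algebra.
From mathcomp Require Import all_classical all_reals all_analysis.

Set Implicit Arguments.
Unset Strict Implicit.
Unset Printing Implicit Defensive.

Import Order.TTheory GRing.Theory Num.Theory.
Import numFieldNormedType.Exports.

Local Open Scope classical_set_scope.
Local Open Scope ring_scope.

(* The norm that the library puts on 'rV[R]_d is the sup norm. It is used here
   only through the topology and through boundedness; every metric quantity
   below uses the Euclidean norm [enorm]. *)
Section euclidean.
Context {R : realType} {d : nat}.
Implicit Types (x y : 'rV[R]_d) (Om : set 'rV[R]_d) (r : R).

Definition enorm x : R := Num.sqrt (\sum_i x 0 i ^+ 2).

Definition ecball x r : set 'rV[R]_d := [set y | enorm (y - x) <= r].

Definition boundary Om : set 'rV[R]_d := closure Om `\` interior Om.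

Definition dist_boundary Om x : R := inf [set enorm (x - y) | y in boundary Om].

Definition boundary_layer Om r : set 'rV[R]_d :=
  [set x | Om x /\ dist_boundary Om x <= r].

Definition inner_domain Om r : set 'rV[R]_d := Om `\` boundary_layer Om r.

End euclidean.

(* The sigma-algebra generated by the coordinates, i.e. the Borel sets. *)
Definition rV_display : measure_display.
Proof. exact: default_measure_display. Qed.

Section measurable_rV.
Context {R : realType} {d : nat}.

Let coord (i : 'I_d) (x : 'rV[R]_d) : measurableTypeR R := x 0 i.

Let rV_set0 : g_sigma_preimage coord set0.
Proof. exact: sigma_algebra0. Qed.

Let rV_setC A : g_sigma_preimage coord A -> g_sigma_preimage coord (~` A).
Proof. exact: sigma_algebraC. Qed.

Let rV_bigcup (F : _^nat) : (forall i, g_sigma_preimage coord (F i)) ->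
  g_sigma_preimage coord (\bigcup_i F i).
Proof. exact: sigma_algebra_bigcup. Qed.

HB.instance Definition _ :=
  @isMeasurable.Build rV_display 'rV[R]_d
    (g_sigma_preimage coord) rV_set0 rV_setC rV_bigcup.

End measurable_rV.

Section lebesgue_rV.
Context {R : realType}.

Definition cons_rV {d} (z : measurableTypeR R * 'rV[R]_d) : 'rV[R]_d.+1 :=
  row_mx (z.1%:M : 'rV_1) z.2.

Definition uncons_rV {d} (x : 'rV[R]_d.+1) : measurableTypeR R * 'rV[R]_d :=
  (x 0 0, rsubmx (x : 'rV_(1 + d))).

Lemma cons_rVK d : cancel (@cons_rV d) uncons_rV.
Proof.
case=> a v; rewrite /cons_rV /uncons_rV row_mxKr; congr pair.
transitivity (row_mx (a%:M : 'rV_1) v 0 (lshift d 0)).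
  by congr (row_mx _ _ _ _); exact/val_inj.
by rewrite row_mxEl mxE.
Qed.

Lemma measurable_coord d (i : 'I_d) :
  measurable_fun setT (fun x : 'rV[R]_d => x 0 i : measurableTypeR R).
Proof.
move=> _ Y mY; rewrite setTI; apply: sub_sigma_algebra => /=.
rewrite -bigcup_seq/=; exists i => /=; first by rewrite mem_index_enum.
by exists Y => //; rewrite setTI.
Qed.

Lemma measurable_fun_rV d0 (T : measurableType d0) d (f : T -> 'rV[R]_d) :
  (forall i, measurable_fun setT (fun t => f t 0 i : measurableTypeR R)) ->
  measurable_fun setT f.
Proof.
move=> mf.
have sub : g_sigma_preimage (fun i t => f t 0 i : measurableTypeR R)
    `<=` measurable.
  apply: smallest_sub; first exact: sigma_algebra_measurable.
  by move=> A; rewrite -bigcup_seq => -[i /= _ [B mB <-]]; exact: mf.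
move=> _ A mA; apply: sub.
have := g_sigma_preimage_comp
  (fun (i : 'I_d) (x : 'rV[R]_d) => x 0 i : measurableTypeR R) f.
by rewrite /comp => ->; exists A.
Qed.

Lemma measurable_cons_rV d : measurable_fun setT (@cons_rV d).
Proof.
apply: measurable_fun_rV => i; have [j ->|j ->] := split_ordP (i : 'I_(1 + d)).
- apply: (eq_measurable_fun fst) => [z _|]; last exact: measurable_fst.
  apply/esym; rewrite [LHS](row_mxEl (z.1%:M : 'rV_1) z.2).
  by rewrite ord1 mxE eqxx mulr1n.
- apply: (eq_measurable_fun (fun z : measurableTypeR R * 'rV[R]_d =>
    z.2 0 j : measurableTypeR R)) => [z _|].
    by apply/esym; rewrite [LHS](row_mxEr (z.1%:M : 'rV_1) z.2).
  exact: (measurableT_comp (measurable_coord j) measurable_snd).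
Qed.

Lemma measurable_uncons_rV d : measurable_fun setT (@uncons_rV d).
Proof.
apply/measurable_fun_pair; first exact: measurable_coord.
apply: measurable_fun_rV => i; under eq_fun do rewrite mxE.
exact: measurable_coord.
Qed.

Definition rV_measureS d (mu : {sigma_finite_measure set 'rV[R]_d -> \bar R}) :
    set 'rV[R]_d.+1 -> \bar R :=
  pushforward (@lebesgue_measure R \x mu)%E cons_rV.

Section instances.
Context d (mu : {sigma_finite_measure set 'rV[R]_d -> \bar R}).

Let measurable_preim A : measurable A -> measurable (@cons_rV d @^-1` A).
Proof.
by move=> mA; rewrite -[X in measurable X]setTI; exact: measurable_cons_rV.
Qed.

Let rV_measureS0 : rV_measureS mu set0 = 0%E.
Proof. by rewrite /rV_measureS /pushforward preimage_set0 measure0. Qed.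

Let rV_measureS_ge0 A : (0 <= rV_measureS mu A)%E.
Proof. by rewrite /rV_measureS /pushforward measure_ge0. Qed.

Let rV_measureS_sigma_additive : semi_sigma_additive (rV_measureS mu).
Proof.
move=> F mF tF mUF; rewrite /rV_measureS /pushforward preimage_bigcup.
apply: measure_semi_sigma_additive.
- by move=> n; exact: measurable_preim.
- apply/trivIsetP => /= i j _ _ ij; rewrite -preimage_setI.
  by move/trivIsetP : tF => /(_ _ _ _ _ ij) ->//; rewrite preimage_set0.
- by rewrite -preimage_bigcup; exact: measurable_preim.
Qed.

HB.instance Definition _ := isMeasure.Build _ _ _ (rV_measureS mu)
  rV_measureS0 rV_measureS_ge0 rV_measureS_sigma_additive.

Let rV_measureS_sigma_finite : sigma_finite setT (rV_measureS mu).
Proof.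
have /sigma_finiteP[F [TF ndF Foo]] := sigma_finiteT (@lebesgue_measure R).
have /sigma_finiteP[G [TG ndG Goo]] := sigma_finiteT mu.
exists (fun n => @uncons_rV d @^-1` (F n `*` G n)).
  rewrite -preimage_bigcup -[LHS](@preimage_setT _ _ uncons_rV).
  congr (_ @^-1` _).
  rewrite -setXTT TF TG predeqE => -[x y]; split.
    move=> [/= [n _ Fnx] [k _ Gky]]; exists (maxn n k) => //; split.
    - by move: x Fnx; exact/subsetPset/ndF/leq_maxl.
    - by move: y Gky; exact/subsetPset/ndG/leq_maxr.
  by move=> [n _ []/= ? ?]; split; exists n.
move=> n; have [mF Fn] := Foo n; have [mG Gn] := Goo n.
have mFG : measurable (F n `*` G n) by exact: measurableX.
split; first by rewrite -[X in measurable X]setTI; exact: measurable_uncons_rV.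
rewrite /rV_measureS /pushforward -comp_preimage.
rewrite (_ : uncons_rV \o cons_rV = id); last exact/funext/cons_rVK.
by rewrite preimage_id product_measure1E// lte_mul_pinfty// ge0_fin_numE.
Qed.

HB.instance Definition _ := Measure_isSigmaFinite.Build _ _ _ (rV_measureS mu)
  rV_measureS_sigma_finite.

End instances.

(* The Lebesgue measure of R^d: R^0 is a point of mass 1, and R^(d+1) carries
   the product of the Lebesgue measures of R and R^d. *)
Fixpoint lebesgue_rV d : {sigma_finite_measure set 'rV[R]_d -> \bar R} :=
  if d is d'.+1 then rV_measureS (lebesgue_rV d') else \d_(0 : 'rV[R]_0).

End lebesgue_rV.

Section differential_calculus.
Context {R : realType} {d : nat}.
Implicit Types (u : 'rV[R]_d -> R) (Om B : set 'rV[R]_d) (s : seq 'I_d).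

Definition partial (i : 'I_d) u : 'rV[R]_d -> R :=
  fun x => 'D_(delta_mx 0 i) u x.

(* partials [:: i1; ...; im] u = d_i1 (... (d_im u)) *)
Definition partials s u : 'rV[R]_d -> R := foldr partial u s.

Definition is_Ck (k : nat) Om u : Prop :=
  forall s,
    ((size s < k)%N ->
       forall i x, Om x -> derivable (partials s u) x (delta_mx 0 i)) /\
    ((size s <= k)%N -> forall x, Om x -> {for x, continuous (partials s u)}).

(* C^k up to the boundary: the partial derivatives in the open set Om extend
   continuously to its closure, u itself being its own extension. *)
Definition is_Ck_closure (k : nat) Om u : Prop :=
  [/\ is_Ck k Om u, {within closure Om, continuous u} &
      forall s, (size s <= k)%N ->
        exists2 g : 'rV[R]_d -> R,
          {within closure Om, continuous g} & {in Om, partials s u =1 g}].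

Definition smooth u : Prop := forall k, is_Ck k setT u.

Definition multi_partial (a : 'I_d -> nat) u : 'rV[R]_d -> R :=
  partials (flatten [seq nseq (a i) i | i <- enum 'I_d]) u.

(* sum over the multi-indices a with |a| <= k of the sup norms on B *)
Definition Ck_norm (k : nat) B u : R :=
  \sum_(a : {ffun 'I_d -> 'I_k.+1} | (\sum_i a i <= k)%N)
    sup [set `|multi_partial (fun i => a i) u x| | x in B].

Definition grad u x : 'rV[R]_d := \row_i partial i u x.

Definition infty_laplacian u x : R :=
  (enorm (grad u x) ^+ 2)^-1 *
  \sum_i \sum_j partials [:: j; i] u x * partial i u x * partial j u x.

Definition inv_p (p : \bar R) : R := fine (p^-1)%E.

Definition p_laplacian (rho : 'rV[R]_d -> R) (p : \bar R) u x : R :=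
  inv_p p * (rho x ^+ 2)^-1 *
    (\sum_i partial i (fun y => rho y ^+ 2 * partial i u y) x) +
  (1 - 2 * inv_p p) * infty_laplacian u x.

End differential_calculus.

(* Near each boundary point, Om lies strictly on one side of the graph of a
   smooth function of d - 1 of the coordinates. *)
Definition smooth_boundary {R : realType} {d : nat}
    (Om : set 'rV[R]_d) : Prop :=
  forall x0, boundary Om x0 ->
    exists (r : R) (i : 'I_d) (b : bool) (g : 'rV[R]_d.-1 -> R),
      [/\ 0 < r, smooth g &
          forall x, enorm (x - x0) < r ->
            (Om x <-> g (col' i x) < (-1) ^+ b * x 0 i)].

Definition smooth_domain {R : realType} {d : nat} (Om : set 'rV[R]_d) : Prop :=
  [/\ open Om, bounded_set Om, connected Om, Om !=set0 & smooth_boundary Om].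

Definition C2_density {R : realType} {d : nat} (Om : set 'rV[R]_d)
    (rho : 'rV[R]_d -> R) : Prop :=
  [/\ is_Ck_closure 2 Om rho,
      exists2 beta : R, 0 < beta &
        forall x, Om x -> beta <= rho x <= beta^-1 &
      (\int[lebesgue_rV d]_(x in Om) (rho x)%:E = 1)%E].

(* Only the values of eta on [0, +oo) matter; eta is smooth there, i.e. it
   coincides there with a smooth function on the real line. *)
Definition admissible_kernel {R : realType} (d : nat) (eta : R -> R) : Prop :=
  [/\ exists2 g : R -> R,
        (forall m t, derivable (derive1n m g) t 1) &
        (forall t, 0 <= t -> eta t = g t),
      forall t, 0 <= t -> 0 <= eta t,
      forall s t, 0 <= s -> s <= t -> eta t <= eta s,
      (forall t, 0 <= t <= 2^-1 -> 1 <= eta t) /\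
      (forall t, 1 < t -> eta t = 0) &
      (\int[lebesgue_rV d]_(z in ecball 0 1) (eta (enorm z))%:E = 1)%E].

Definition kernel_peak {R : realType} (eta : R -> R) (r0 theta : R) : Prop :=
  forall r, 0 <= r <= 1 -> r * eta r + theta * (r - r0) ^+ 2 <= r0 * eta r0.

(* i0 is the index of the first coordinate. *)
Definition sigma_eta {R : realType} {d : nat} (i0 : 'I_d) (eta : R -> R) : R :=
  fine (\int[lebesgue_rV d]_z (`|z 0 i0| ^+ 2 * eta (enorm z))%:E)%E.

Definition ball_volume (R : realType) (d : nat) : R :=
  fine (lebesgue_rV d (ecball (0 : 'rV[R]_d) 1)).

Section operators.
Context {R : realType} {d : nat}.
Variables (i0 : 'I_d) (eta : R -> R) (r0 : R) (n k : nat).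
(* S enumerates, without repetition, the points of the cloud X_n. *)
Variable S : seq 'rV[R]_d.
Implicit Types (u : 'rV[R]_d -> R) (x y : 'rV[R]_d).

Definition nb_points (eps : R) x : nat :=
  count (fun y => enorm (x - y) <= eps) S.

Definition knn_radius x : R :=
  inf [set eps : R | 0 < eps /\ (k <= nb_points eps x)%N].

Definition knn_weight x y : R := eta (enorm (x - y) / knn_radius x).

Definition knn_degree x : R := \sum_(y <- S) knn_weight x y.

Definition knn_scaling : R := (n%:R * ball_volume R d / k%:R) `^ (2 / d%:R).

Definition L_rw u x : R :=
  2 / (sigma_eta i0 eta * knn_degree x) * knn_scaling *
  \sum_(y <- S) knn_weight x y * (u y - u x).

(* inf and sup range over a finite set: they are the min and the max. *)
Definition L_infty u x : R :=
  (r0 ^+ 2 * eta r0)^-1 * knn_scaling *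
  (inf [set knn_weight x y * (u y - u x) | y in [set` S]] +
   sup [set knn_weight x y * (u y - u x) | y in [set` S]]).

Definition L_p (p : \bar R) u x : R :=
  inv_p p * L_rw u x + (1 - 2 * inv_p p) * L_infty u x.

End operators.

Definition point_cloud {R : realType} {d : nat} {T : Type}
    (X : nat -> T -> 'rV[R]_d) (n : nat) (w : T) : seq 'rV[R]_d :=
  undup [seq X i w | i <- iota 0 n].

Definition iid_with_density {R : realType} {d : nat} {dT : measure_display}
    {T : measurableType dT} (P : probability T R) (Om : set 'rV[R]_d)
    (rho : 'rV[R]_d -> R) (X : nat -> {RV P >-> 'rV[R]_d}) : Prop :=
  [/\ forall i w, Om (X i w),
      forall i (A : set 'rV[R]_d), measurable A ->
        distribution P (X i) A =
          (\int[lebesgue_rV d]_(x in A `&` Om) (rho x)%:E)%E &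
      forall (n : nat) (A : nat -> set 'rV[R]_d),
        (forall i, measurable (A i)) ->
        P (\bigcap_(i < n) (X i @^-1` A i)) =
          (\prod_(i < n) P (X i @^-1` A i))%E].

Section event.
Context {R : realType} {d : nat} {T : Type}.
Variables (i0 : 'I_d) (Om : set 'rV[R]_d) (rho : 'rV[R]_d -> R) (eta : R -> R).
Variables (r0 theta : R) (p : \bar R) (X : nat -> T -> 'rV[R]_d).
Variables (n k : nat) (lambda C1 c2 : R).

Let h : R := (k%:R / n%:R) `^ (d%:R^-1).

Definition error_bound (u : 'rV[R]_d -> R) (x : 'rV[R]_d) : \bar R :=
  if grad u x == 0 then +oo%E else
    (C1 * (Ck_norm 2 (ecball x (c2 * h)) u ^+ 2 * (enorm (grad u x))^-1 *
             theta^-1 * h +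
           Ck_norm 3 (ecball x (c2 * h)) u * (lambda + h)))%:E.

Definition consistency_event : set T :=
  [set w | forall u : 'rV[R]_d -> R, is_Ck_closure 3 Om u ->
     forall x, inner_domain Om (c2 * h) x -> x \in point_cloud X n w ->
       (`|L_p i0 eta r0 n k (point_cloud X n w) p u x -
          rho x `^ (- (2 / d%:R)) * p_laplacian rho p u x|%:E
        <= error_bound u x)%E].

End event.

(* The event is an uncountable intersection, so "has probability at least q"
   means that it contains a measurable event of probability at least q. *)
Definition has_prob_at_least {R : realType} {dT : measure_display}
    {T : measurableType dT} (P : probability T R) (E : set T) (q : R) : Prop :=
  exists A : set T, [/\ measurable A, A `<=` E & (q%:E <= P A)%E].

(* Main.v *)
Require Import Defs.
From HB Require Import structures.
From mathcomp Require Import all_boot all_order all_algebra.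
From mathcomp Require Import fingroup perm.
From mathcomp Require Import ring lra.
From mathcomp Require Import all_classical all_reals all_analysis.
From mathcomp Require Import measurable_realfun.

Set Implicit Arguments.
Unset Strict Implicit.
Unset Printing Implicit Defensive.

Import Order.TTheory GRing.Theory Num.Theory.
Import numFieldNormedType.Exports.

Local Open Scope classical_set_scope.
Local Open Scope ring_scope.

(** Write h = (k/n)^(1/d). Bernstein's inequality and a union bound over a finite
    net of centers and radii show that, simultaneously for all centers x and all
    radii e of order h, the number of sample points near x and the kernel moments
    of order 0, 1, 2 at x deviate from their means by at most a multiple of
    n lambda h^(d+1); the numbers of net points are polynomial in n and are
    absorbed by the factor n^3 at the price of a smaller rate. Counting points
    then gives |rho(x) alpha(d) eps_k(x)^d - h^d| <= C (lambda + h) h^d, and the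
    moments together with the third-order Taylor expansion of u give the
    random-walk operator.

    For the infinity part, with G = |grad u(x)| and nu = grad u(x) / G, the peak
    condition on r eta(r) forces every maximum of
    eta(|z|/e) (G nu.z + z.A z/2) to be close to z = r0 e nu, with an error
    Nb^2 e^3 / (G theta) where Nb bounds A; and a covering argument with cells of
    side of order h sqrt(lambda h) provides a sample point close to r0 e nu. The
    minimum is the opposite of the maximum for - u, so that the first-order terms
    cancel in the sum. *)

(** * Lebesgue measure of boxes and linear changes of variables *)

(** The centers are sample points and the radius eps_k(x) depends on the sample, so an estimate at
    one fixed center and radius is of no use; uniformity in both is the obstacle. The indicator of a
    ball is not Lipschitz in these parameters. It is replaced by a piecewise linear cutoff with a
    layer of width of order lambda h, which costs a relative error lambda in the counts and permits
    finite nets. The probability bound says something only if both exponential terms are below 1,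
    and this forces n h^d (lambda h)^2 > 1, hence 1/n <= lambda h, which keeps the nets polynomial
    in n. Cells of side h sqrt(lambda h) are fine enough because a displacement from the maximizer
    of the linear part costs only its square there. The constants are fixed before theta is known;
    theta enters the error through a single term. Finally the cloud is a set while the moments are
    sums over indices; an extra event, with complement as small as wished, excludes repeated
    points. *)

Definition rV_box {R : realType} {d : nat} (A : 'I_d -> set R) : set 'rV[R]_d :=
  [set x | forall i, A i (x 0 i)].

Section lebesgue_rV_theory.
Context {R : realType}.
Local Notation lambda := (@lebesgue_measure R).

Lemma measurable_rV_box d (A : 'I_d -> set (measurableTypeR R)) :
  (forall i, measurable (A i)) -> measurable (@rV_box R d A).
Proof.
move=> mA; rewrite (_ : rV_box A =
    \bigcap_(i in [set: 'I_d]) ((fun x : 'rV[R]_d => x 0 i : measurableTypeR R) @^-1` A i)).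
  apply: fin_bigcap_measurable => // i _; rewrite -[X in measurable X]setTI.
  exact: measurable_coord.
by apply/seteqP; split => x /= Hx i; [move=> _|]; exact: Hx.
Qed.

Lemma cons_rV0 d (a : R) (v : 'rV[R]_d) : cons_rV (a, v) 0 ord0 = a.
Proof. by have := congr1 fst (cons_rVK (a, v)). Qed.

Lemma cons_rV_lift d (a : R) (v : 'rV[R]_d) i :
  cons_rV (a, v) 0 (lift ord0 i) = v 0 i.
Proof.
have /= := congr1 (fun z : measurableTypeR R * 'rV[R]_d => z.2 0 i) (cons_rVK (a, v)); rewrite mxE => <-.
by congr (fun_of_matrix _ _ _); exact/val_inj.
Qed.

Lemma lebesgue_rV_box d (A : 'I_d -> set (measurableTypeR R)) :
  (forall i, measurable (A i)) ->
  (lebesgue_rV d (rV_box A) = \prod_(i < d) lambda (A i))%E.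
Proof.
elim: d A => [|d IH] A mA.
  rewrite big_ord0 /= diracE (_ : (_ \in _) = true) //.
  by apply/mem_set => -[].
rewrite big_ord_recl -IH /=; last by move=> i; exact: mA.
rewrite /rV_measureS /pushforward.
rewrite -product_measure1E //; last exact: measurable_rV_box.
congr (_ _); apply/seteqP; split => [[a v] /= Hx|[a v] [/= H1 H2] i].
  split => /=; first by have := Hx ord0; rewrite cons_rV0.
  by move=> i; have := Hx (lift ord0 i); rewrite cons_rV_lift.
have [j ->|->] := unliftP ord0 i; first by rewrite cons_rV_lift; exact: H2.
by rewrite cons_rV0.
Qed.

Definition rV_boxes (d : nat) : set (set 'rV[R]_d) :=
  [set B | exists A : 'I_d -> set (measurableTypeR R),
     (forall i, measurable (A i)) /\ B = rV_box A].

Lemma rV_boxes_generate d : @measurable _ 'rV[R]_d = <<s @rV_boxes d >>.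
Proof.
apply/seteqP; split.
  apply: smallest_sub; first exact: smallest_sigma_algebra.
  move=> B; rewrite -bigcup_seq => -[i /= _ [C mC <-]].
  apply: sub_sigma_algebra.
  exists (fun j => if j == i then C else setT); split.
    by move=> j; case: ifP.
  rewrite setTI; apply/seteqP; split => x /=.
    by move=> Cx j; case: eqP => [->|].
  by move/(_ i); rewrite eqxx.
apply: smallest_sub; first exact: sigma_algebra_measurable.
by move=> _ [A [mA ->]]; exact: measurable_rV_box.
Qed.

Lemma setI_closed_rV_boxes d : setI_closed (@rV_boxes d).
Proof.
move=> _ _ [A [mA ->]] [B [mB ->]]; exists (fun i => A i `&` B i); split.
  by move=> i; exact: measurableI.
apply/seteqP; split => x /=; first by move=> [HA HB] i; split; [exact: HA|exact: HB].
by move=> H; split => i; have [] := H i.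
Qed.

Let cube d (n : nat) : set 'rV[R]_d := rV_box (fun=> `[- n%:R, n%:R]%classic).

Let cube_boxes d n : @rV_boxes d (@cube d n).
Proof. by exists (fun=> `[- n%:R, n%:R]%classic); split. Qed.

Let cube_cover d : \bigcup_n (@cube d n) = setT.
Proof.
rewrite -subTset => x _; exists (Num.trunc (\sum_i `|x 0 i|)).+1 => //= i.
rewrite /= in_itv /= -ler_norml (@le_trans _ _ (\sum_i `|x 0 i|))//.
  by rewrite (bigD1 i)//= lerDl sumr_ge0.
by rewrite ltW// truncnS_gt.
Qed.

Let cube_finite d n : (lebesgue_rV d (@cube d n) < +oo)%E.
Proof.
rewrite /cube lebesgue_rV_box//; under eq_bigr do rewrite lebesgue_measure_itv/=.
rewrite (eq_bigr (fun=> (n%:R + n%:R)%:E)) ?prodEFin ?ltry// => i _.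
case: ifPn => [_|]; first by rewrite -EFinB opprK.
rewrite lte_fin -leNgt => n0; congr EFin; have : (0 : R) <= n%:R by [].
by lra.
Qed.

(** Boxes are stable under intersection and generate the sigma-algebra, and cubes of finite measure
    exhaust the space, so values on boxes determine a measure. The factor [c] is there for
    dilations. *)
Lemma lebesgue_rV_unique d (nu : {measure set 'rV[R]_d -> \bar R}) (c : {nonneg R}) :
  (forall A : 'I_d -> set (measurableTypeR R), (forall i, measurable (A i)) ->
     nu (rV_box A) = (c%:num%:E * \prod_(i < d) lambda (A i))%E) ->
  forall B, measurable B -> nu B = (c%:num%:E * lebesgue_rV d B)%E.
Proof.
move=> H B mB; apply/esym.
apply: (measure_unique (@rV_boxes d) (@cube d) _ _ _ _ (mscale c (lebesgue_rV d)) nu) => //.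
- exact: rV_boxes_generate.
- exact: setI_closed_rV_boxes.
- exact: cube_cover.
- move=> _ [A [mA ->]]; rewrite H//.
  by rewrite -lebesgue_rV_box.
- by move=> n; rewrite /= /mscale lte_mul_pinfty//; exact: cube_finite.
Qed.

(** A permutation of the coordinates followed by a map of each coordinate: one form that covers
    translations, dilations, reflections and permutations, the only changes of variables used
    below. *)
Definition rV_comap d (s : {perm 'I_d}) (phi : 'I_d -> R -> R) (x : 'rV[R]_d) : 'rV[R]_d :=
  \row_i phi i (x 0 (s i)).

Lemma measurable_rV_comap d (s : {perm 'I_d}) (phi : 'I_d -> R -> R) :
  (forall i, measurable_fun setT (phi i : measurableTypeR R -> measurableTypeR R)) ->
  measurable_fun setT (rV_comap s phi).
Proof.
move=> mphi; apply: measurable_fun_rV => i; under eq_fun do rewrite mxE.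
by apply: (measurableT_comp (mphi i)); exact: measurable_coord.
Qed.

(** The preimage of a box is a box whose sides are permuted preimages, so both measures agree on
    boxes up to the product of the factors. *)
Lemma lebesgue_rV_comap d (s : {perm 'I_d}) (phi : 'I_d -> R -> R) (c : 'I_d -> R) :
  (forall i, measurable_fun setT (phi i : measurableTypeR R -> measurableTypeR R)) ->
  (forall i, 0 <= c i) ->
  (forall i (A : set (measurableTypeR R)), measurable A ->
     lambda (phi i @^-1` A) = ((c i)%:E * lambda A)%E) ->
  forall B, measurable B ->
    lebesgue_rV d (rV_comap s phi @^-1` B) =
    ((\prod_i c i)%:E * lebesgue_rV d B)%E.
Proof.
move=> mphi c0 H B mB.
have mT := measurable_rV_comap s mphi.
pose T := HB.pack_for {mfun 'rV[R]_d >-> 'rV[R]_d} (rV_comap s phi) (isMeasurableFun.Build _ _ _ _ _ mT).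
have C0 : 0 <= \prod_i c i by exact: prodr_ge0.
apply: (lebesgue_rV_unique (nu := pushforward (lebesgue_rV d) T) (c := NngNum C0)) => //= A mA.
rewrite /pushforward.
have -> : T @^-1` rV_box A = rV_box (fun i => phi ((s^-1)%g i) @^-1` A ((s^-1)%g i)).
  apply/seteqP; split => x /= Hx i.
    by have /= := Hx ((s^-1)%g i); rewrite mxE permKV.
  by have /= := Hx (s i); rewrite mxE permK.
rewrite lebesgue_rV_box; last first.
  by move=> i; rewrite -[X in measurable X]setTI; exact: mphi.
rewrite (reindex_inj (@perm_inj _ s)) /=.
under eq_bigr do rewrite permK H//.
by rewrite big_split/= -prodEFin.
Qed.

Lemma lebesgue_translate (b : R) (A : set (measurableTypeR R)) : measurable A ->
  lambda ((fun t => t + b) @^-1` A) = lambda A.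
Proof.
move=> mA.
have mphi : measurable_fun setT ((fun t => t + b) : measurableTypeR R -> measurableTypeR R).
  exact: measurable_funD.
pose T := HB.pack_for {mfun measurableTypeR R >-> measurableTypeR R} (fun t : R => t + b) (isMeasurableFun.Build _ _ _ _ _ mphi).
apply/esym; apply: (lebesgue_measure_unique (mu := pushforward lambda T)) => // _ [[p q]] _ <-.
rewrite /= /pushforward.
rewrite (_ : _ @^-1` _ = `]p - b, q - b]%classic); last first.
  by apply/seteqP; split => x /=; rewrite !in_itv/= ltrBlDr lerBrDr.
rewrite !lebesgue_measure_itv /= !lte_fin ltrD2r.
by case: ifP => // _; rewrite -!EFinB; congr EFin; lra.
Qed.

Lemma lebesgue_dilate (a : R) (A : set (measurableTypeR R)) : 0 < a -> measurable A ->
  lambda ( *%R a @^-1` A) = (a^-1%:E * lambda A)%E.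
Proof.
move=> a0 mA.
have mphi : measurable_fun setT ( *%R a : measurableTypeR R -> measurableTypeR R).
  exact: measurable_funM.
pose T := HB.pack_for {mfun measurableTypeR R >-> measurableTypeR R} ( *%R a) (isMeasurableFun.Build _ _ _ _ _ mphi).
have -> : lambda A = (a%:E * lambda ( *%R a @^-1` A))%E.
  apply: (lebesgue_measure_unique (mu := mscale (NngNum (ltW a0)) (pushforward lambda T))) => // _ [[p q]] _ <-.
  rewrite /= /mscale /= /pushforward.
  rewrite (_ : _ @^-1` _ = `]a^-1 * p, a^-1 * q]%classic); last first.
    by apply/seteqP; split => x /=; rewrite !in_itv/= ltr_pdivrMl// ler_pdivlMl.
  rewrite !lebesgue_measure_itv /= !lte_fin ltr_pM2l ?invr_gt0//.
  case: ifP => _; rewrite ?mule0// -!EFinB -EFinM; congr EFin.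
  by rewrite -mulrBr mulrA mulfV ?mul1r// gt_eqF.
by rewrite muleA -EFinM mulVf ?mul1e// gt_eqF.
Qed.

Lemma lebesgue_rV_translate d (x : 'rV[R]_d) (B : set 'rV[R]_d) : measurable B ->
  lebesgue_rV d ((fun z => z + x) @^-1` B) = lebesgue_rV d B.
Proof.
move=> mB; have := @lebesgue_rV_comap d 1%g (fun i t => t + x 0 i) (fun=> 1) _ _ _ B mB.
rewrite (_ : rV_comap _ _ = fun z => z + x); last first.
  by apply/funext => z; apply/rowP => i; rewrite !mxE perm1.
rewrite big1// mul1e; apply => // i.
  exact: measurable_funD.
by move=> A mA; rewrite lebesgue_translate// mul1e.
Qed.

Lemma lebesgue_rV_dilate d (a : R) (B : set 'rV[R]_d) : 0 < a -> measurable B ->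
  lebesgue_rV d ((fun z => a *: z) @^-1` B) = ((a ^- d)%:E * lebesgue_rV d B)%E.
Proof.
move=> a0 mB; have := @lebesgue_rV_comap d 1%g (fun=> *%R a) (fun=> a^-1) _ _ _ B mB.
rewrite (_ : rV_comap _ _ = fun z => a *: z); last first.
  by apply/funext => z; apply/rowP => i; rewrite !mxE perm1.
rewrite prodr_const card_ord exprVn; apply => // i.
- by rewrite invr_ge0 ltW.
- by move=> A mA; rewrite lebesgue_dilate.
Qed.

Definition rV_flip d (i0 : 'I_d) (z : 'rV[R]_d) : 'rV[R]_d :=
  \row_i (if i == i0 then - z 0 i else z 0 i).

Lemma lebesgue_rV_flip d (i0 : 'I_d) (B : set 'rV[R]_d) : measurable B ->
  lebesgue_rV d (rV_flip i0 @^-1` B) = lebesgue_rV d B.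
Proof.
move=> mB; have := @lebesgue_rV_comap d 1%g (fun i => if i == i0 then -%R else id) (fun=> 1) _ _ _ B mB.
rewrite (_ : rV_comap _ _ = rV_flip i0); last first.
  by apply/funext => z; apply/rowP => i; rewrite !mxE perm1; case: ifP.
rewrite big1// mul1e; apply => // i.
  by case: ifP => // _; exact: measurable_funN.
by move=> A mA; rewrite mul1e; case: ifP => // _; exact: lebesgue_measureN.
Qed.

Definition rV_perm d (s : {perm 'I_d}) (z : 'rV[R]_d) : 'rV[R]_d :=
  \row_i z 0 (s i).

Lemma lebesgue_rV_perm d (s : {perm 'I_d}) (B : set 'rV[R]_d) : measurable B ->
  lebesgue_rV d (rV_perm s @^-1` B) = lebesgue_rV d B.
Proof.
move=> mB; have := @lebesgue_rV_comap d s (fun=> id) (fun=> 1) _ _ _ B mB.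
rewrite (_ : rV_comap _ _ = rV_perm s); last by apply/funext => z; apply/rowP => i; rewrite !mxE.
by rewrite big1// mul1e; apply => // i A mA; rewrite mul1e.
Qed.

End lebesgue_rV_theory.

Section borel_rV.
Context {R : realType} {d : nat}.

(** The sigma-algebra is generated by the coordinates, so an open set has to be exhibited as a
    countable union: the cubes with rational center and radius [m.+1%:R^-1] that it contains. *)
Lemma open_measurable_rV (A : set 'rV[R]_d) : open A -> measurable A.
Proof.
move=> oA.
pose B (k : 'rV[rat]_d * nat) : set 'rV[R]_d :=
  rV_box (fun i => ball (ratr (k.1 0 i) : R) k.2.+1%:R^-1).
rewrite (_ : A = \bigcup_(k in [set k | B k `<=` A]) B k); last first.
  apply/seteqP; split => [x Ax|x [k kA] /kA]//.
  have /nbhs_ballP[e /= e0 xeA] : nbhs x A by exact: open_nbhs_nbhs.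
  have [m me] : exists m : nat, m.+1%:R^-1 < e / 2.
    by exists (Num.trunc (e / 2)^-1); rewrite invf_plt ?posrE ?divr_gt0// truncnS_gt.
  have /choice[q qx] : forall i, exists q : rat, x 0 i - m.+1%:R^-1 < (ratr q : R) < x 0 i + m.+1%:R^-1.
    move=> i; have [|q] := @rat_in_itvoo R (x 0 i - m.+1%:R^-1) (x 0 i + m.+1%:R^-1).
      by rewrite ltrD2l gtrN ?invr_gt0.
    by rewrite in_itv/=; exists q.
  exists (\row_i q i, m) => /=.
    move=> y /= By; apply: xeA; split => // i j; rewrite ord1.
    have := By j; have := qx j; rewrite /ball/= mxE !ltr_norml.
    move: me; move: (m.+1%:R^-1) => w we.
    by move=> /andP[? ?] /andP[? ?]; apply/andP; split; lra.
  move=> i; rewrite /ball/= mxE ltr_norml; have := qx i.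
  move: (m.+1%:R^-1) => w.
  by move=> /andP[? ?]; apply/andP; split; lra.
rewrite (_ : bigcup _ _ =
  \bigcup_n (if unpickle n is Some k then if `[< B k `<=` A >] then B k else set0 else set0)).
  apply: bigcupT_measurable => n; case: (unpickle n) => // k; case: ifP => // _.
  by apply: measurable_rV_box => i; exact: measurable_ball.
apply/seteqP; split => [x [k /= kA kx]|x [n _]].
  by exists (pickle k) => //; rewrite pickleK; case: asboolP.
case: unpickle => // k; case: asboolP => // kA kx; by exists k.
Qed.

Lemma continuous_measurable_rV (D : set 'rV[R]_d) (f : 'rV[R]_d -> R) :
  open D -> (forall x, D x -> {for x, continuous f}) ->
  measurable_fun D (f : _ -> measurableTypeR R).
Proof.
move=> oD cf mD; apply: (measurability _ (RGenOInfty.measurableE R)) => //.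
move=> _ [_ [a ->] <-]; apply: open_measurable_rV.
rewrite openE => x [Dx /= fx]; rewrite /interior.
have /= fax := cf x Dx `]a, +oo[%classic.
near=> y; split; first by near: y; exact: open_nbhs_nbhs.
near: y; apply: fax; apply: open_nbhs_nbhs; split => //.
Unshelve. all: by end_near. Qed.

End borel_rV.

Section change_of_variables.
Context {R : realType} {d : nat}.
Local Notation mu := (lebesgue_rV d : {measure set 'rV[R]_d -> \bar R}).

(** The factor multiplies measures of preimages, so it is the inverse of the Jacobian: [a ^- d] for
    the dilation by [a]. *)
Definition scales_lebesgue (T : 'rV[R]_d -> 'rV[R]_d) (c : R) : Prop :=
  [/\ measurable_fun setT T, 0 <= c &
   forall B, measurable B -> mu (T @^-1` B) = (c%:E * mu B)%E].

Lemma ge0_integral_comap T c (D : set 'rV[R]_d) (f : 'rV[R]_d -> \bar R) :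
  scales_lebesgue T c -> measurable D -> measurable_fun D f ->
  (forall x, D x -> 0 <= f x)%E ->
  (\int[mu]_(x in T @^-1` D) f (T x) = c%:E * \int[mu]_(x in D) f x)%E.
Proof.
move=> [mT c0 mu_T] mD mf f0.
pose T' := HB.pack_for {mfun 'rV[R]_d >-> 'rV[R]_d} T (isMeasurableFun.Build _ _ _ _ _ mT).
have := @ge0_integral_pushforward _ _ _ _ _ T' mT mu D f mD mf.
rewrite /comp /= => <-; last by move=> y /set_mem; exact: f0.
rewrite (@eq_measure_integral _ _ _ _ (mscale (NngNum c0) mu)); last first.
  by move=> A mA _; rewrite /= /pushforward mu_T.
by rewrite ge0_integral_mscale.
Qed.

Lemma Rintegral_comap T c (D : set 'rV[R]_d) (f : 'rV[R]_d -> R) :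
  scales_lebesgue T c -> measurable D -> mu.-integrable D (EFin \o f) ->
  \int[mu]_(x in T @^-1` D) f (T x) = c * \int[mu]_(x in D) f x.
Proof.
move=> sT mD intf; have /integrableP[mf _] := intf.
rewrite /Rintegral integralE.
have ef : (fun x => (f (T x))%:E)%E = (EFin \o f) \o T by [].
rewrite ef funepos_comp funeneg_comp /comp.
rewrite (ge0_integral_comap (f := (EFin \o f)^\+)%E sT mD) //; last exact: measurable_funepos.
rewrite (ge0_integral_comap (f := (EFin \o f)^\-)%E sT mD) //; last exact: measurable_funeneg.
rewrite -muleBr//; last first.
  by apply: fin_num_adde_defl; rewrite fin_numN integrable_neg_fin_num.
rewrite fineM//.
  by rewrite [in RHS]integralE.
by rewrite -integralE; exact: integrable_fin_num.
Qed.

Lemma scales_translate (x : 'rV[R]_d) : scales_lebesgue (fun z => z + x) 1.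
Proof.
split=> // [|B mB]; last by rewrite mul1e; exact: lebesgue_rV_translate.
apply: measurable_fun_rV => i; under eq_fun do rewrite mxE.
by apply: measurable_funD => //; exact: measurable_coord.
Qed.

Lemma scales_dilate (a : R) : 0 < a ->
  scales_lebesgue (fun z : 'rV[R]_d => a *: z) (a ^- d).
Proof.
move=> a0; split=> [||B mB]; last exact: lebesgue_rV_dilate.
  apply: measurable_fun_rV => i; under eq_fun do rewrite mxE.
  by apply: measurable_funM => //; exact: measurable_coord.
by rewrite invr_ge0 exprn_ge0// ltW.
Qed.

Lemma scales_flip (i0 : 'I_d) : scales_lebesgue (@rV_flip R d i0) 1.
Proof.
split=> // [|B mB]; last by rewrite mul1e; exact: lebesgue_rV_flip.
apply: measurable_fun_rV => i; under eq_fun do rewrite mxE.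
case: (i == i0); last exact: measurable_coord.
by apply: measurableT_comp => //; exact: measurable_coord.
Qed.

Lemma scales_perm (s : {perm 'I_d}) : scales_lebesgue (@rV_perm R d s) 1.
Proof.
split=> // [|B mB]; last by rewrite mul1e; exact: lebesgue_rV_perm.
apply: measurable_fun_rV => i; under eq_fun do rewrite mxE.
exact: measurable_coord.
Qed.

End change_of_variables.

(** * Euclidean norm and scalar product *)

Section euclidean_norm.
Context {R : realType} {d : nat}.
Implicit Types (x y z : 'rV[R]_d).

Definition dotr x y : R := \sum_i x 0 i * y 0 i.

Lemma dotrC x y : dotr x y = dotr y x.
Proof. by apply: eq_bigr => i _; rewrite mulrC. Qed.

Lemma dotrDl x y z : dotr (x + y) z = dotr x z + dotr y z.
Proof. by rewrite -big_split; apply: eq_bigr => i _; rewrite mxE mulrDl. Qed.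

Lemma dotrZl a x y : dotr (a *: x) y = a * dotr x y.
Proof. by rewrite mulr_sumr; apply: eq_bigr => i _; rewrite mxE mulrA. Qed.

Lemma dotrDr x y z : dotr x (y + z) = dotr x y + dotr x z.
Proof. by rewrite dotrC dotrDl !(dotrC x). Qed.

Lemma dotrZr a x y : dotr x (a *: y) = a * dotr x y.
Proof. by rewrite dotrC dotrZl (dotrC x). Qed.

Lemma dotrr_ge0 x : 0 <= dotr x x.
Proof. by apply: sumr_ge0 => i _; rewrite -expr2 sqr_ge0. Qed.

Lemma enormE x : enorm x = Num.sqrt (dotr x x).
Proof. by congr Num.sqrt; apply: eq_bigr => i _; rewrite expr2. Qed.

Lemma enorm_ge0 x : 0 <= enorm x.
Proof. exact: sqrtr_ge0. Qed.
Hint Resolve enorm_ge0 : core.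

Lemma sqr_enorm x : enorm x ^+ 2 = dotr x x.
Proof. by rewrite enormE sqr_sqrtr// dotrr_ge0. Qed.

Lemma coord_le_enorm x i : `|x 0 i| <= enorm x.
Proof.
rewrite -(@ler_pXn2r _ 2) ?nnegrE// sqr_enorm /dotr (bigD1 i)//= real_normK ?num_real//.
by rewrite expr2 lerDl sumr_ge0// => j _; rewrite -expr2 sqr_ge0.
Qed.

Lemma enorm_eq0 x : (enorm x == 0) = (x == 0).
Proof.
apply/eqP/eqP => [x0|->].
  apply/rowP => i; rewrite mxE; apply/eqP; rewrite -normr_le0.
  by rewrite -x0 coord_le_enorm.
by rewrite /enorm big1 ?sqrtr0// => i _; rewrite mxE expr0n.
Qed.

Lemma enorm_gt0 x : (0 < enorm x) = (x != 0).
Proof. by rewrite lt_neqAle enorm_ge0 andbT eq_sym enorm_eq0. Qed.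

Lemma enorm0 : enorm (0 : 'rV[R]_d) = 0.
Proof. by apply/eqP; rewrite enorm_eq0. Qed.

Lemma enormZ a x : enorm (a *: x) = `|a| * enorm x.
Proof.
by rewrite !enormE dotrZl dotrZr mulrA -expr2 sqrtrM ?sqr_ge0// sqrtr_sqr.
Qed.

Lemma enormN x : enorm (- x) = enorm x.
Proof. by rewrite -scaleN1r enormZ normrN1 mul1r. Qed.

Lemma enormB x y : enorm (x - y) = enorm (y - x).
Proof. by rewrite -enormN opprB. Qed.

(** Cauchy-Schwarz, from the nonnegativity of the squared norm of
    [dotr y y *: x - dotr x y *: y]. *)
Lemma dotr_le x y : `|dotr x y| <= enorm x * enorm y.
Proof.
rewrite -(@ler_pXn2r _ 2) ?nnegrE ?mulr_ge0// real_normK ?num_real// exprMn !sqr_enorm.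
have [/eqP y0|y0] := boolP (y == 0).
  rewrite y0 (_ : dotr x 0 = 0) ?expr0n//= ?mulr_ge0 ?dotrr_ge0//.
  by apply: big1 => i _; rewrite mxE mulr0.
have b0 : 0 < dotr y y by rewrite -sqr_enorm exprn_gt0// enorm_gt0.
have := dotrr_ge0 (dotr y y *: x + (- dotr x y) *: y).
rewrite !(dotrDl, dotrDr, dotrZl, dotrZr) (dotrC y x).
rewrite (_ : _ + _ = dotr y y * (dotr x x * dotr y y - dotr x y ^+ 2)); last by ring.
by rewrite pmulr_rge0// subr_ge0.
Qed.

Lemma enorm_triangle x y : enorm (x + y) <= enorm x + enorm y.
Proof.
rewrite -(@ler_pXn2r _ 2) ?nnegrE ?addr_ge0// sqr_enorm !(dotrDl, dotrDr) sqrrD !sqr_enorm.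
have := le_trans (ler_norm _) (dotr_le x y); rewrite (dotrC y x); lra.
Qed.

Lemma enorm_dist x y : `|enorm x - enorm y| <= enorm (x - y).
Proof.
rewrite ler_norml; apply/andP; split.
  have := enorm_triangle (y - x) x; rewrite subrK (enormB y); lra.
have := enorm_triangle (x - y) y; rewrite subrK; lra.
Qed.

Lemma enorm_le_coord x (s : R) : (forall i, `|x 0 i| <= s) -> enorm x <= d%:R * s.
Proof.
move=> xs; have [/eqP->|x0] := boolP (x == 0).
  rewrite enorm0; case: (posnP d) => [->|d0]; first by rewrite mul0r.
  by rewrite mulr_ge0// (le_trans _ (xs (Ordinal d0))).
have p : 0 < enorm x by rewrite enorm_gt0.
rewrite -(ler_pM2l p) -expr2 sqr_enorm /dotr.
apply: (@le_trans _ _ (\sum_(i < d) enorm x * s)).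
  apply: ler_sum => i _; apply: le_trans (ler_norm _) _.
  by rewrite normrM ler_pM// coord_le_enorm.
by rewrite sumr_const card_ord -(mulr_natl (enorm x * s)) mulrCA.
Qed.

Lemma enorm_continuous : continuous (@enorm R d).
Proof.
move=> x; apply/(@cvgrPdist_le _ _ _ (nbhs x)) => e e0.
have d1 : 0 < d%:R + 1 :> R by rewrite ltr_wpDl.
have : nbhs x (ball x (e / (d%:R + 1))) by apply: nbhsx_ballx; rewrite divr_gt0.
apply: filterS => y [_ xy]; apply: le_trans (enorm_dist _ _) _.
apply: le_trans (@enorm_le_coord _ (e / (d%:R + 1)) _) _.
  by move=> i; rewrite !mxE ltW//; exact: xy.
by rewrite mulrCA ger_pMr// ler_pdivrMr//; lra.
Qed.

Lemma enorm_flip i x : enorm (rV_flip i x) = enorm x.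
Proof.
by congr Num.sqrt; apply: eq_bigr => j _; rewrite mxE; case: ifP => // _; rewrite sqrrN.
Qed.

Lemma enorm_perm s x : enorm (rV_perm s x) = enorm x.
Proof.
congr Num.sqrt; rewrite [RHS](reindex_inj (@perm_inj _ s)).
by apply: eq_bigr => j _; rewrite mxE.
Qed.

Lemma measurable_enorm : measurable_fun setT (@enorm R d : _ -> measurableTypeR R).
Proof.
apply: continuous_measurable_rV; first exact: openT.
by move=> x _; exact: enorm_continuous.
Qed.

Lemma measurable_ecball x r : measurable (ecball x r).
Proof.
rewrite (_ : ecball x r = (fun y => enorm (y - x)) @^-1` `]-oo, r]%classic); last first.
  by apply/seteqP; split => y; rewrite /ecball/= in_itv.
rewrite -[X in measurable X]setTI.
have [mT _ _] := scales_translate (- x).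
exact: (measurableT_comp measurable_enorm mT).
Qed.

End euclidean_norm.
#[global] Hint Extern 0 (is_true (0 <= enorm _)) => exact: enorm_ge0 : core.

(** * Taylor expansions and the C^k norms *)

Section one_dimensional_taylor.
Context {R : realType}.
Implicit Types f df ddf dddf : R -> R.

(** Increments along the coordinate axes have either sign below, hence a mean value theorem that
    does not order its endpoints. *)
Lemma MVT_signed f df (r : R) :
  (forall t : R, `|t| <= `|r| -> is_derive t 1 f (df t)) ->
  exists2 c, `|c| <= `|r| & f r - f 0 = df c * r.
Proof.
move=> fdf; have cf a b : (forall t, t \in `[a, b]%R -> `|t| <= `|r|) ->
    {within `[a, b], continuous f}.
  move=> H; apply: derivable_within_continuous => t /H /fdf ?.
  exact: ex_derive.
have [r0|r0|->] := ltgtP r 0.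
- have [|||c] := @MVT R f df r 0 => //.
  + move=> t; rewrite in_itv/= => /andP[rt t0]; apply: fdf.
    by rewrite !ltr0_norm// lerN2 ltW.
  + apply: cf => t; rewrite in_itv/= => /andP[rt t0].
    by rewrite ler0_norm// ltr0_norm// lerN2.
  + rewrite in_itv/= => /andP[rc c0] H; exists c; first by rewrite !ltr0_norm// lerN2 ltW.
    by rewrite -opprB H; ring.
- have [|||c] := @MVT R f df 0 r => //.
  + move=> t; rewrite in_itv/= => /andP[rt t0]; apply: fdf.
    by rewrite !gtr0_norm// ltW.
  + apply: cf => t; rewrite in_itv/= => /andP[rt t0].
    by rewrite ger0_norm// gtr0_norm.
  + rewrite in_itv/= => /andP[rc c0] H; exists c; first by rewrite !gtr0_norm// ltW.
    by rewrite H subr0.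
- by exists 0 => //; rewrite subrr mulr0.
Qed.

Lemma taylor_order1 f df (K : R) :
  (forall t : R, 0 <= t <= 1 -> is_derive t 1 f (df t)) ->
  (forall t, 0 <= t <= 1 -> `|df t| <= K) ->
  forall t, 0 <= t <= 1 -> `|f t - f 0| <= K.
Proof.
move=> fdf dfK t /andP[t0 t1].
have [||c] := @MVT_segment R f df 0 t t0.
- move=> s; rewrite in_itv/= => /andP[s0 st]; apply: fdf; rewrite ltW//=; lra.
- apply: derivable_within_continuous => s; rewrite in_itv/= => /andP[s0 st].
  suff /fdf : 0 <= s <= 1 by move=> ?; exact: ex_derive.
  by rewrite s0/=; lra.
rewrite in_itv/= => /andP[c0 ct] ->; rewrite subr0 normrM (ger0_norm t0).
have Kc : `|df c| <= K by apply: dfK; rewrite c0/=; lra.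
by apply: le_trans Kc; rewrite ler_piMr.
Qed.

(** The derivative of the remainder is the remainder of one order less for [df], so the mean value
    theorem raises the order by one. Since [t <= 1], the factorials of the sharp constants are
    dropped. *)
Lemma taylor_order2 f df ddf (K : R) :
  (forall t : R, 0 <= t <= 1 -> is_derive t 1 f (df t)) ->
  (forall t : R, 0 <= t <= 1 -> is_derive t 1 df (ddf t)) ->
  (forall t, 0 <= t <= 1 -> `|ddf t| <= K) ->
  forall t, 0 <= t <= 1 -> `|f t - f 0 - t * df 0| <= K.
Proof.
move=> fdf dfddf ddfK t t01.
have := @taylor_order1 (fun t => f t - t * df 0) (fun t => df t - df 0) K _ _ t t01.
rewrite mul0r subr0 addrAC; apply.
  move=> s s01; have ? := fdf s s01.
  rewrite (_ : (fun _ => _) = f - (df 0 \*: id)); last first.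
    by apply/funext => q; rewrite !fctE/= /GRing.scale/= mulrC.
  by apply: is_derive_eq; rewrite /GRing.scale/= mulr1.
by move=> s s01; exact: (@taylor_order1 df ddf).
Qed.

Lemma taylor_order3 f df ddf dddf (K : R) :
  (forall t : R, 0 <= t <= 1 -> is_derive t 1 f (df t)) ->
  (forall t : R, 0 <= t <= 1 -> is_derive t 1 df (ddf t)) ->
  (forall t : R, 0 <= t <= 1 -> is_derive t 1 ddf (dddf t)) ->
  (forall t, 0 <= t <= 1 -> `|dddf t| <= K) ->
  forall t, 0 <= t <= 1 -> `|f t - f 0 - t * df 0 - t ^+ 2 / 2 * ddf 0| <= K.
Proof.
move=> fdf dfddf ddfdddf dddfK t t01.
have := @taylor_order1 (fun t => f t - t * df 0 - t ^+ 2 / 2 * ddf 0)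
  (fun t => df t - df 0 - t * ddf 0) K _ _ t t01.
rewrite mul0r expr0n/= !mul0r !subr0.
rewrite (_ : f t - t * df 0 - t ^+ 2 / 2 * ddf 0 - f 0 = f t - f 0 - t * df 0 - t ^+ 2 / 2 * ddf 0); last by ring.
apply.
  move=> s s01; have ? := fdf s s01.
  rewrite (_ : (fun _ => _) = f - (df 0 \*: id) - ((ddf 0 / 2) \*: (id ^+ 2))); last first.
    by apply/funext => q; rewrite !fctE/= /GRing.scale/=; ring.
  by apply: is_derive_eq; rewrite /GRing.scale/=; field.
by move=> s s01; exact: (@taylor_order2 df ddf dddf).
Qed.

End one_dimensional_taylor.

Section line_derivative.
Context {R : realType} {d : nat}.
Implicit Types (f u : 'rV[R]_d -> R) (x y z : 'rV[R]_d).

Lemma is_derive_coordinate f x (i : 'I_d) (t : R) :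
  derivable f (x + t *: delta_mx 0 i) (delta_mx 0 i) ->
  is_derive t 1 (fun s : R => f (x + s *: delta_mx 0 i)) (partial i f (x + t *: delta_mx 0 i)).
Proof.
set e := delta_mx 0 i : 'rV[R]_d; move=> df.
have E : (fun h : R => h^-1 *: (((fun s : R => f (x + s *: e)) \o shift t) (h *: (1 : R)) - f (x + t *: e)))
   = (fun h => h^-1 *: ((f \o shift (x + t *: e)) (h *: e) - f (x + t *: e))).
  apply/funext => h /=; congr (_ *: (f _ - _)).
  by rewrite /GRing.scale/= mulr1 -/(GRing.scale _ _) scalerDl addrCA addrA addrC addrA.
by apply: DeriveDef; rewrite /derivable /partial /derive E.
Qed.

Lemma ball_rV_norm x y (r : R) : 0 < r -> (forall i, `|x 0 i - y 0 i| < r) -> ball x r y.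
Proof. by move=> r0 H; split => // i j; rewrite ord1; exact: H. Qed.

(* Telescoping along the coordinate directions reduces the claim to the mean
   value theorem in one variable. *)
Lemma derive_line0 f y z :
  (\forall q \near y, forall i, derivable f q (delta_mx 0 i)) ->
  (forall i, {for y, continuous (partial i f)}) ->
  is_derive (0 : R) 1 (fun t : R => f (y + t *: z)) (\sum_i z 0 i * partial i f y).
Proof.
move=> H1 H2; set D := \sum_i _.
suff cvgD : (fun h : R => h^-1 *: (((fun t : R => f (y + t *: z)) \o shift 0) (h *: (1 : R)) - f (y + 0 *: z))) @ 0^' --> D.
  by apply: DeriveDef; [apply/cvg_ex; exists D|exact: cvg_lim].
apply/cvgrPdist_le => e e0.
pose S := \sum_i `|z 0 i| + 1.
have S0 : 0 < S by rewrite ltr_wpDl// sumr_ge0.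
have zS i : `|z 0 i| <= S.
  by rewrite /S (bigD1 i)//= -addrA lerDl addr_ge0// sumr_ge0.
pose e' := e / S; have e'0 : 0 < e' by rewrite divr_gt0.
have : \forall q \near y, (forall i, derivable f q (delta_mx 0 i)) /\
    (forall i, `|partial i f y - partial i f q| <= e').
  apply: filterI; first exact: H1.
  apply: (@filter_forall _ _ (fun i q => `|partial i f y - partial i f q| <= e') (nbhs y)) => i.
  by move/(_ i)/(@cvgrPdist_le _ _ _ (nbhs y)) : H2; apply.
move=> /nbhs_ballP[del /= del0 Hdel].
near=> h.
have h0 : h != 0 by near: h; exact: nbhs_dnbhs_neq.
have hdel : `|h| * S < del.
  by rewrite -ltr_pdivlMr//; near: h; apply: dnbhs0_lt; rewrite divr_gt0.
rewrite /= addr0 scale0r addr0 /GRing.scale/= mulr1.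
pose p (k : nat) := y + h *: \row_i (if (i < k)%N then z 0 i else 0).
have p0 : p 0%N = y by rewrite /p (_ : \row__ _ = 0) ?scaler0 ?addr0//; apply/rowP => i; rewrite !mxE.
have pd : p d = y + h *: z by rewrite /p; congr (_ + _ *: _); apply/rowP => i; rewrite !mxE ltn_ord.
have step (k : 'I_d) : exists c : R, `|c - partial k f y| <= e' /\
    f (p k.+1) - f (p k) = c * (h * z 0 k).
  have inball (t : R) : `|t| <= `|h * z 0 k| -> ball y del (p k + t *: delta_mx 0 k).
    move=> th; apply: ball_rV_norm => // j.
    have -> : y 0 j - (p k + t *: delta_mx 0 k) 0 j =
        - (if (j < k)%N then h * z 0 j else if j == k then t else 0).
      rewrite !mxE eqxx/=; have [jk|kj|jk] := ltngtP j k.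
      - by rewrite (_ : j == k = false) ?mulr0 ?addr0; [ring|apply/eqP => E; move: jk; rewrite E ltnn].
      - by rewrite (_ : j == k = false) ?mulr0 ?addr0; [ring|apply/eqP => E; move: kj; rewrite E ltnn].
      - by rewrite (_ : j == k) ?mulr1 ?mulr0; [ring|apply/eqP/val_inj].
    rewrite normrN; have hz i : `|h * z 0 i| < del.
      by rewrite normrM; apply: le_lt_trans hdel; rewrite ler_wpM2l.
    case: ifP => _ //; case: ifP => _; last by rewrite normr0.
    exact: le_lt_trans th _.
  have [|c ch Ec] := @MVT_signed R (fun t => f (p k + t *: delta_mx 0 k))
      (fun t => partial k f (p k + t *: delta_mx 0 k)) (h * z 0 k).
    move=> t th; apply: is_derive_coordinate.
    by have [] := Hdel _ (inball t th).
  exists (partial k f (p k + c *: delta_mx 0 k)); split.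
    by rewrite distrC; have [_] := Hdel _ (inball c ch); exact.
  rewrite -Ec scale0r addr0; congr (f _ - _).
  apply/rowP => j; rewrite !mxE eqxx/= ltnS leq_eqVlt.
  have [->|jk] := eqVneq j k; first by rewrite eqxx ltnn/=; ring.
  by rewrite (inj_eq val_inj) (negbTE jk)/= mulr0 addr0.
have /choice[c Hc] := step.
have -> : f (y + h *: z) - f y = \sum_i c i * (h * z 0 i).
  rewrite -pd -p0 -(@telescope_sumr _ 0 d (fun k => f (p k)))// big_mkord.
  by apply: eq_bigr => k _; have [_ ->] := Hc k.
have -> : D - h^-1 * (\sum_i c i * (h * z 0 i)) = \sum_i z 0 i * (partial i f y - c i).
  rewrite mulr_sumr -sumrB; apply: eq_bigr => i _; field.
  by [].
apply: le_trans (ler_norm_sum _ _ _) _.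
apply: (@le_trans _ _ (\sum_i `|z 0 i| * e')).
  by apply: ler_sum => i _; rewrite normrM ler_wpM2l// distrC; have [] := Hc i.
rewrite -mulr_suml /e' mulrA ler_pdivrMr// mulrC ler_wpM2l// ?ltW//.
by rewrite /S ltrDl.
Unshelve. all: by end_near. Qed.

Lemma derive_line f y z (t : R) :
  (\forall q \near (y + t *: z), forall i, derivable f q (delta_mx 0 i)) ->
  (forall i, {for y + t *: z, continuous (partial i f)}) ->
  is_derive t 1 (fun s : R => f (y + s *: z)) (\sum_i z 0 i * partial i f (y + t *: z)).
Proof.
move=> H1 H2; have H := derive_line0 z H1 H2.
have E : (fun h : R => h^-1 *: (((fun s : R => f (y + s *: z)) \o shift t) (h *: (1 : R)) - f (y + t *: z)))
   = (fun h : R => h^-1 *: (((fun s : R => f (y + t *: z + s *: z)) \o shift 0) (h *: (1 : R)) - f (y + t *: z + 0 *: z))).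
  apply/funext => h /=; rewrite scale0r !addr0; congr (_ *: (f _ - _)).
  by rewrite scalerDl (addrC (h *: _ *: z)) addrA.
case: H => H3 H4.
by apply: DeriveDef; rewrite /derivable /derive E.
Qed.

End line_derivative.

Section Ck_functions.
Context {R : realType} {d : nat}.
Variable Om : set 'rV[R]_d.
Hypothesis oOm : open Om.
Implicit Types (f u : 'rV[R]_d -> R) (x y z : 'rV[R]_d) (s : seq 'I_d).

Lemma is_Ck_partials k m u s : is_Ck k Om u -> (size s + m <= k)%N ->
  is_Ck m Om (partials s u).
Proof.
move=> uk sk s'; have [H1 H2] := uk (s' ++ s).
rewrite /partials foldr_cat -/(partials s u) in H1 H2.
split => s'm; [apply: H1|apply: H2]; rewrite size_cat.
  by apply: leq_trans sk; rewrite addnC ltn_add2l.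
by apply: leq_trans sk; rewrite addnC leq_add2l.
Qed.

Lemma is_Ck_le k m u : is_Ck k Om u -> (m <= k)%N -> is_Ck m Om u.
Proof. by move=> uk mk; exact: (@is_Ck_partials k m u [::]). Qed.

Lemma is_Ck_line k u s y z (t : R) : is_Ck k Om u -> (size s < k)%N ->
  Om (y + t *: z) ->
  is_derive t 1 (fun q : R => partials s u (y + q *: z))
    (\sum_i z 0 i * partials (i :: s) u (y + t *: z)).
Proof.
move=> uk sk Oy; apply: derive_line.
  have : nbhs (y + t *: z) Om by exact: open_nbhs_nbhs.
  by apply: filterS => q Oq i; have [H _] := uk s; exact: H.
by move=> i; have [_ H] := uk (i :: s); exact: H.
Qed.

Lemma partials_cons_eq u u' s s' i : (forall x, Om x -> partials s u x = partials s' u' x) ->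
  forall x, Om x -> partials (i :: s) u x = partials (i :: s') u' x.
Proof.
move=> E x Ox; apply: near_eq_derive.
have : nbhs x Om by exact: open_nbhs_nbhs.
by apply: filterS => q; exact: E.
Qed.

(* The second difference of [u] over a small square is expressed with either
   order of differentiation by applying the mean value theorem twice. *)
Lemma second_difference u (i j : 'I_d) x (h : R) : is_Ck 2 Om u ->
  (forall a b, `|a| <= `|h| -> `|b| <= `|h| ->
     Om (x + a *: delta_mx 0 i + b *: delta_mx 0 j)) ->
  exists a b, [/\ `|a| <= `|h|, `|b| <= `|h| &
   u (x + h *: delta_mx 0 i + h *: delta_mx 0 j) - u (x + h *: delta_mx 0 i)
    - (u (x + h *: delta_mx 0 j) - u x) =
   partials [:: j; i] u (x + a *: delta_mx 0 i + b *: delta_mx 0 j) * h * h].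
Proof.
move=> uk HOm.
have C0 : `|0 : R| <= `|h| by rewrite normr0.
have [|a ah Ea] := @MVT_signed R
   (fun a => u (x + a *: delta_mx 0 i + h *: delta_mx 0 j) - u (x + a *: delta_mx 0 i))
   (fun a => partial i u (x + a *: delta_mx 0 i + h *: delta_mx 0 j)
             - partial i u (x + a *: delta_mx 0 i)) h.
  move=> a ah.
  have [H _] := uk [::].
  apply: is_deriveB.
    have E : (fun a : R => u (x + a *: delta_mx 0 i + h *: delta_mx 0 j)) =
       (fun a : R => u ((x + h *: delta_mx 0 j) + a *: delta_mx 0 i)).
      by apply/funext => q; rewrite addrAC.
    rewrite E (addrAC x); apply: is_derive_coordinate; apply: H => //.
    by rewrite addrAC; exact: HOm.
  apply: is_derive_coordinate; apply: H => //.
  by have := HOm a 0 ah C0; rewrite scale0r addr0.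
have [|b bh Eb] := @MVT_signed R
   (fun b => partial i u (x + a *: delta_mx 0 i + b *: delta_mx 0 j))
   (fun b => partial j (partial i u) (x + a *: delta_mx 0 i + b *: delta_mx 0 j)) h.
  move=> b bh; apply: is_derive_coordinate; have [H _] := uk [:: i]; apply: H => //.
  exact: HOm.
exists a, b; split => //.
move: Ea Eb; rewrite !scale0r !addr0 => -> ->; by rewrite /=.
Qed.

(** The second difference over a small square is symmetric in the two directions, so the two mixed
    derivatives agree at two points of the square; continuity carries the equality to [x]. *)
Lemma schwarz_partials u (i j : 'I_d) x : is_Ck 2 Om u -> Om x ->
  partials [:: i; j] u x = partials [:: j; i] u x.
Proof.
move=> uk Ox; apply/eqP; rewrite -subr_eq0 -normr_le0; apply/ler_addgt0Pr => e e0.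
rewrite add0r.
have e20 : 0 < e / 2 by rewrite divr_gt0.
have cont s : (size s <= 2)%N -> \forall q \near x, `|partials s u x - partials s u q| <= e / 2.
  by move=> s2; have [_ /(_ s2 x Ox)] := uk s; move/(@cvgrPdist_le _ _ _ (nbhs x)); apply.
have : \forall q \near x, [/\ Om q, `|partials [:: i; j] u x - partials [:: i; j] u q| <= e / 2
    & `|partials [:: j; i] u x - partials [:: j; i] u q| <= e / 2].
  have Ox' : nbhs x Om by exact: open_nbhs_nbhs.
  apply: filterS3 Ox' (cont [:: i; j] isT) (cont [:: j; i] isT) => q ? ? ?.
  by split.
move=> /nbhs_ballP[del /= del0 Hdel].
(* Two moves of length at most [h] may add up in one coordinate, and [2 * h < del]. *)
pose h := del / 3; have h0 : 0 < h by rewrite divr_gt0.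
have inball (k l : 'I_d) (a b : R) : `|a| <= `|h| -> `|b| <= `|h| ->
    ball x del (x + a *: delta_mx 0 k + b *: delta_mx 0 l).
  rewrite (gtr0_norm h0) => ah bh; apply: ball_rV_norm => // m.
  rewrite !mxE eqxx /= opprD addrA opprD addrA subrr sub0r.
  have hh : forall c : bool, `|a * c%:R| <= h /\ `|b * c%:R| <= h.
    by case; rewrite ?mulr1 ?mulr0 ?normr0; split => //; exact: ltW.
  apply: le_lt_trans (ler_normB _ _) _; rewrite normrN.
  apply: (@le_lt_trans _ _ (h + h)); last by rewrite /h; lra.
  by rewrite lerD//; [have [] := hh (m == k)|have [] := hh (m == l)].
have [|a [b [ah bh E1]]] := @second_difference u i j x h uk.
  by move=> a b ah bh; have [] := Hdel _ (inball i j a b ah bh).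
have [|a' [b' [ah' bh' E2]]] := @second_difference u j i x h uk.
  by move=> a' b' ah' bh'; have [] := Hdel _ (inball j i a' b' ah' bh').
have K1 : `|partials [:: j; i] u x - partials [:: j; i] u (x + a *: delta_mx 0 i + b *: delta_mx 0 j)| <= e / 2.
  by have [_ _ K] := Hdel _ (inball i j a b ah bh); exact: K.
have K2 : `|partials [:: i; j] u x - partials [:: i; j] u (x + a' *: delta_mx 0 j + b' *: delta_mx 0 i)| <= e / 2.
  by have [_ K _] := Hdel _ (inball j i a' b' ah' bh'); exact: K.
have E : partials [:: j; i] u (x + a *: delta_mx 0 i + b *: delta_mx 0 j) =
         partials [:: i; j] u (x + a' *: delta_mx 0 j + b' *: delta_mx 0 i).
  have hn0 : h != 0 by rewrite gt_eqF.
  suff /(mulIf hn0)/(mulIf hn0) : partials [:: j; i] u (x + a *: delta_mx 0 i + b *: delta_mx 0 j) * h * h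
      = partials [:: i; j] u (x + a' *: delta_mx 0 j + b' *: delta_mx 0 i) * h * h by [].
  apply: etrans (esym E1) (etrans _ E2).
  have -> : x + h *: delta_mx 0 j + h *: delta_mx 0 i = x + h *: delta_mx 0 i + h *: delta_mx 0 j.
    by rewrite addrAC.
  have aux (p q r s : R) : p - q - (r - s) = p - r - (q - s) by ring.
  exact: aux.
rewrite E in K1; apply: le_trans (ler_distD (partials [:: i; j] u (x + a' *: delta_mx 0 j + b' *: delta_mx 0 i)) _ _) _.
by rewrite [leRHS]splitr; apply: lerD; [exact: K2|rewrite distrC; exact: K1].
Qed.

(** The norms are indexed by multi-indices while derivatives come as words of indices. The head of
    [s] is located in [s'] and brought to the front by swaps of neighbours, each an instance of
    [schwarz_partials]. *)
Lemma partials_perm k u s s' x : is_Ck k Om u -> (size s <= k)%N ->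
  perm_eq s s' -> Om x -> partials s u x = partials s' u x.
Proof.
move=> uk; elim: s s' x => [s' x _|i s IH s' x sk].
  by rewrite perm_sym => /perm_nilP ->.
move=> ss' Ox; have is' : i \in s' by rewrite -(perm_mem ss') mem_head.
have [a [b E]] : exists a b, s' = a ++ i :: b by case/splitPr: is' => a b; exists a, b.
rewrite {is'}E in ss' *.
have sab : perm_eq s (a ++ b) by rewrite -(perm_cons i) (perm_trans ss')// perm_catC /= perm_cons perm_catC.
have szk : (size (a ++ i :: b) <= k)%N by rewrite -(perm_size ss').
transitivity (partials (i :: a ++ b) u x).
  by apply: partials_cons_eq => // q Oq; apply: IH => //; exact: ltnW.
elim: a x Ox szk {ss' sab} => [//|j a IHa] x Ox szk.
rewrite !cat_cons; apply: etrans (schwarz_partials (u := partials (a ++ b) u) i j _ Ox) _.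
  apply: is_Ck_partials uk _.
  by move: szk; rewrite /= !size_cat /= addn2 addnS.
by apply: (@partials_cons_eq u u (i :: a ++ b)) => // q Oq; apply: IHa => //; exact: ltnW.
Qed.

End Ck_functions.

Section Ck_norm_bounds.
Context {R : realType} {d : nat}.
Variable Om : set 'rV[R]_d.
Hypotheses (oOm : open Om) (bOm : bounded_set Om).
Implicit Types (f u : 'rV[R]_d -> R) (x y z : 'rV[R]_d) (s : seq 'I_d).

Lemma compact_closure_bounded : compact (closure Om).
Proof.
apply: bounded_closed_compact; last exact: closed_closure.
have [M [Mr HM]] := bOm; exists M; split => // N MN x clx.
apply/ler_addgt0Pr => e e0.
have [y [Oy [_ xy]]] := clx _ (nbhsx_ballx x e e0).
have yN : `|y| <= N by exact: HM.
rewrite -(subrK y x); apply: le_trans (ler_normD _ _) _; rewrite addrC lerD//.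
have -> : `|x - y| = mx_norm (x - y) by [].
rewrite mx_normrE; apply: bigmax_le => [|[i j] _ /=]; first exact: ltW.
by rewrite !mxE ltW//; exact: xy.
Qed.

(** The continuous extension of the derivative is bounded on the compact closure. This is what makes
    the [sup] in [Ck_norm] an upper bound of the values. *)
Lemma partials_bounded k u s : is_Ck_closure k Om u -> (size s <= k)%N ->
  exists M, forall x, Om x -> `|partials s u x| <= M.
Proof.
move=> [_ _ H] sk; have [g cg Eg] := H s sk.
have /compact_bounded[M [Mr HM]] := continuous_compact cg compact_closure_bounded.
exists (M + 1) => x Ox; rewrite (Eg x); last exact/mem_set.
apply: (HM (M + 1)); first by rewrite ltrDl.
by exists x => //; exact: subset_closure.
Qed.

(** The letter counts of the word [s] form a multi-index of order at most [k], and its supremum is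
    one of the nonnegative terms of the norm. *)
Lemma partials_le_Ck_norm k u s (B : set 'rV[R]_d) y : is_Ck_closure k Om u ->
  (size s <= k)%N -> B `<=` Om -> B y -> `|partials s u y| <= Ck_norm k B u.
Proof.
move=> uk sk BO By.
pose a : {ffun 'I_d -> 'I_k.+1} := [ffun i => inord (count_mem i s)].
have aE i : a i = count_mem i s :> nat.
  by rewrite ffunE inordK// ltnS (leq_trans (count_size _ _)).
have suma : (\sum_i a i <= k)%N.
  apply: leq_trans sk; rewrite (eq_bigr (fun i => count_mem i s)); last by move=> i _; exact: aE.
  rewrite -sum1_size; under eq_bigr do rewrite -sum1_count.
  rewrite (exchange_big_dep xpredT)//=; apply: leq_sum => j _.
  by rewrite (big_pred1 j)// => i /=; rewrite eq_sym.
have sup_ge0 (b : {ffun 'I_d -> 'I_k.+1}) : (\sum_i b i <= k)%N ->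
    has_ubound [set `|multi_partial (fun i => b i) u x| | x in B].
  move=> bk; have [|M HM] := @partials_bounded k u (flatten [seq nseq (b i) i | i <- enum 'I_d]) uk.
    rewrite size_flatten /shape -map_comp sumnE big_map big_enum /=.
    by under eq_bigr do rewrite size_nseq.
  by exists M => _ [x Bx <-]; apply: HM; exact: BO.
rewrite /Ck_norm (bigD1 a)//=.
have H : `|partials s u y| <= sup [set `|multi_partial (fun i => a i) u x| | x in B].
  apply: ub_le_sup; first exact: sup_ge0.
  exists y => //; congr `|_|; have [ukk _ _] := uk.
  apply/esym; apply: (partials_perm oOm ukk sk _ (BO _ By)).
  apply/allP => j _ /=; rewrite count_flatten -map_comp sumnE big_map big_enum /=.
  rewrite (bigD1 j)//= count_nseq /= eqxx mul1n aE big1 ?addn0//.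
  by move=> i ij; rewrite count_nseq /= (negbTE ij).
apply: le_trans H _; rewrite lerDl; apply: sumr_ge0 => b /andP[bk _].
apply: le_trans (ub_le_sup (sup_ge0 b bk) _); last by exists y.
exact: normr_ge0.
Qed.

End Ck_norm_bounds.

Section multivariate_taylor.
Context {R : realType} {d : nat}.
Variables (Om : set 'rV[R]_d) (u : 'rV[R]_d -> R) (x z : 'rV[R]_d) (M : R).
Hypotheses (oOm : open Om) (segOm : forall t : R, 0 <= t <= 1 -> Om (x + t *: z)).

Lemma weighted_sum_le (F : 'I_d -> R) K : (forall i, `|F i| <= K) ->
  `|\sum_i z 0 i * F i| <= d%:R * (enorm z * K).
Proof.
move=> FK; apply: le_trans (ler_norm_sum _ _ _) _.
apply: (@le_trans _ _ (\sum_(i < d) enorm z * K)).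
  by apply: ler_sum => i _; rewrite normrM ler_pM// coord_le_enorm.
by rewrite sumr_const card_ord -(mulr_natl (enorm z * K)).
Qed.

Let line1 (s : seq 'I_d) k (t : R) : is_Ck k Om u -> (size s < k)%N -> 0 <= t <= 1 ->
  is_derive t 1 (fun q : R => partials s u (x + q *: z))
    (\sum_i z 0 i * partials (i :: s) u (x + t *: z)).
Proof. by move=> uk sk t01; apply: is_Ck_line uk sk _ => //; exact: segOm. Qed.

Let is_derive_wsum (F : 'I_d -> R -> R) (dF : 'I_d -> R) (t : R) :
  (forall i, is_derive t 1 (F i) (dF i)) ->
  is_derive t 1 (fun q : R => \sum_i z 0 i * F i q) (\sum_i z 0 i * dF i).
Proof.
move=> H; rewrite (_ : (fun _ => _) = \sum_(i < d) (z 0 i \*: F i)).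
  by apply: is_derive_sum => i; have ? := H i; exact: is_deriveZ.
by apply/funext => q; rewrite fct_sumE.
Qed.

Lemma taylor1_le : is_Ck 1 Om u ->
  (forall i y, (exists2 t : R, 0 <= t <= 1 & y = x + t *: z) -> `|partials [:: i] u y| <= M) ->
  `|u (x + z) - u x| <= d%:R * (enorm z * M).
Proof.
move=> uk uM; have := @taylor_order1 R (fun t => u (x + t *: z))
  (fun t => \sum_i z 0 i * partials [:: i] u (x + t *: z)) (d%:R * (enorm z * M)) _ _ 1.
rewrite scale1r scale0r addr0; apply; rewrite ?ler01 ?lexx//.
- by move=> t t01; exact: (line1 (s := [::])) uk _ t01.
- by move=> t t01; apply: weighted_sum_le => i; apply: uM; exists t.
Qed.

Lemma taylor2_le : is_Ck 2 Om u ->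
  (forall i j y, (exists2 t : R, 0 <= t <= 1 & y = x + t *: z) -> `|partials [:: j; i] u y| <= M) ->
  `|u (x + z) - u x - \sum_i z 0 i * partial i u x| <= d%:R * (enorm z * (d%:R * (enorm z * M))).
Proof.
move=> uk uM; have := @taylor_order2 R (fun t => u (x + t *: z))
  (fun t => \sum_i z 0 i * partials [:: i] u (x + t *: z))
  (fun t => \sum_i z 0 i * \sum_j z 0 j * partials [:: j; i] u (x + t *: z))
  (d%:R * (enorm z * (d%:R * (enorm z * M)))) _ _ _ 1.
rewrite scale1r scale0r addr0 mul1r; apply; rewrite ?ler01 ?lexx//.
- by move=> t t01; exact: (line1 (s := [::])) uk _ t01.
- by move=> t t01; apply: is_derive_wsum => i; exact: line1 uk _ t01.
- by move=> t t01; apply: weighted_sum_le => i; apply: weighted_sum_le => j; apply: uM; exists t.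
Qed.

Lemma taylor3_le : is_Ck 3 Om u ->
  (forall i j l y, (exists2 t : R, 0 <= t <= 1 & y = x + t *: z) -> `|partials [:: l; j; i] u y| <= M) ->
  `|u (x + z) - u x - \sum_i z 0 i * partial i u x -
    2^-1 * \sum_i z 0 i * \sum_j z 0 j * partials [:: j; i] u x| <=
  d%:R * (enorm z * (d%:R * (enorm z * (d%:R * (enorm z * M))))).
Proof.
move=> uk uM; have := @taylor_order3 R (fun t => u (x + t *: z))
  (fun t => \sum_i z 0 i * partials [:: i] u (x + t *: z))
  (fun t => \sum_i z 0 i * \sum_j z 0 j * partials [:: j; i] u (x + t *: z))
  (fun t => \sum_i z 0 i * \sum_j z 0 j * \sum_l z 0 l * partials [:: l; j; i] u (x + t *: z))
  (d%:R * (enorm z * (d%:R * (enorm z * (d%:R * (enorm z * M)))))) _ _ _ _ 1.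
rewrite scale1r scale0r addr0 !mul1r expr1n mul1r; apply; rewrite ?ler01 ?lexx//.
- by move=> t t01; exact: (line1 (s := [::])) uk _ t01.
- by move=> t t01; apply: is_derive_wsum => i; exact: line1 uk _ t01.
- move=> t t01; apply: is_derive_wsum => i; apply: is_derive_wsum => j.
  exact: line1 uk _ t01.
- move=> t t01; apply: weighted_sum_le => i; apply: weighted_sum_le => j.
  by apply: weighted_sum_le => l; apply: uM; exists t.
Qed.

End multivariate_taylor.

(** * Balls contained in the domain *)

Section inner_ball.
Context {R : realType} {d : nat}.
Variable Om : set 'rV[R]_d.
Hypothesis oOm : open Om.

(* The last point of the segment from [x] that can be reached inside [Om] is a
   boundary point. *)
Lemma inner_domain_ball (x : 'rV[R]_d) (r : R) : inner_domain Om r x -> ecball x r `<=` Om.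
Proof.
move=> [Ox Hx] y xy; apply: contrapT => nOy.
have /negP : ~ dist_boundary Om x <= r by move=> H; exact: Hx.
rewrite -ltNge => rlt.
pose z := y - x.
pose A : set R := [set t | 0 <= t /\ ~ Om (x + t *: z)].
have A1 : A 1 by split => //; rewrite scale1r /z addrC subrK.
have lbA : has_lbound A by exists 0 => t [].
have infA : has_inf A by split => //; exists 1.
pose t0 := inf A.
have t01 : t0 <= 1 by apply: ge_inf.
have t00 : 0 <= t0 by apply: lb_le_inf; [exists 1|move=> t []].
have below (t : R) : 0 <= t -> t < t0 -> Om (x + t *: z).
  move=> tp tt0; apply: contrapT => nO.
  by move: tt0; rewrite ltNge => /negP; apply; apply: ge_inf.
pose S := enorm z + 1; have S0 : 0 < S by rewrite ltr_wpDl.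
have zS i : `|z 0 i| <= S by apply: le_trans (coord_le_enorm z i) _; rewrite lerDl.
have close (t e : R) : 0 < e -> `|t - t0| * S < e -> ball (x + t0 *: z) e (x + t *: z).
  move=> e0 te; apply: ball_rV_norm => // i.
  rewrite !mxE opprD addrACA subrr add0r -mulrBl normrM distrC.
  apply: le_lt_trans te; rewrite ler_wpM2l//.
  by have := zS i; rewrite !mxE.
have nO0 : ~ Om (x + t0 *: z).
  move=> O0; have /nbhs_ballP[e /= e0 He] : nbhs (x + t0 *: z) Om by exact: open_nbhs_nbhs.
  have [t At tlt] := inf_adherent (divr_gt0 e0 S0) infA.
  have t0t : t0 <= t by apply: ge_inf.
  case: At => _; apply; apply: He; apply: close => //.
  by rewrite ger0_norm ?subr_ge0// -ltr_pdivlMr// ltrBlDl.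
have t0pos : 0 < t0.
  rewrite lt_neqAle t00 andbT; apply/eqP => E; apply: nO0.
  by rewrite -E scale0r addr0.
have clO : closure Om (x + t0 *: z).
  move=> B /nbhs_ballP[e /= e0 HB].
  pose t := t0 - Num.min t0 (e / (2 * S)).
  have m0 : 0 < Num.min t0 (e / (2 * S)) by rewrite lt_min t0pos divr_gt0// mulr_gt0.
  exists (x + t *: z); split.
    apply: below; last by rewrite /t ltrBlDr ltrDl.
    by rewrite /t subr_ge0 ge_min lexx.
  apply: HB; apply: close => //; rewrite /t addrAC subrr add0r normrN gtr0_norm//.
  apply: (@le_lt_trans _ _ (e / (2 * S) * S)).
    by rewrite ler_pM2r// ge_min lexx orbT.
  by rewrite (_ : e / (2 * S) * S = e / 2); [lra|field; rewrite gt_eqF].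
have bd : boundary Om (x + t0 *: z).
  split => //; move=> /interior_subset; exact: nO0.
move: rlt; apply/negP; rewrite -leNgt.
apply: (@le_trans _ _ (enorm (x - (x + t0 *: z)))).
  apply: ge_inf; last by exists (x + t0 *: z).
  by exists 0 => _ [w _ <-].
rewrite opprD addrA subrr sub0r enormN enormZ ger0_norm//.
by apply: le_trans xy; rewrite ler_piMl.
Qed.

End inner_ball.

(** * Concentration of sums of independent variables *)

Section image_density.
Local Open Scope ereal_scope.
Context d1 d2 (T : measurableType d1) (Y : measurableType d2) (R : realType).
Variables (mu : {measure set T -> \bar R}) (nu : {measure set Y -> \bar R}).
Variables (X : T -> Y) (W : T -> R).
Hypotheses (mX : measurable_fun setT X) (mW : measurable_fun setT W)
  (W0 : forall t, (0 <= W t)%R).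
Hypothesis nuE : forall A, measurable A -> nu A = \int[mu]_(t in X @^-1` A) (W t)%:E.

Let mpre A : measurable A -> measurable (X @^-1` A).
Proof. by move=> mA; rewrite -[X in measurable X]setTI; exact: mX. Qed.

Let density_indic E : measurable E ->
  \int[nu]_y (\1_E y)%:E = \int[mu]_t ((\1_E (X t))%:E * (W t)%:E).
Proof.
move=> mE; rewrite integral_indic// setIT nuE// integral_mkcond.
apply: eq_integral => t _; rewrite patchE indicE.
have -> : (t \in X @^-1` E) = (X t \in E) by apply/idP/idP => /set_mem ?; apply/mem_set.
by case: ifP => _; rewrite ?mul1e ?mul0e.
Qed.

Import HBNNSimple.

Let mW_indic E : measurable E -> measurable_fun setT (fun t => (\1_E (X t))%:E * (W t)%:E).
Proof.
move=> mE; apply: emeasurable_funM; last exact/measurable_EFinP.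
by apply/measurable_EFinP; apply: measurableT_comp => //.
Qed.

Let density_nnsfun (h : {nnsfun Y >-> R}) :
  \int[nu]_y (h y)%:E = \int[mu]_t ((h (X t))%:E * (W t)%:E).
Proof.
under [LHS]eq_integral do rewrite fimfunE -fsumEFin//.
rewrite [LHS]ge0_integral_fsum//; last 2 first.
  - by move=> r; exact/measurable_EFinP/measurableT_comp.
  - by move=> n x _; rewrite EFinM nnfun_muleindic_ge0.
under [RHS]eq_integral.
  move=> x xD; rewrite fimfunE -fsumEFin// ge0_mule_fsuml; last first.
    by move=> r; rewrite EFinM nnfun_muleindic_ge0.
  over.
rewrite [RHS]ge0_integral_fsum//; last 2 first.
  - move=> r; under eq_fun do rewrite EFinM -muleA.
    by apply: emeasurable_funM; [exact/measurable_EFinP/measurable_cst|exact: mW_indic].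
  - move=> n x _; apply: mule_ge0; last by rewrite lee_fin.
    by rewrite EFinM nnfun_muleindic_ge0.
apply: eq_fsbigr => r rh.
have r0 : (0 <= r)%R by move/set_mem : rh => [y _ <-].
under [LHS]eq_integral do rewrite EFinM.
rewrite ge0_integralZl//; last exact/measurable_EFinP.
rewrite density_indic// -ge0_integralZl//.
- by apply: eq_integral => t _; rewrite EFinM muleA.
- exact: mW_indic.
- by move=> t _; rewrite mule_ge0// lee_fin.
Qed.

(** Approximation by simple functions and monotone convergence. It serves twice: for the expectation
    of a product, where [W] is the product of the other factors, and for the law with density [rho],
    where [X] is the identity. *)
Lemma ge0_integral_image_density (h : Y -> \bar R) :
  measurable_fun setT h -> (forall y, 0 <= h y) ->
  \int[nu]_y h y = \int[mu]_t (h (X t) * (W t)%:E).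
Proof.
move=> mh h0; pose h_ := nnsfun_approx measurableT mh.
transitivity (limn (fun n => \int[nu]_y (h_ n y)%:E)).
  rewrite -monotone_convergence//=.
  - apply: eq_integral => x _; apply/esym/cvg_lim => //=.
    by apply: cvg_nnsfun_approx => // y _.
  - by move=> n; apply: measurableT_comp => //; exact: measurable_funTS.
  - by move=> n x _; rewrite lee_fin.
  - by move=> x _ a b ab; rewrite lee_fin//; exact/lefP/nd_nnsfun_approx.
transitivity (limn (fun n => \int[mu]_t ((h_ n (X t))%:E * (W t)%:E))).
  by congr (limn _); apply/funext => n /=; rewrite density_nnsfun.
rewrite -monotone_convergence//=.
- apply: eq_integral => t _; apply/cvg_lim => //=.
  apply: cvgeZr => //.
  by apply: cvg_nnsfun_approx => // y _.
- move=> n; apply: emeasurable_funM; last exact/measurable_EFinP.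
  apply/measurable_EFinP.
  exact: measurableT_comp.
- by move=> n x _; rewrite mule_ge0// lee_fin.
- move=> x _ a b ab; rewrite lee_wpmul2r// lee_fin//.
  exact/lefP/nd_nnsfun_approx.
Qed.

End image_density.

Section exceptional_probability.
Context {R : realType} {dT : measure_display} {T : measurableType dT}.
Variable P : probability T R.

(** Here [e] bounds the probability of the complement, so that errors add under intersections. *)
Definition holds_up_to (e : R) (A : set T) : Prop :=
  measurable A /\ (P (~` A) <= e%:E)%E.

Lemma holds_up_toI e1 e2 A B : holds_up_to e1 A -> holds_up_to e2 B ->
  holds_up_to (e1 + e2) (A `&` B).
Proof.
move=> [mA PA] [mB PB]; split; first exact: measurableI.
rewrite setCI; apply: le_trans (measureU2 _ _ _) _; try exact: measurableC.
by rewrite EFinD leeD.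
Qed.

Lemma holds_up_to_bigcap (I : finType) e (A : I -> set T) :
  0 <= e -> (forall i, holds_up_to e (A i)) ->
  holds_up_to (#|I|%:R * e) (\bigcap_(i in [set: I]) A i).
Proof.
move=> e0 HA.
have H (s : seq I) : holds_up_to ((size s)%:R * e) [set w | forall i, i \in s -> A i w].
  elim: s => [|i s [mS PS]].
    rewrite (_ : [set _ | _] = setT); last by apply/seteqP; split.
    by split => //; rewrite setCT measure0 lee_fin mul0r.
  rewrite (_ : [set _ | _] = A i `&` [set w | forall i, i \in s -> A i w]).
    by rewrite /= -natr1 mulrDl mul1r addrC; apply: holds_up_toI => //; split.
  apply/seteqP; split => [w /= Hw|w [/= Aw Hw] j].
    split => /=; first by apply: Hw; rewrite mem_head.
    by move=> j js; apply: Hw; rewrite inE js orbT.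
  by rewrite inE => /orP[/eqP->|/Hw].
rewrite cardE (_ : bigcap _ _ = [set w | forall i, i \in enum I -> A i w]); first exact: H.
by apply/seteqP; split => w /= Hw i; [move=> _; exact: Hw|move=> _; apply: Hw; rewrite mem_enum].
Qed.

Lemma holds_up_to_ge e A : holds_up_to e A -> ((1 - e)%:E <= P A)%E.
Proof.
move=> [mA]; rewrite probability_setC//.
have : P A \is a fin_num by exact: fin_num_measure.
by case: (P A) => // r _; rewrite -EFinB !lee_fin; lra.
Qed.

Lemma holds_up_to_le e1 e2 A : holds_up_to e1 A -> e1 <= e2 -> holds_up_to e2 A.
Proof. by move=> [mA PA] e12; split => //; apply: le_trans PA _; rewrite lee_fin. Qed.

End exceptional_probability.

Section iid_sums.
Context {R : realType} {dT dY : measure_display} {T : measurableType dT}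
  {Y : measurableType dY}.
Variables (P : probability T R) (Q : probability Y R) (X : nat -> {RV P >-> Y}).
Hypothesis XQ : forall i A, measurable A -> P (X i @^-1` A) = Q A.
Hypothesis X_indep : forall (n : nat) (A : nat -> set Y),
  (forall i, measurable (A i)) ->
  P (\bigcap_(i < n) (X i @^-1` A i)) = (\prod_(i < n) P (X i @^-1` A i))%E.

Let mX i : measurable_fun setT (X i). Proof. exact: measurable_funP. Qed.

Let fineQ A : measurable A -> (fine (Q A))%:E = Q A.
Proof. by move=> mA; rewrite fineK// fin_num_measure. Qed.

Let measurable_prodX (g : nat -> Y -> R) a b :
  (forall j, measurable_fun setT (g j)) ->
  measurable_fun setT (fun w => \prod_(a <= j < b) g j (X j w)).
Proof.
move=> mg; elim: b => [|b IH].
  by under eq_fun do rewrite big_geq//; exact: measurable_cst.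
have [ab|ba] := leqP a b; last by under eq_fun do rewrite big_geq//; exact: measurable_cst.
under eq_fun do rewrite big_nat_recr//=.
apply: measurable_funM => //.
exact: (measurableT_comp (mg b) (mX b)).
Qed.

(** Independence is assumed for events only. By induction on [m], a product of [m] factors [g] and
    [n - m] indicators has the expected integral; each step turns one indicator into [g]. *)
Lemma expectation_iid_prod (n : nat) (g : Y -> R) (G : R) :
  measurable_fun setT g -> (forall y, 0 <= g y) ->
  (\int[Q]_y (g y)%:E = G%:E)%E ->
  (\int[P]_w (\prod_(0 <= j < n) g (X j w))%:E = (G ^+ n)%:E)%E.
Proof.
move=> mg g0 gG.
have G0 : 0 <= G by rewrite -lee_fin -gG; apply: integral_ge0 => y _; rewrite lee_fin.
have H m : (m <= n)%N -> forall A : nat -> set Y, (forall i, measurable (A i)) ->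
    (\int[P]_w (\prod_(0 <= j < m) g (X j w) * \prod_(m <= j < n) \1_(A j) (X j w))%:E =
     (G ^+ m * \prod_(m <= j < n) fine (Q (A j)))%:E)%E.
  elim: m => [_ A mA|m IH mn A mA].
    under eq_integral do rewrite big_geq// mul1r.
    rewrite expr0 mul1r big_mkord -prodEFin.
    transitivity (\prod_(i < n) P (X i @^-1` A i))%E; last first.
      by apply: eq_bigr => i _; rewrite fineQ// XQ.
    rewrite -X_indep//.
    have mI : measurable (\bigcap_(i < n) (X i @^-1` A i)).
      by apply: bigcap_measurableType => i _; rewrite -[X in measurable X]setTI; exact: mX.
    rewrite -[in RHS](setIT (\bigcap_(_ < _) _)) -integral_indic//.
    apply: eq_integral => w _; congr EFin.
    rewrite big_mkord indicE; case: (boolP (w \in _)) => [/set_mem wA|/negP wA].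
      by rewrite big1// => i _; rewrite indicE mem_set//; exact: (wA i (ltn_ord i)).
    apply/eqP; rewrite prodf_seq_eq0; apply/hasP.
    apply: contra_notP wA => H; apply/mem_set => i /= ni.
    apply: contra_notP H => H; exists (Ordinal ni); first by rewrite mem_index_enum.
    by rewrite /= indicE memNset.
  pose W w := \prod_(0 <= j < m) g (X j w) * \prod_(m.+1 <= j < n) \1_(A j) (X j w).
  pose c := G ^+ m * \prod_(m.+1 <= j < n) fine (Q (A j)).
  have c0 : 0 <= c.
    rewrite mulr_ge0 ?exprn_ge0//; apply: prodr_ge0 => j _.
    by rewrite fine_ge0.
  have mW : measurable_fun setT W.
    apply: measurable_funM; first exact: (measurable_prodX (g := fun=> g)).
    apply: (measurable_prodX (g := fun j => \1_(A j))) => j.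
    exact: measurable_indic.
  have W0 w : 0 <= W w by rewrite mulr_ge0//; apply: prodr_ge0.
  (* The induction hypothesis with the indicator of [B] in place [m] says that the density [W] has
     image [c * Q] under [X m]; integrating [g] against this image replaces the indicator by [g]. *)
  have nuE B : measurable B ->
      mscale (NngNum c0) Q B = (\int[P]_(w in X m @^-1` B) (W w)%:E)%E.
    move=> mB; have /= := IH (ltnW mn) (fun j => if j == m then B else A j).
    rewrite /mscale /= (@big_ltn _ _ _ m n)// eqxx => IH'.
    transitivity ((G ^+ m * (fine (Q B) * \prod_(m.+1 <= i < n) fine (Q (A i))))%:E).
      by rewrite -(fineQ mB) -EFinM /c; congr EFin; ring.
    rewrite (@eq_big_nat _ _ _ m.+1 n _ (fun j => fine (Q (if j == m then B else A j)))); last first.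
      by move=> j /andP[mj _]; rewrite gtn_eqF.
    rewrite -IH'; last by move=> i; case: ifP.
    rewrite [RHS]integral_mkcond; apply: eq_integral => w _.
    rewrite patchE (@big_ltn _ _ _ m n)// eqxx indicE.
    have -> : (w \in X m @^-1` B) = (X m w \in B) by apply/idP/idP => /set_mem ?; apply/mem_set.
    case: ifP => _; last by rewrite mul0r mulr0.
    rewrite mul1r /W; congr (_ * _)%:E; apply: eq_big_nat => j /andP[mj _].
    by rewrite gtn_eqF.
  have := @ge0_integral_image_density _ _ _ _ _ P (mscale (NngNum c0) Q) (X m) W (mX m) mW W0 nuE (EFin \o g).
  rewrite ge0_integral_mscale//; last 2 first.
  - exact/measurable_EFinP.
  - by move=> y _; rewrite lee_fin.
  rewrite /= gG => Hden.
  transitivity ((c * G)%:E); last by rewrite exprS /c; congr EFin; ring.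
  rewrite EFinM Hden; last 2 first.
  - exact/measurable_EFinP.
  - by move=> y; rewrite lee_fin.
  apply: eq_integral => w _; rewrite -EFinM big_nat_recr//= /W; congr EFin.
  by ring.
have /= := H n (leqnn n) (fun=> setT) (fun=> measurableT).
by under eq_integral do rewrite [X in _ * X]big_geq// mulr1; rewrite [X in _ * X]big_geq// mulr1.
Qed.

Lemma measurable_sumX n (f : Y -> R) : measurable_fun setT f ->
  measurable_fun setT (fun w => \sum_(0 <= j < n) f (X j w)).
Proof.
move=> mf; elim: n => [|n IH].
  by under eq_fun do rewrite big_geq//; exact: measurable_cst.
under eq_fun do rewrite big_nat_recr//=.
by apply: measurable_funD => //; exact: (measurableT_comp mf (mX n)).
Qed.

Let bounded_integrable (f : Y -> R) (M : R) : measurable_fun setT f ->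
  (forall y, `|f y| <= M) -> Q.-integrable setT (EFin \o f).
Proof.
move=> mf fM; apply: measurable_bounded_integrable => //.
  by apply: le_lt_trans (probability_le1 Q measurableT) _; rewrite ltry.
by exists M; split; [exact: num_real|move=> N MN y _; apply: le_trans (fM y) (ltW MN)].
Qed.

(** From [expR (- y) >= 1 - y] and [(1 - y) * (1 + y + 2 * y ^+ 2) = 1 + y ^+ 2 * (1 - 2 * y) >=
    1]. *)
Lemma expR_le_quadratic (y : R) : y <= 2^-1 -> expR y <= 1 + y + 2 * y ^+ 2.
Proof.
move=> y2; have y1 : 0 < 1 - y by lra.
have := expR_ge1Dx (- y); rewrite expRN.
have e0 := expR_gt0 y.
rewrite -(ler_pM2r e0) mulVf ?gt_eqF// => H.
rewrite -(ler_pM2l y1); apply: le_trans H _.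
rewrite (_ : (1 - y) * _ = 1 + y ^+ 2 * (1 - 2 * y)); last by ring.
by rewrite lerDl mulr_ge0 ?sqr_ge0//; lra.
Qed.

(* Chernoff's method, with the quadratic bound [expR_le_quadratic] on the
   moment generating function. *)
Lemma bernstein_upper n (f : Y -> R) (M V t : R) :
  measurable_fun setT f -> (forall y, `|f y| <= M) -> 0 < M -> 0 < V ->
  \int[Q]_y (f y ^+ 2) <= V -> 0 < t -> t * M <= 2 * V ->
  (P [set w | (n%:R * (\int[Q]_y f y + t) <= \sum_(0 <= j < n) f (X j w))%R] <=
   (expR (- (n%:R * t ^+ 2 / (8 * V))))%:E)%E.
Proof.
move=> mf fM M0 V0 fV t0 tMV.
(* The minimizer of [2 * s ^+ 2 * V - s * t], with minimum [- t ^+ 2 / (8 * V)]; the assumption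
   [t * M <= 2 * V] then gives [s * f y <= 2^-1]. *)
pose s := t / (4 * V); have s0 : 0 < s by rewrite divr_gt0// mulr_gt0.
have sf y : s * f y <= 2^-1.
  have -> : 2^-1 = s * (2 * V / t) by rewrite /s; field; rewrite !gt_eqF.
  rewrite ler_pM2l// (le_trans (ler_norm _))// (le_trans (fM _))//.
  by rewrite ler_pdivlMr// mulrC.
pose g y := expR (s * f y).
have mg : measurable_fun setT g.
  apply: (measurableT_comp (@measurable_expR R)); exact: measurable_funM.
have g0 y : 0 <= g y by exact: expR_ge0.
have gb y : `|g y| <= expR 2^-1 by rewrite ger0_norm// ler_expR.
have ig := bounded_integrable mg gb.
pose G := \int[Q]_y g y.
have gG : (\int[Q]_y (g y)%:E = G%:E)%E by rewrite fineK// integrable_fin_num.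
pose m := \int[Q]_y f y.
have ifn := bounded_integrable mf fM.
have mf2 : measurable_fun setT (fun y => f y ^+ 2) by exact: measurable_funX.
have if2 : Q.-integrable setT (EFin \o (fun y => f y ^+ 2)).
  apply: (@bounded_integrable _ (M ^+ 2)) => // y.
  by rewrite normrX lerXn2r// ?nnegrE// ltW.
have GV : G <= expR (s * m + 2 * s ^+ 2 * V).
  apply: le_trans (expR_ge1Dx _).
  have b1 : forall y, `|s * f y| <= s * M by move=> y; rewrite normrM gtr0_norm// ler_pM2l.
  have i1 : Q.-integrable setT (EFin \o (fun y => s * f y)).
    by apply: bounded_integrable b1; exact: measurable_funM.
  have b2 y : `|2 * s ^+ 2 * f y ^+ 2| <= 2 * s ^+ 2 * M ^+ 2.
    have c0 : 0 <= 2 * s ^+ 2 by rewrite mulr_ge0// sqr_ge0.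
    rewrite normrM (ger0_norm c0) ler_wpM2l// normrX lerXn2r// ?nnegrE//.
    exact: ltW.
  have i2 : Q.-integrable setT (EFin \o (fun y => 2 * s ^+ 2 * f y ^+ 2)).
    apply: (@bounded_integrable _ (2 * s ^+ 2 * M ^+ 2)); first exact: measurable_funM.
    exact: b2.
  have i0 : Q.-integrable setT (EFin \o (fun y => 1 + s * f y)).
    apply: (@bounded_integrable _ (1 + s * M)).
      by apply: measurable_funD => //; exact: measurable_funM.
    by move=> y; rewrite (le_trans (ler_normD _ _))// normr1 lerD2l.
  apply: (@le_trans _ _ (\int[Q]_y ((1 + s * f y) + 2 * s ^+ 2 * f y ^+ 2))).
    apply: le_Rintegral => //.
      apply: (@bounded_integrable _ ((1 + s * M) + 2 * s ^+ 2 * M ^+ 2)).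
        apply: measurable_funD; last exact: measurable_funM.
        by apply: measurable_funD => //; exact: measurable_funM.
      move=> y; rewrite (le_trans (ler_normD _ _))// lerD//.
      by rewrite (le_trans (ler_normD _ _))// normr1 lerD2l.
    move=> y _; rewrite /g; have := expR_le_quadratic (sf y); rewrite exprMn mulrA.
    exact.
  have ic : Q.-integrable setT (EFin \o (fun=> 1 : R)).
    by apply: (@bounded_integrable _ 1) => // y; rewrite normr1.
  rewrite (RintegralD measurableT i0 i2) (RintegralD measurableT ic i1).
  rewrite Rintegral_cst//.
  have -> : fine (Q setT) = 1 by rewrite probability_setT.
  rewrite mulr1 (RintegralZl s measurableT ifn)
    (RintegralZl _ measurableT if2).
  by rewrite -addrA lerD2l lerD2l ler_wpM2l// mulr_ge0// sqr_ge0.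
have := expectation_iid_prod n mg g0 gG.
have eS w : \prod_(0 <= j < n) g (X j w) = expR (s * \sum_(0 <= j < n) f (X j w)).
  by rewrite /g -expR_sum mulr_sumr.
under eq_integral do rewrite eS.
move=> HE; set B := [set w | _].
have mB : measurable B.
  rewrite -[B]setTI; have -> : B = (fun w => \sum_(0 <= j < n) f (X j w)) @^-1` `[n%:R * (m + t), +oo[%classic.
    by apply/seteqP; split => w; rewrite /B/= in_itv/= andbT.
  exact: measurable_sumX.
pose a := expR (s * (n%:R * (m + t))).
have a0 : 0 < a by exact: expR_gt0.
have : (a%:E * P B <= (G ^+ n)%:E)%E.
  rewrite -HE -[B]setIT -integral_indic// -ge0_integralZl//; last 2 first.
  - by apply/measurable_EFinP; exact: measurable_indic.
  - by rewrite lee_fin ltW.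
  apply: ge0_le_integral => //.
  - by move=> w _; rewrite -EFinM lee_fin mulr_ge0// ltW.
  - by apply/measurable_EFinP; apply: measurable_funM => //; exact: measurable_indic.
  - apply/measurable_EFinP; apply: (measurableT_comp (@measurable_expR R)).
    by apply: measurable_funM => //; exact: measurable_sumX.
  move=> w _; rewrite -EFinM lee_fin indicE; case: (boolP (w \in B)) => [/set_mem wB|_].
    by rewrite mulr1 ler_expR ler_pM2l.
  by rewrite mulr0 expR_ge0.
have : P B \is a fin_num by exact: fin_num_measure.
case: (P B) => // r _; rewrite -EFinM !lee_fin => ar.
rewrite -(ler_pM2l a0) (le_trans ar)//.
apply: (@le_trans _ _ (expR (s * m + 2 * s ^+ 2 * V) ^+ n)).
  by rewrite lerXn2r// ?nnegrE ?expR_ge0// Rintegral_ge0.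
rewrite -expRM_natl -expRD ler_expR le_eqVlt; apply/orP; left; apply/eqP.
by rewrite /s; field; rewrite gt_eqF.
Qed.

(** Both tails of each member, hence the factor 2, and a union bound; [M], [V] and [t] are common to
    the family. *)
Lemma bernstein_family (I : finType) n (f : I -> Y -> R) (M V t : R) :
  (forall i, measurable_fun setT (f i)) -> (forall i y, `|f i y| <= M) ->
  0 < M -> 0 < V -> (forall i, \int[Q]_y (f i y ^+ 2) <= V) ->
  0 < t -> t * M <= 2 * V ->
  holds_up_to P (#|I|%:R * (2 * expR (- (n%:R * t ^+ 2 / (8 * V)))))
    (\bigcap_(i in [set: I])
       [set w | `|\sum_(0 <= j < n) f i (X j w) - n%:R * \int[Q]_y f i y| <= n%:R * t]).
Proof.
move=> mf fM M0 V0 fV t0 tMV; apply: holds_up_to_bigcap => [|i].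
  by rewrite mulr_ge0// expR_ge0.
set S := fun w => \sum_(0 <= j < n) f i (X j w); set m := \int[Q]_y f i y.
have mS : measurable_fun setT S by exact: measurable_sumX.
split.
  rewrite -[X in measurable X]setTI.
  have -> : [set w | `|S w - n%:R * m| <= n%:R * t] =
      (fun w => S w - n%:R * m) @^-1` `[- (n%:R * t), n%:R * t]%classic.
    by apply/seteqP; split => w /=; rewrite in_itv/= ler_norml.
  by apply: measurable_funB => //; exact: measurable_cst.
have mNf : measurable_fun setT (fun y => - f i y) by exact: measurableT_comp.
have H1 := bernstein_upper n (mf i) (fM i) M0 V0 (fV i) t0 tMV.
have H2 : (P [set w | (n%:R * (\int[Q]_y (- f i y) + t) <= \sum_(0 <= j < n) - f i (X j w))%R] <=
   (expR (- (n%:R * t ^+ 2 / (8 * V))))%:E)%E.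
  apply: (@bernstein_upper n (fun y => - f i y) M V t) => //.
    by move=> y; rewrite normrN.
  by apply: le_trans (fV i); rewrite le_eqVlt; apply/orP; left; apply/eqP; apply: eq_Rintegral => y _; rewrite sqrrN.
have eN : \int[Q]_y (- f i y) = - m.
  rewrite -[RHS]mulN1r -RintegralZl//; last exact: bounded_integrable (fM i).
  by apply: eq_Rintegral => y _; rewrite mulN1r.
set B1 := [set w | _] in H1; set B2 := [set w | _] in H2.
have mB1 : measurable B1.
  rewrite -[B1]setTI; have -> : B1 = S @^-1` `[n%:R * (m + t), +oo[%classic.
    by apply/seteqP; split => w; rewrite /B1/= in_itv/= andbT.
  exact: mS.
have mB2 : measurable B2.
  rewrite -[B2]setTI; have -> : B2 = (fun w => - S w) @^-1` `[n%:R * (- m + t), +oo[%classic.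
    by apply/seteqP; split => w; rewrite /B2/= in_itv/= andbT eN -sumrN.
  by apply: measurableT_comp.
apply: (@le_trans _ _ (P (B1 `|` B2))).
  apply: le_measure; rewrite ?inE; [|exact: measurableU|].
    apply: measurableC; rewrite -[X in measurable X]setTI.
    have -> : [set w | `|S w - n%:R * m| <= n%:R * t] =
        (fun w => S w - n%:R * m) @^-1` `[- (n%:R * t), n%:R * t]%classic.
      by apply/seteqP; split => w /=; rewrite in_itv/= ler_norml.
    by apply: measurable_funB => //; exact: measurable_cst.
  move=> w /= /negP; rewrite -ltNge -/(S w) => H.
  rewrite /B1 /B2 /= sumrN eN -/(S w) -/m.
  have [Sw|Sw] := leP (n%:R * (m + t)) (S w); [by left|right].
  move: H; rewrite ltr_normr => /orP[]; lra.
apply: le_trans (measureU2 _ mB1 mB2) _.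
by rewrite mulr_natl mulr2n EFinD leeD.
Qed.

Lemma prob_none_in n (B : set Y) : measurable B ->
  P (\bigcap_(j < n) (X j @^-1` ~` B)) = ((1 - fine (Q B)) ^+ n)%:E.
Proof.
move=> mB; rewrite (@X_indep n (fun=> ~` B)); last by move=> _; exact: measurableC.
rewrite (eq_bigr (fun=> (1 - fine (Q B))%:E)).
  by rewrite prodEFin prodr_const card_ord.
by move=> j _; rewrite XQ ?probability_setC//; [rewrite EFinB fineQ|exact: measurableC].
Qed.

(** All [n] points miss a set of probability at least [q] with probability at most [(1 - q) ^+ n],
    which is at most [expR (- (n%:R * q))]. *)
Lemma cells_all_hit (I : finType) n (B : I -> set Y) (q : R) :
  (forall i, measurable (B i)) -> (forall i, (q%:E <= Q (B i))%E) ->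
  holds_up_to P (#|I|%:R * expR (- (n%:R * q)))
    (\bigcap_(i in [set: I]) [set w | exists2 j, (j < n)%N & B i (X j w)]).
Proof.
move=> mB qB; apply: holds_up_to_bigcap => [|i]; first exact: expR_ge0.
have eC : [set w | exists2 j, (j < n)%N & B i (X j w)] =
    ~` (\bigcap_(j < n) (X j @^-1` ~` B i)).
  apply/seteqP; split => [w [j jn Bj] /(_ j jn)//|w /= H].
  apply: contra_notP H => H j jn Bj; apply: H; by exists j.
have mI : measurable (\bigcap_(j < n) (X j @^-1` ~` B i)).
  apply: bigcap_measurableType => j _; rewrite -[X in measurable X]setTI.
  by apply: mX => //; exact: measurableC.
rewrite eC; split; first exact: measurableC.
rewrite setCK prob_none_in// lee_fin mulrC -mulNr expRM_natr.
have q1 : q <= fine (Q (B i)) by rewrite -lee_fin fineQ.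
have Q1 : fine (Q (B i)) <= 1 by rewrite -lee_fin fineQ// probability_le1.
rewrite lerXn2r ?nnegrE ?expR_ge0 ?subr_ge0//.
by apply: le_trans (expR_ge1Dx _); lra.
Qed.

(** Two different indices fall into one given cell with probability at most [e ^+ 2]. For small
    cells the total is as small as wished, which replaces an almost sure statement about ties. *)
Lemma cells_no_collision (I : finType) n (C : I -> set Y) (e : R) :
  (forall i, measurable (C i)) -> (forall i, (Q (C i) <= e%:E)%E) ->
  exists2 A : set T, holds_up_to P (#|{: 'I_n * 'I_n * I}|%:R * e ^+ 2) A &
    forall w, A w -> forall (a b : 'I_n) i, C i (X a w) -> C i (X b w) -> a = b.
Proof.
move=> mC Ce.
pose A (k : 'I_n * 'I_n * I) : set T :=
  if k.1.1 == k.1.2 then setT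
  else ~` (X k.1.1 @^-1` C k.2 `&` X k.1.2 @^-1` C k.2).
exists (\bigcap_(k in [set: 'I_n * 'I_n * I]) A k); last first.
  move=> w Aw a b i Ca Cb; apply/eqP/negPn/negP => ab.
  by have := Aw (a, b, i) Logic.I; rewrite /A /= (negbTE ab); apply.
apply: holds_up_to_bigcap => [|[[a b] i]]; first exact: sqr_ge0.
rewrite /A /=; case: ifPn => ab.
  by split => //; rewrite setCT measure0 lee_fin sqr_ge0.
have mp j : measurable (X j @^-1` C i).
  by rewrite -[X in measurable X]setTI; exact: mX.
split; first by apply: measurableC; exact: measurableI.
rewrite setCK.
pose A' (j : nat) : set Y := if (j == a) || (j == b) then C i else setT.
have -> : X a @^-1` C i `&` X b @^-1` C i = \bigcap_(j < n) (X j @^-1` A' j).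
  apply/seteqP; split => [w [Ca Cb] j jn|w Hw].
    by rewrite /A' /=; case: ifPn => // /orP[]/eqP->.
  split; first by have := Hw a (ltn_ord a); rewrite /A' /= eqxx.
  by have := Hw b (ltn_ord b); rewrite /A' /= eqxx orbT.
rewrite X_indep; last by move=> j; rewrite /A'; case: ifP.
rewrite (bigD1 a)//= (bigD1 b)//=; last by rewrite eq_sym.
rewrite big1 ?mule1; last first.
  move=> j; rewrite -!(inj_eq val_inj)/= => /andP[ja jb].
  by rewrite /A' (negbTE ja) (negbTE jb) XQ//; exact: probability_setT.
rewrite /A' !eqxx orbT !XQ// expr2 EFinM.
by apply: lee_pmul.
Qed.

End iid_sums.

(** * Moments of the kernel *)

Section ball_volume.
Context {R : realType} {d : nat}.
Local Notation mu := (lebesgue_rV d).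
Local Notation B := (ecball (0 : 'rV[R]_d)).

Lemma lebesgue_rV_cube (a b : 'I_d -> R) : (forall i, a i <= b i) ->
  mu (rV_box (fun i => `[a i, b i[%classic)) = (\prod_i (b i - a i))%:E.
Proof.
move=> ab; rewrite lebesgue_rV_box// -prodEFin; apply: eq_bigr => i _.
rewrite lebesgue_measure_itv/= lte_fin.
have := ab i; rewrite le_eqVlt => /predU1P[->|->]; last by rewrite -EFinB.
by rewrite ltxx subrr.
Qed.

Lemma ecball_finite (x : 'rV[R]_d) r : (mu (ecball x r) < +oo)%E.
Proof.
have [r0|r0] := ltP r 0.
  rewrite (_ : ecball x r = set0) ?measure0//; apply/seteqP; split => // y.
  by rewrite /ecball /= => H; have := enorm_ge0 (y - x); lra.
apply: (@le_lt_trans _ _ (mu (rV_box (fun i => `[x 0 i - r, x 0 i + r + 1[%classic)))).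
  apply: le_measure; rewrite ?inE; [exact: measurable_ecball|exact: measurable_rV_box|].
  move=> y yx i /=; rewrite in_itv/=; have := le_trans (coord_le_enorm (y - x) i) yx.
  by rewrite !mxE ler_norml => /andP[? ?]; apply/andP; split; lra.
by rewrite lebesgue_rV_cube ?ltry// => i; lra.
Qed.

Definition bvol (r : R) : R := fine (mu (B r)).

Lemma bvolE r : (bvol r)%:E = mu (B r).
Proof. by rewrite fineK// ge0_fin_numE// ecball_finite. Qed.

Lemma bvol_ge0 r : 0 <= bvol r. Proof. exact: fine_ge0. Qed.

Lemma dilate_preimage_ecball (e r : R) : 0 < e ->
  (fun z : 'rV[R]_d => e^-1 *: z) @^-1` B r = B (e * r).
Proof.
move=> e0; apply/seteqP; split => z; rewrite /ecball/= !subr0 enormZ gtr0_norm ?invr_gt0//.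
  by rewrite ler_pdivrMl.
by rewrite ler_pdivrMl.
Qed.

Lemma bvol_scale (r : R) : 0 < r -> bvol r = r ^+ d * ball_volume R d.
Proof.
move=> r0; rewrite /bvol -[in LHS](mulr1 r) -dilate_preimage_ecball//.
rewrite lebesgue_rV_dilate ?invr_gt0//; last exact: measurable_ecball.
by rewrite exprVn invrK fineM// ge0_fin_numE// ecball_finite.
Qed.

Lemma ball_volume_gt0 : 0 < ball_volume R d.
Proof.
(* The cube of side [s] at the origin lies in the unit ball since [d%:R * s <= 1]; adding 1 keeps
   [s] positive when [d] is 0. *)
pose s := (d%:R + 1)^-1 : R.
have d1 : 0 < d%:R + 1 :> R by rewrite ltr_wpDl.
have s0 : 0 < s by rewrite invr_gt0.
rewrite -lte_fin -[ball_volume R d]/(bvol 1) bvolE.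
apply: (@lt_le_trans _ _ (mu (rV_box (fun i => `[0, s[%classic)))).
  rewrite lebesgue_rV_cube; last by move=> i; exact: ltW.
  by rewrite lte_fin prodr_gt0// => i _; rewrite subr0.
apply: le_measure; rewrite ?inE; [exact: measurable_rV_box|exact: measurable_ecball|].
move=> y /= Hy; rewrite /ecball/= subr0; apply: le_trans (enorm_le_coord (s := s) _) _.
  by move=> i; have := Hy i; rewrite /= in_itv/= => /andP[y0 ys]; rewrite ger0_norm// ltW.
by rewrite /s ler_pdivrMr// mul1r lerDl.
Qed.

Lemma exprD_le (m : nat) (e w : R) : 0 <= e -> 0 <= w <= e ->
  (e + w) ^+ m.+1 <= e ^+ m.+1 + 3 ^+ m.+1 * (w * e ^+ m).
Proof.
move=> e0 /andP[w0 we]; elim: m => [|m IH]; first by rewrite !expr1 expr0; lra.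
rewrite [leLHS]exprS; apply: (@le_trans _ _ ((e + w) * (e ^+ m.+1 + 3 ^+ m.+1 * (w * e ^+ m)))).
  by rewrite ler_wpM2l// addr_ge0.
have p0 : 0 <= w * e ^+ m by rewrite mulr_ge0// exprn_ge0.
have t1 : 1 <= 3 ^+ m.+1 :> R by rewrite exprn_ege1// ler1n.
rewrite !(exprS _ m.+1) (exprS e m); move: p0 t1; move: (e ^+ m) (3 ^+ m.+1) => q t p0 t1.
rewrite -subr_ge0 (_ : _ - _ = (t - 1) * (e * (w * q)) + t * ((e - w) * (w * q))); last by ring.
rewrite addr_ge0// mulr_ge0 ?subr_ge0//; first exact: mulr_ge0.
  exact: le_trans t1.
by rewrite mulr_ge0// subr_ge0.
Qed.

(** The volume of a spherical shell is linear in its width [w]; this is the price of smoothing the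
    indicator of a ball. *)
Lemma bvolD_le (e w : R) : 0 < e -> 0 <= w <= e ->
  bvol (e + w) <= bvol e + 3 ^+ d * ball_volume R d * (w * e ^+ d.-1).
Proof.
move=> e0 /andP[w0 we]; rewrite !bvol_scale//; last lra.
rewrite (mulrC (3 ^+ d)) -!(mulrC (ball_volume R d)) -mulrA -mulrDr ler_pM2l ?ball_volume_gt0//.
case: d => [|m]; first by rewrite !expr0 lerDl !mulr_ge0.
by apply: exprD_le; [exact: ltW|apply/andP].
Qed.

End ball_volume.
Arguments bvol {R} d r.

(** * Regularity of the kernel profile *)

Section kernel_regularity.
Context {R : realType}.
Variables (d : nat) (eta : R -> R).
Hypothesis eta_adm : @admissible_kernel R d eta.

Lemma derivable_bounded_segment (f : R -> R) (a b : R) : (forall t : R, derivable f t 1) ->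
  exists2 K : R, 0 < K & forall t, a <= t <= b -> `|f t| <= K.
Proof.
move=> df; have cf : {within `[a, b], continuous f}.
  by apply: derivable_within_continuous => t _.
have /compact_bounded[M [Mr HM]] := continuous_compact cf (@segment_compact _ a b).
exists (`|M| + 1) => [|t tab]; first by rewrite ltr_wpDl.
apply: (HM (`|M| + 1)); first by rewrite (le_lt_trans (ler_norm M))// ltrDl.
by exists t => //=; rewrite in_itv.
Qed.

Lemma eta_ge0 t : 0 <= t -> 0 <= eta t. Proof. by case: eta_adm => _ H _ _ _; exact: H. Qed.

Lemma eta_le0 t : 0 <= t -> eta t <= eta 0.
Proof. by case: eta_adm => _ _ H _ _ t0; exact: H. Qed.

(** The assumption gives 0 for [t > 1] only; the value at 1 follows from the right continuity of the
    smooth function that agrees with [eta]. *)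
Lemma eta_supp t : 1 <= t -> eta t = 0.
Proof.
case: eta_adm => -[g dg eg] _ _ [_ H1] _; rewrite le_eqVlt => /predU1P[<-|]; last exact: H1.
rewrite eg//.
have cg : g y @[y --> (1:R)] --> g 1.
  by apply: differentiable_continuous; apply/derivable1_diffP; exact: (dg 0%N).
have cr : g y @[y --> (1:R)^'+] --> g 1 by apply: cvg_trans cg; apply: cvg_app; exact: cvg_within.
apply/esym/(cvg_unique _ _ cr) => //.
apply: cvg_near_cst; near=> y.
have y1 : 1 < y by near: y; exact: nbhs_right_gt.
by rewrite -eg ?H1// ltW// (lt_trans _ y1).
Unshelve. all: by end_near. Qed.

Lemma eta_ge1 t : 0 <= t <= 2^-1 -> 1 <= eta t.
Proof. by case: eta_adm => _ _ _ [H _] _; exact: H. Qed.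

(** On [[0, 1]] the mean value theorem applies to the smooth extension; beyond 1 the kernel is zero,
    and [eta 1 = 0] joins the two ranges. *)
Lemma eta_lipschitz : exists2 L : R, 0 < L &
  forall s t, 0 <= s -> 0 <= t -> `|eta s - eta t| <= L * `|s - t|.
Proof.
have [[g dg eg] _ _ _ _] := eta_adm.
have [L L0 HL] := @derivable_bounded_segment (derive1 g) 0 1 (dg 1%N).
have H1 s t : 0 <= s -> s <= t -> t <= 1 -> `|eta s - eta t| <= L * `|s - t|.
  move=> s0 st t1; rewrite !eg//; last exact: le_trans st.
  have dgt (q : R) : is_derive q 1 g (derive1 g q).
    by rewrite derive1E; apply: derivableP; exact: (dg 0%N).
  have [|c] := @MVT_segment R g (derive1 g) s t st.
    by apply: derivable_within_continuous => q _; exact: (dg 0%N).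
  rewrite in_itv/= => /andP[sc ct] E; rewrite distrC E normrM distrC ler_wpM2r//.
  by apply: HL; rewrite (le_trans s0 sc) (le_trans ct t1).
exists L => // s t.
wlog st : s t / s <= t.
  move=> W s0 t0; have [/W|/ltW/W] := leP s t; first exact.
  by rewrite distrC (distrC s); exact.
move=> s0 t0; have [t1|t1] := leP t 1; first exact: H1.
have [s1|s1] := leP s 1; last first.
  by rewrite (eta_supp (ltW s1)) (eta_supp (ltW t1)) subrr normr0 mulr_ge0// ltW.
rewrite (eta_supp (ltW t1)) -(eta_supp (lexx 1)); apply: le_trans (H1 _ _ s0 s1 (lexx _)) _.
by rewrite ler_pM2l// !ler0_norm ?subr_le0//; lra.
Qed.

(* The derivative of [r * eta r] vanishes at its maximum point [r0]. *)
Lemma eta_peak_lower (r0 : R) : 0 < r0 < 1 -> exists2 C : R, 0 < C &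
  forall theta, 0 < theta -> kernel_peak eta r0 theta ->
  forall r, 0 <= r <= 2 -> r0 * eta r0 - C * (r - r0) ^+ 2 <= r * eta r.
Proof.
move=> /andP[r00 r01]; have [[g dg eg] _ _ _ _] := eta_adm.
have dg0 (q : R) : is_derive q 1 g (derive1 g q).
  by rewrite derive1E; apply: derivableP; exact: (dg 0%N).
pose gg : R -> R := derive1 (derive1 g).
have dgg (q : R) : derivable gg q 1 by exact: (dg 2%N).
have dg1 (q : R) : is_derive q 1 (derive1 g) (gg q).
  by rewrite /gg derive1E; apply: derivableP; exact: (dg 1%N).
pose F (r : R) := r * g r; pose dF (r : R) := g r + r * derive1 g r.
pose ddF (r : R) := 2 * derive1 g r + r * gg r.
have HF (r : R) : is_derive r 1 F (dF r).
  rewrite (_ : F = id * g); last by apply/funext.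
  by apply: is_derive_eq; rewrite /GRing.scale/= /dF; ring.
have HdF (r : R) : is_derive r 1 dF (ddF r).
  rewrite (_ : dF = g + id * derive1 g); last by apply/funext.
  apply: is_derive_eq (is_deriveD (dg0 r) (is_deriveM (is_derive_id r 1) (dg1 r))) _.
  rewrite /GRing.scale/= /ddF.
  by rewrite mulr1 mulr2n mulrDl !mul1r addrCA addrC.
have [K1 K10 HK1] := @derivable_bounded_segment (derive1 g) 0 2 (dg 1%N).
have [K2 K20 HK2] := @derivable_bounded_segment gg 0 2 dgg.
(* A bound on [[0, 2]] for the second derivative of [r * eta r]. It is chosen before [theta], which
   serves only to know that [r0] is a maximum point. *)
exists (2 * K1 + 2 * K2); first by lra.
move=> theta th0 pk r /andP[r1 r2].
have dF0 : dF r0 = 0.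
  have /@derive_val : is_derive r0 1 F 0.
    apply: (@derive1_at_max _ F 0 1 r0) => //.
      by rewrite in_itv/= r00 r01.
    move=> t; rewrite in_itv/= => /andP[t0 t1]; rewrite /F -(eg t (ltW t0)) -(eg r0 (ltW r00)).
    have /(_ t) := pk; rewrite (ltW t0) (ltW t1) => /(_ isT).
    by apply: le_trans; rewrite lerDl mulr_ge0 ?sqr_ge0// ltW.
  have [_ <-] := HF r0; exact.
have HH (t : R) : is_derive t 1 (fun q : R => r0 + q * (r - r0)) (r - r0).
  rewrite (_ : (fun _ => _) = cst r0 + (r - r0) \*: id); last first.
    by apply/funext => q; rewrite !fctE/= /GRing.scale/= mulrC.
  by apply: is_derive_eq; rewrite add0r /GRing.scale/= mulr1.
have comp (f df : R -> R) (t : R) : (forall q : R, is_derive q 1 f (df q)) ->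
    is_derive t 1 (fun q : R => f (r0 + q * (r - r0))) ((r - r0) * df (r0 + t * (r - r0))).
  move=> Hf; have ? := Hf (r0 + t * (r - r0)); have ? := HH t.
  have := @is_derive1_comp R f (fun q : R => r0 + q * (r - r0)) t (df (r0 + t * (r - r0))) (r - r0) _ _.
  by move=> H1; rewrite mulrC; exact: H1.
have := @taylor_order2 R (fun t => F (r0 + t * (r - r0)))
  (fun t => (r - r0) * dF (r0 + t * (r - r0)))
  (fun t => (r - r0) * ((r - r0) * ddF (r0 + t * (r - r0))))
  ((2 * K1 + 2 * K2) * (r - r0) ^+ 2) _ _ _ 1 _.
rewrite !mul1r !mul0r !addr0 (_ : r0 + (r - r0) = r) ?dF0 ?mulr0 ?subr0; last by ring.
rewrite /F -!eg//; last exact: ltW.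
move=> H; have : `|r * eta r - r0 * eta r0| <= (2 * K1 + 2 * K2) * (r - r0) ^+ 2.
  have i01 : 0 <= (1 : R) <= 1 by rewrite ler01 lexx.
  have H2 (t : R) : is_derive t 1 (fun t0 : R => (r - r0) * dF (r0 + t0 * (r - r0)))
       ((r - r0) * ((r - r0) * ddF (r0 + t * (r - r0)))).
    by have ? := comp dF ddF t HdF; exact: is_deriveZ.
  apply: (H (fun t _ => comp F dF t HF) (fun t _ => H2 t) _ i01) => t /andP[t0 t1].
  rewrite mulrA -expr2 normrM (ger0_norm (sqr_ge0 _)) [leRHS]mulrC ler_wpM2l ?sqr_ge0//.
  set q := r0 + _.
  have q02 : 0 <= q <= 2.
    rewrite /q (_ : r0 + t * (r - r0) = (1 - t) * r0 + t * r); last by ring.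
    apply/andP; split.
      by rewrite addr_ge0// mulr_ge0// ?subr_ge0// ltW.
    apply: (@le_trans _ _ ((1 - t) * 2 + t * 2)); last by lra.
    by rewrite lerD// ler_wpM2l// ?subr_ge0//; lra.
  rewrite /ddF; apply: le_trans (ler_normD _ _) _; rewrite !normrM.
  case/andP: (q02) => q0 q2; rewrite (ger0_norm q0) (ger0_norm (ler0n _ 2)).
  have h1 := HK1 _ q02; have h2 := HK2 _ q02.
  by rewrite lerD// ?ler_pM2l// ler_pM.
rewrite ler_norml => /andP[]; lra.
Qed.

End kernel_regularity.

Section integrals_over_balls.
Context {R : realType} {d : nat}.
Local Notation mu := (lebesgue_rV d).
Local Notation B := (ecball (0 : 'rV[R]_d)).
Implicit Types (f : 'rV[R]_d -> R).

Lemma lipschitz_measurable f (L : R) : (forall x y, `|f x - f y| <= L * enorm (x - y)) ->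
  measurable_fun setT (f : _ -> measurableTypeR R).
Proof.
move=> fL; apply: continuous_measurable_rV; first exact: openT.
move=> x _; apply/(@cvgrPdist_le _ _ _ (nbhs x)) => e e0.
pose C := (`|L| + 1) * (d%:R + 1).
have C0 : 0 < C by rewrite mulr_gt0// ltr_wpDl.
have : nbhs x (ball x (e / C)) by apply: nbhsx_ballx; rewrite divr_gt0.
apply: filterS => y [_ xy]; apply: le_trans (fL _ _) _.
have H : enorm (x - y) <= d%:R * (e / C).
  by apply: enorm_le_coord => i; rewrite !mxE ltW//; exact: xy.
have q0 : 0 < e / C by rewrite divr_gt0.
apply: (@le_trans _ _ ((`|L| + 1) * ((d%:R + 1) * (e / C)))); last first.
  have qC : e / C * C = e by rewrite divfK// gt_eqF.
  by rewrite -[leRHS]qC; move: (e / C) => q; rewrite /C mulrA mulrC.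
apply: (@le_trans _ _ ((`|L| + 1) * enorm (x - y))).
  by rewrite ler_wpM2r// (le_trans (ler_norm L))// lerDl.
rewrite ler_pM2l ?ltr_wpDl//; apply: le_trans H _.
by rewrite ler_pM2r// lerDl.
Qed.

Lemma ball_integrable f (M r : R) : measurable_fun setT (f : _ -> measurableTypeR R) ->
  (forall z, B r z -> `|f z| <= M) -> mu.-integrable (B r) (EFin \o f).
Proof.
move=> mf fM; apply: measurable_bounded_integrable => //.
- exact: measurable_ecball.
- exact: ecball_finite.
- exact: measurable_funS mf.
by exists M; split; [exact: num_real|move=> N MN y By; apply: le_trans (fM y By) (ltW MN)].
Qed.

Lemma integrable_scale (D : set 'rV[R]_d) f (c : R) : measurable D ->
  mu.-integrable D (EFin \o f) -> mu.-integrable D (EFin \o (fun z => c * f z)).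
Proof.
move=> mD intf; rewrite (_ : EFin \o _ = (fun z => c%:E * (EFin \o f) z)%E).
  exact: integrableZl.
by apply/funext => z /=; rewrite EFinM.
Qed.

Lemma Rintegral_ball_le f (M r : R) : measurable_fun setT (f : _ -> measurableTypeR R) ->
  (forall z, B r z -> `|f z| <= M) -> `|\int[mu]_(z in B r) f z| <= M * bvol d r.
Proof.
move=> mf fM; have mB : measurable (B r) by exact: measurable_ecball.
have intf := ball_integrable mf fM.
apply: le_trans (le_normr_Rintegral mB intf) _.
rewrite -Rintegral_cst//; apply: le_Rintegral => //.
  by apply: (@ball_integrable _ M) => [|z Bz]; [exact: measurableT_comp|rewrite normr_id fM].
by apply: (@ball_integrable _ `|M|) => // z _.
Qed.

End integrals_over_balls.

Section kernel_moments.
Context {R : realType} {d : nat}.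
Variable eta : R -> R.
Hypothesis eta_adm : @admissible_kernel R d eta.
Local Notation mu := (lebesgue_rV d).
Local Notation B := (ecball (0 : 'rV[R]_d)).

Definition kernel (e : R) (z : 'rV[R]_d) : R := eta (enorm z / e).

Lemma kernel_ge0 e z : 0 < e -> 0 <= kernel e z.
Proof. by move=> e0; rewrite (eta_ge0 eta_adm)// divr_ge0// ltW. Qed.

Lemma kernel_le e z : 0 < e -> kernel e z <= eta 0.
Proof. by move=> e0; rewrite (eta_le0 eta_adm)// divr_ge0// ltW. Qed.

Lemma kernel_norm_le e z : 0 < e -> `|kernel e z| <= eta 0.
Proof. by move=> e0; rewrite ger0_norm ?kernel_ge0// kernel_le. Qed.

Lemma kernel_supp e z : 0 < e -> e <= enorm z -> kernel e z = 0.
Proof. by move=> e0 ez; rewrite /kernel (eta_supp eta_adm)// ler_pdivlMr// mul1r. Qed.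

Lemma kernel_lipschitz e L : 0 < e ->
  (forall s t, 0 <= s -> 0 <= t -> `|eta s - eta t| <= L * `|s - t|) -> 0 <= L ->
  forall z z', `|kernel e z - kernel e z'| <= L / e * enorm (z - z').
Proof.
move=> e0 HL L0 z z'.
apply: le_trans (HL _ _ (divr_ge0 (enorm_ge0 z) (ltW e0)) (divr_ge0 (enorm_ge0 z') (ltW e0))) _.
rewrite -mulrBl normrM (ger0_norm (x := e^-1)) ?invr_ge0 ?(ltW e0)//.
rewrite mulrA -[leRHS]mulrA [e^-1 * _]mulrC mulrA ler_wpM2r ?invr_ge0 ?(ltW e0)//.
by rewrite ler_wpM2l// enorm_dist.
Qed.

Lemma measurable_kernel e : 0 < e -> measurable_fun setT (kernel e : _ -> measurableTypeR R).
Proof.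
move=> e0; have [L L0 HL] := eta_lipschitz eta_adm.
exact: lipschitz_measurable (kernel_lipschitz e0 HL (ltW L0)).
Qed.

Lemma kernelE e z : 0 < e -> kernel e z = kernel 1 (e^-1 *: z).
Proof. by move=> e0; rewrite /kernel divr1 enormZ gtr0_norm ?invr_gt0// mulrC. Qed.

Lemma Rintegral_dilate_ball (f : 'rV[R]_d -> R) (e : R) : 0 < e ->
  mu.-integrable (B 1) (EFin \o f) ->
  \int[mu]_(z in B e) f (e^-1 *: z) = e ^+ d * \int[mu]_(z in B 1) f z.
Proof.
move=> e0 intf; have e'0 : 0 < e^-1 by rewrite invr_gt0.
have mB : measurable (B 1) by exact: measurable_ecball.
have := Rintegral_comap (scales_dilate e'0) mB intf.
by rewrite dilate_preimage_ecball// mulr1 exprVn invrK.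
Qed.

Let kernel1_coord_integrable (p : 'rV[R]_d -> R) : measurable_fun setT (p : _ -> measurableTypeR R) ->
  (forall z, B 1 z -> `|p z| <= 1) -> mu.-integrable (B 1) (EFin \o (fun z => kernel 1 z * p z)).
Proof.
move=> mp p1; apply: (@ball_integrable _ _ _ (eta 0)).
  by apply: measurable_funM => //; exact: measurable_kernel.
move=> z Bz; rewrite normrM -[leRHS]mulr1 ler_pM//; [exact: kernel_norm_le|exact: p1].
Qed.

Let coord_ball1 i (z : 'rV[R]_d) : B 1 z -> `|z 0 i| <= 1.
Proof. by rewrite /ecball/= subr0 => z1; exact: le_trans (coord_le_enorm z i) z1. Qed.

Let coord2_ball1 i j (z : 'rV[R]_d) : B 1 z -> `|z 0 i * z 0 j| <= 1.
Proof. by move=> z1; rewrite normrM -[leRHS]mulr1 ler_pM// coord_ball1. Qed.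

Let mcoord2 (i j : 'I_d) : measurable_fun setT ((fun z : 'rV[R]_d => z 0 i * z 0 j) : _ -> measurableTypeR R).
Proof. by apply: measurable_funM; exact: measurable_coord. Qed.

Lemma kernel_moment0 e : 0 < e -> \int[mu]_(z in B e) kernel e z = e ^+ d.
Proof.
move=> e0; under eq_Rintegral do rewrite kernelE//.
rewrite Rintegral_dilate_ball//.
  rewrite (_ : \int[mu]_(z in B 1) _ = 1) ?mulr1//.
  have [_ _ _ _ H] := eta_adm; rewrite /Rintegral -[RHS]/(fine 1%E) -H.
  by congr fine; apply: eq_integral => z _; rewrite /kernel divr1.
have := @kernel1_coord_integrable (fun=> 1) (measurable_cst _) (fun _ _ => _).
by under eq_fun do rewrite mulr1; apply; rewrite normr1.
Qed.

Lemma flip_preimage_ecball (i : 'I_d) r : @rV_flip R d i @^-1` B r = B r.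
Proof. by apply/seteqP; split => z; rewrite /ecball/= !subr0 enorm_flip. Qed.

Lemma perm_preimage_ecball (s : {perm 'I_d}) r : @rV_perm R d s @^-1` B r = B r.
Proof. by apply/seteqP; split => z; rewrite /ecball/= !subr0 enorm_perm. Qed.

Let odd_moment (p : 'rV[R]_d -> R) i : measurable_fun setT (p : _ -> measurableTypeR R) ->
  (forall z, B 1 z -> `|p z| <= 1) -> (forall z, p (rV_flip i z) = - p z) ->
  \int[mu]_(z in B 1) (kernel 1 z * p z) = 0.
Proof.
move=> mp p1 pN; have intf := kernel1_coord_integrable mp p1.
have mB : measurable (B 1) by exact: measurable_ecball.
have := Rintegral_comap (scales_flip i) mB intf.
rewrite flip_preimage_ecball mul1r.
have -> : \int[mu]_(z in B 1) (kernel 1 (rV_flip i z) * p (rV_flip i z)) =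
    -1 * \int[mu]_(z in B 1) (kernel 1 z * p z).
  by rewrite -RintegralZl//; apply: eq_Rintegral => z _; rewrite /kernel enorm_flip pN; ring.
lra.
Qed.

Lemma kernel_moment1 e i : 0 < e -> \int[mu]_(z in B e) (kernel e z * z 0 i) = 0.
Proof.
move=> e0.
transitivity (\int[mu]_(z in B e) (fun z => e * (kernel 1 z * z 0 i)) (e^-1 *: z)).
  apply: eq_Rintegral => z _; rewrite kernelE// mxE; field.
  by rewrite gt_eqF.
have intf := kernel1_coord_integrable (measurable_coord i) (coord_ball1 i).
have mB : measurable (B 1) by exact: measurable_ecball.
rewrite (Rintegral_dilate_ball (f := fun z => e * (kernel 1 z * z 0 i)) e0); last first.
  exact: integrable_scale.
rewrite RintegralZl// (@odd_moment _ i) ?mulr0//; first exact: measurable_coord.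
  exact: coord_ball1.
by move=> z; rewrite mxE eqxx.
Qed.

(** Reflecting one coordinate kills the mixed moments, and exchanging the coordinates [i] and [i0]
    equates the pure ones; the second-moment matrix is a multiple of the identity. *)
Lemma kernel_moment2 e i j (i0 : 'I_d) : 0 < e ->
  \int[mu]_(z in B e) (kernel e z * (z 0 i * z 0 j)) = (i == j)%:R * (e ^+ d.+2 * sigma_eta i0 eta).
Proof.
move=> e0.
transitivity (\int[mu]_(z in B e) (fun z => e ^+ 2 * (kernel 1 z * (z 0 i * z 0 j))) (e^-1 *: z)).
  apply: eq_Rintegral => z _; rewrite kernelE// !mxE; field.
  by rewrite gt_eqF.
have intf k l := kernel1_coord_integrable (mcoord2 k l) (coord2_ball1 k l).
have mB : measurable (B 1) by exact: measurable_ecball.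
rewrite (Rintegral_dilate_ball (f := fun z => e ^+ 2 * (kernel 1 z * (z 0 i * z 0 j))) e0); last first.
  exact: integrable_scale.
rewrite RintegralZl//; have [<-|ij] := eqVneq i j; last first.
  rewrite (@odd_moment _ i) ?mulr0 ?mul0r//; first exact: coord2_ball1.
  by move=> z; rewrite !mxE eqxx eq_sym (negbTE ij) mulNr.
rewrite mul1r mulrA -exprD addn2; congr (_ * _).
have -> : \int[mu]_(z in B 1) (kernel 1 z * (z 0 i * z 0 i)) =
          \int[mu]_(z in B 1) (kernel 1 z * (z 0 i0 * z 0 i0)).
  have := Rintegral_comap (scales_perm (tperm i i0)) mB (intf i0 i0).
  rewrite perm_preimage_ecball mul1r => <-.
  by apply: eq_Rintegral => z _; rewrite /kernel enorm_perm !mxE tpermR.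
rewrite /sigma_eta /Rintegral; congr fine; rewrite integral_mkcond.
apply: eq_integral => z _; rewrite patchE.
have -> : `|z 0 i0| ^+ 2 * eta (enorm z) = kernel 1 z * (z 0 i0 * z 0 i0).
  by rewrite real_normK ?num_real// /kernel divr1 mulrC expr2.
case: ifPn => // /negP zB; rewrite kernel_supp ?mul0r//.
rewrite leNgt; apply/negP => z1; apply: zB; apply/mem_set.
by rewrite /ecball/= subr0 ltW.
Qed.

Lemma sigma_eta_gt0 (i0 : 'I_d) : 0 < sigma_eta i0 eta.
Proof.
have := kernel_moment2 i0 i0 i0 ltr01; rewrite eqxx expr1n !mul1r => <-.
(* The cube with sides [[s, 2 * s[] lies in the ball of radius one half, where the kernel is at
   least 1, and its points have every coordinate at least [s]. *)
pose s := (2 * (2 * d%:R + 1))^-1 : R.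
have s0 : 0 < s by rewrite invr_gt0 mulr_gt0// ltr_wpDl.
pose A := @rV_box R d (fun=> `[s, 2 * s[%classic).
have mA : measurable A by exact: measurable_rV_box.
have Ahalf z : A z -> enorm z <= 2^-1.
  move=> Az; apply: (le_trans (enorm_le_coord (s := 2 * s) _)).
    by move=> i; have := Az i; rewrite /= in_itv/= => /andP[z1 z2]; rewrite ger0_norm//; lra.
  have hs : s * (2 * (2 * d%:R + 1)) = 1.
    by rewrite mulVf// gt_eqF// mulr_gt0// ltr_wpDl.
  by move: hs s0; clearbody s; move: d%:R => q; nra.
have AB : A `<=` B 1.
  by move=> z /Ahalf z1; rewrite /ecball/= subr0; lra.
have mB : measurable (B 1) by exact: measurable_ecball.
have intf := kernel1_coord_integrable (mcoord2 i0 i0) (coord2_ball1 i0 i0).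
rewrite -lte_fin fineK; last exact: integrable_fin_num.
apply: (@lt_le_trans _ _ (\int[mu]_(z in A) (s ^+ 2)%:E)%E).
  have muA : mu A = (\prod_(i < d) (2 * s - s))%:E.
    by rewrite -(@lebesgue_rV_cube R d (fun=> s) (fun=> 2 * s))// => _; lra.
  have -> : (\int[mu]_(z in A) (s ^+ 2)%:E = (s ^+ 2)%:E * (\prod_(i < d) (2 * s - s))%:E)%E.
    by rewrite integral_cst//; congr (_ * _)%E; exact: muA.
  rewrite -EFinM lte_fin mulr_gt0// ?exprn_gt0// prodr_gt0// => _ _; lra.
apply: (@le_trans _ _ (\int[mu]_(z in A) (kernel 1 z * (z 0 i0 * z 0 i0))%:E)%E).
  have mf : measurable_fun A (fun z => (kernel 1 z * (z 0 i0 * z 0 i0))%:E).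
    by apply/measurable_EFinP; apply: (measurable_funS mB AB); apply/measurable_EFinP; have /integrableP[] := intf.
  apply: ge0_le_integral => //.
    by move=> z _; rewrite lee_fin sqr_ge0.
  move=> z Az; rewrite lee_fin -[leLHS]mul1r ler_pM ?sqr_ge0//.
    by rewrite /kernel divr1 (eta_ge1 eta_adm)// enorm_ge0 Ahalf.
  have := Az i0; rewrite /= in_itv/= => /andP[z1 z2].
  by rewrite expr2 ler_pM// ltW.
apply: ge0_subset_integral => //.
  by have /integrableP[] := intf.
by move=> z _; rewrite lee_fin -expr2 mulr_ge0 ?sqr_ge0// kernel_ge0.
Qed.

End kernel_moments.

(** * Integrals against the law of the sample *)

Section law_with_density.
Context {R : realType} {d : nat}.
Variables (Om : set 'rV[R]_d) (rho : 'rV[R]_d -> R) (beta : R).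
Variable Q : probability 'rV[R]_d R.
Hypotheses (oOm : open Om) (beta0 : 0 < beta).
Hypothesis rho_cont : forall x, Om x -> {for x, continuous rho}.
Hypothesis rho_bounds : forall x, Om x -> beta <= rho x <= beta^-1.
Hypothesis QE : forall A, measurable A ->
  Q A = (\int[lebesgue_rV d]_(x in A `&` Om) (rho x)%:E)%E.
Local Notation mu := (lebesgue_rV d).
Local Notation B := (ecball (0 : 'rV[R]_d)).

Let mOm : measurable Om. Proof. exact: open_measurable_rV. Qed.

(** Nothing is known about [rho] outside [Om]; its extension by zero is measurable and bounded on
    the whole space. *)
Let rhoO := rho \_ Om.

Let mrhoO : measurable_fun setT (rhoO : _ -> measurableTypeR R).
Proof. by apply/(measurable_restrictT _ mOm); exact: continuous_measurable_rV. Qed.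

Let rhoO_bounds x : 0 <= rhoO x <= beta^-1.
Proof.
rewrite /rhoO patchE; case: ifPn => [/set_mem Ox|_]; last by rewrite lexx invr_ge0 ltW.
by have /andP[b1 ->] := rho_bounds Ox; rewrite andbT (le_trans (ltW beta0)).
Qed.

Let QEr A : measurable A -> Q A = (\int[mu]_(t in A) (rhoO t)%:E)%E.
Proof.
move=> mA; rewrite QE// integral_mkcondr; apply: eq_integral => x _.
by rewrite /rhoO !patchE; case: ifP.
Qed.

Lemma law_ge0_integral (h : 'rV[R]_d -> R) :
  measurable_fun setT (h : _ -> measurableTypeR R) -> (forall y, 0 <= h y) ->
  (\int[Q]_y (h y)%:E = \int[mu]_y (h y * rhoO y)%:E)%E.
Proof.
move=> mh h0.
have r0 t : 0 <= rhoO t by have /andP[] := rhoO_bounds t.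
have := @ge0_integral_image_density _ _ _ _ R mu Q id rhoO (@measurable_id _ _ _) mrhoO r0 QEr (EFin \o h).
by move=> -> //; apply/measurable_EFinP.
Qed.

Lemma law_le (A : set 'rV[R]_d) : measurable A -> (Q A <= (beta^-1)%:E * mu A)%E.
Proof.
move=> mA; rewrite QEr// -integral_cst//; apply: ge0_le_integral => //.
- by move=> x _; rewrite lee_fin; have /andP[] := rhoO_bounds x.
- by apply/measurable_EFinP; exact: measurable_funTS.
- by move=> x _; rewrite lee_fin; have /andP[] := rhoO_bounds x.
Qed.

Lemma law_ge (A : set 'rV[R]_d) : measurable A -> A `<=` Om -> (beta%:E * mu A <= Q A)%E.
Proof.
move=> mA AO; rewrite QEr// -integral_cst//; apply: ge0_le_integral => //.
- by move=> x _; rewrite lee_fin ltW.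
- by apply/measurable_EFinP; exact: measurable_funTS.
- move=> x Ax; rewrite lee_fin /rhoO patchE mem_set; last exact: AO.
  by have /andP[] := rho_bounds (AO _ Ax).
Qed.

Let mtrans x (psi : 'rV[R]_d -> R) : measurable_fun setT (psi : _ -> measurableTypeR R) ->
  measurable_fun setT ((fun y => psi (y - x)) : _ -> measurableTypeR R).
Proof.
by move=> mpsi; have [mT _ _] := scales_translate (- x); exact: (measurableT_comp mpsi mT).
Qed.

Section one_ball.
Variables (x : 'rV[R]_d) (r M : R) (psi : 'rV[R]_d -> R).
Hypotheses (mpsi : measurable_fun setT (psi : _ -> measurableTypeR R))
  (psiM : forall z, `|psi z| <= M) (psi_supp : forall z, r < enorm z -> psi z = 0).

Let law_integral_ge0 (f : 'rV[R]_d -> R) :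
  measurable_fun setT (f : _ -> measurableTypeR R) -> (forall z, 0 <= f z) ->
  (forall z, r < enorm z -> f z = 0) ->
  \int[Q]_y f (y - x) = \int[mu]_(z in B r) (f z * rhoO (x + z)).
Proof.
move=> mf f0 fs; rewrite /Rintegral; congr fine.
rewrite (law_ge0_integral (mtrans x mf)); last by move=> y; exact: f0.
have [mT _ _] := scales_translate x.
have := @ge0_integral_comap R d _ 1 setT (fun y => (f (y - x) * rhoO y)%:E) (scales_translate x) measurableT.
rewrite preimage_setT mul1e => <-.
- rewrite [RHS]integral_mkcond; apply: eq_integral => z _.
  rewrite patchE addrK (addrC z); case: ifPn => // /negP zB.
  rewrite fs ?mul0r// ltNge; apply/negP => zr; apply: zB; apply/mem_set.
  by rewrite /ecball/= subr0.
- apply/measurable_EFinP; apply: measurable_funM => //; exact: mtrans.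
- by move=> y _; rewrite lee_fin mulr_ge0//; have /andP[] := rhoO_bounds y.
Qed.

Let M0 : 0 <= M. Proof. exact: le_trans (psiM 0). Qed.

Let mrhox : measurable_fun setT ((fun z => rhoO (x + z)) : _ -> measurableTypeR R).
Proof.
under eq_fun do rewrite addrC.
by have [mT _ _] := scales_translate x; exact: (measurableT_comp mrhoO mT).
Qed.

Lemma law_integral_ball : ecball x r `<=` Om ->
  \int[Q]_y psi (y - x) = \int[mu]_(z in B r) (psi z * rho (x + z)).
Proof.
move=> BO.
pose p z := Num.max (psi z) 0; pose q z := Num.max (- psi z) 0.
have pq z : psi z = p z - q z.
  by rewrite /p /q; case: (leP (psi z) 0) => H; [rewrite max_l|rewrite max_r]; rewrite ?oppr_ge0 ?oppr_le0; lra.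
have mp : measurable_fun setT (p : _ -> measurableTypeR R) by apply: measurable_maxr.
have mq : measurable_fun setT (q : _ -> measurableTypeR R).
  by apply: measurable_maxr => //; exact: measurableT_comp.
have p0 z : 0 <= p z by rewrite /p le_max lexx orbT.
have q0 z : 0 <= q z by rewrite /q le_max lexx orbT.
have pM z : `|p z| <= M.
  by rewrite ger0_norm// /p ge_max M0 andbT (le_trans (ler_norm _)).
have qM z : `|q z| <= M.
  by rewrite ger0_norm// /q ge_max M0 andbT (le_trans (ler_norm _))// normrN.
have ps z : r < enorm z -> p z = 0 by move=> rz; rewrite /p psi_supp// maxxx.
have qs z : r < enorm z -> q z = 0 by move=> rz; rewrite /q psi_supp// oppr0 maxxx.
have iQ (f : 'rV[R]_d -> R) : measurable_fun setT (f : _ -> measurableTypeR R) ->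
    (forall z, `|f z| <= M) -> Q.-integrable setT (EFin \o (fun y => f (y - x))).
  move=> mf fM; apply: measurable_bounded_integrable => //.
  - by apply: le_lt_trans (probability_le1 Q measurableT) _; rewrite ltry.
  - exact: mtrans.
  - by exists M; split; [exact: num_real|move=> N MN y _; apply: le_trans (fM _) (ltW MN)].
have mB : measurable (B r) by exact: measurable_ecball.
have iB (f : 'rV[R]_d -> R) : measurable_fun setT (f : _ -> measurableTypeR R) ->
    (forall z, `|f z| <= M) -> mu.-integrable (B r) (EFin \o (fun z => f z * rhoO (x + z))).
  move=> mf fM; apply: (@ball_integrable _ _ _ (M * beta^-1)).
    exact: measurable_funM.
  move=> z _; rewrite normrM ler_pM//.
  by have /andP[h1 h2] := rhoO_bounds (x + z); rewrite ger0_norm.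
transitivity (\int[Q]_y (p (y - x) - q (y - x))).
  by apply: eq_Rintegral => y _; rewrite pq.
rewrite (RintegralB measurableT (iQ _ mp pM) (iQ _ mq qM)) !law_integral_ge0//.
rewrite -(RintegralB mB (iB _ mp pM) (iB _ mq qM)).
apply: eq_Rintegral => z /set_mem zB; rewrite pq -mulrBl; congr (_ * _).
rewrite /rhoO patchE mem_set//; apply: BO.
by move: zB; rewrite /ecball/= subr0 addrAC subrr add0r.
Qed.

(** The variance parameter in Bernstein's inequality: as [psi] lives in a ball of radius [r], it is
    of order [r ^+ d] instead of [M ^+ 2]. *)
Lemma law_second_moment_le : 0 < r ->
  \int[Q]_y (psi (y - x) ^+ 2) <= M ^+ 2 * beta^-1 * bvol d r.
Proof.
move=> r0; have mB : measurable (B r) by exact: measurable_ecball.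
rewrite (law_integral_ge0 (f := fun z => psi z ^+ 2)).
- apply: le_trans (ler_norm _) _; apply: Rintegral_ball_le.
    by apply: measurable_funM => //; exact: measurable_funX.
  move=> z _; rewrite normrM ler_pM//.
    by rewrite normrX lerXn2r// ?nnegrE.
  by have /andP[h1 h2] := rhoO_bounds (x + z); rewrite ger0_norm.
- exact: measurable_funX.
- by move=> z; exact: sqr_ge0.
- by move=> z rz; rewrite psi_supp// expr0n.
Qed.

Let irho (f : 'rV[R]_d -> R) (N : R) : measurable_fun setT (f : _ -> measurableTypeR R) ->
  (forall z, B r z -> `|f z| <= N) -> mu.-integrable (B r) (EFin \o f).
Proof. exact: ball_integrable. Qed.

Let Brhox z : ecball x r `<=` Om -> B r z -> rho (x + z) = rhoO (x + z).
Proof.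
move=> BO; rewrite /ecball/= subr0 => zr; rewrite /rhoO patchE mem_set//.
by apply: BO; rewrite /ecball/= addrAC subrr add0r.
Qed.

Lemma law_integral_order1 (K : R) : ecball x r `<=` Om ->
  (forall z, enorm z <= r -> `|rho (x + z) - rho x| <= K) ->
  `|\int[Q]_y psi (y - x) - rho x * \int[mu]_(z in B r) psi z| <= M * K * bvol d r.
Proof.
move=> BO HK; rewrite law_integral_ball//.
have mB : measurable (B r) by exact: measurable_ecball.
have ip : mu.-integrable (B r) (EFin \o psi) by apply: irho => // z _; exact: psiM.
have E1 : \int[mu]_(z in B r) (psi z * rho (x + z)) = \int[mu]_(z in B r) (psi z * rhoO (x + z)).
  by apply: eq_Rintegral => z /set_mem zB; rewrite Brhox.
have i1 : mu.-integrable (B r) (EFin \o (fun z => psi z * rhoO (x + z))).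
  apply: (@irho _ (M * beta^-1)); first exact: measurable_funM.
  move=> z _; rewrite normrM ler_pM//.
  by have /andP[h1 h2] := rhoO_bounds (x + z); rewrite ger0_norm.
rewrite E1 -RintegralZl// -RintegralB//; last exact: integrable_scale.
apply: Rintegral_ball_le.
  apply: measurable_funB; apply: measurable_funM => //.
move=> z zB; rewrite -Brhox// (mulrC (rho x)) -mulrBr normrM ler_pM//.
by apply: HK; move: zB; rewrite /ecball/= subr0.
Qed.

(** With [c] the gradient of [rho], the last sum is the drift produced by the inhomogeneous density.
    It is the leading term when the integral of [psi] itself vanishes, as it does for first
    moments. *)
Lemma law_integral_order2 (K : R) (c : 'I_d -> R) : ecball x r `<=` Om ->
  (forall z, enorm z <= r -> `|rho (x + z) - rho x - \sum_i z 0 i * c i| <= K) ->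
  `|\int[Q]_y psi (y - x) - rho x * \int[mu]_(z in B r) psi z
    - \sum_i c i * \int[mu]_(z in B r) (psi z * z 0 i)| <= M * K * bvol d r.
Proof.
move=> BO HK; rewrite law_integral_ball//.
have mB : measurable (B r) by exact: measurable_ecball.
have ip : mu.-integrable (B r) (EFin \o psi) by apply: irho => // z _; exact: psiM.
have E1 : \int[mu]_(z in B r) (psi z * rho (x + z)) = \int[mu]_(z in B r) (psi z * rhoO (x + z)).
  by apply: eq_Rintegral => z /set_mem zB; rewrite Brhox.
have i1 : mu.-integrable (B r) (EFin \o (fun z => psi z * rhoO (x + z))).
  apply: (@irho _ (M * beta^-1)); first exact: measurable_funM.
  move=> z _; rewrite normrM ler_pM//.
  by have /andP[h1 h2] := rhoO_bounds (x + z); rewrite ger0_norm.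
have i2 i : mu.-integrable (B r) (EFin \o (fun z => psi z * z 0 i)).
  apply: (@irho _ (M * r)).
    by apply: measurable_funM => //; exact: measurable_coord.
  move=> z zB; rewrite normrM ler_pM//; apply: le_trans (coord_le_enorm z i) _.
  by move: zB; rewrite /ecball/= subr0.
have H (s : seq 'I_d) : mu.-integrable (B r) (EFin \o (fun z => \sum_(i <- s) c i * (psi z * z 0 i))) /\
    \int[mu]_(z in B r) (\sum_(i <- s) c i * (psi z * z 0 i)) =
    \sum_(i <- s) c i * \int[mu]_(z in B r) (psi z * z 0 i).
  elim: s => [|i s [IH1 IH2]].
    have E z : \sum_(i <- [::]) c i * (psi z * z 0 i) = 0 by rewrite big_nil.
    split; last by rewrite big_nil; under eq_Rintegral do rewrite big_nil; rewrite Rintegral_cst// mul0r.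
    apply: (@irho _ 0); first by under eq_fun do rewrite big_nil; exact: measurable_cst.
    by move=> z _; rewrite E normr0.
  have ii : mu.-integrable (B r) (EFin \o (fun z => c i * (psi z * z 0 i))).
    exact: integrable_scale.
  split.
    pose F z := c i * (psi z * z 0 i); pose G z := \sum_(i <- s) c i * (psi z * z 0 i).
    rewrite (_ : EFin \o _ = ((EFin \o F) \+ (EFin \o G))%E); first exact: integrableD.
    by apply/funext => z /=; rewrite big_cons EFinD.
  rewrite big_cons -IH2 -RintegralZl// -RintegralD//.
  by apply: eq_Rintegral => z _; rewrite big_cons.
have [H1 H2] := H (index_enum 'I_d).
have i3 : mu.-integrable (B r) (EFin \o (fun z => rho x * psi z)) by exact: integrable_scale.
have i4 : mu.-integrable (B r) (EFin \o (fun z => psi z * rhoO (x + z) - rho x * psi z)).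
  pose F z := psi z * rhoO (x + z); pose G z := rho x * psi z.
  rewrite (_ : EFin \o _ = ((EFin \o F) \- (EFin \o G))%E); first exact: integrableB.
  by apply/funext => z /=; rewrite EFinB.
rewrite E1 -H2 -RintegralZl// -RintegralB// -RintegralB//.
apply: Rintegral_ball_le.
  apply: measurable_funB; first by apply: measurable_funB; apply: measurable_funM.
  apply: measurable_sum => i; apply: measurable_funM => //.
  by apply: measurable_funM => //; exact: measurable_coord.
move=> z zB; rewrite -Brhox//.
rewrite (_ : _ - _ = psi z * (rho (x + z) - rho x - \sum_i z 0 i * c i)).
  by rewrite normrM ler_pM//; apply: HK; move: zB; rewrite /ecball/= subr0.
rewrite !mulrBr mulr_sumr (mulrC (rho x)); congr (_ - _).
by apply: eq_bigr => i _; ring.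
Qed.

End one_ball.
End law_with_density.

(** * Uniform events over a net *)

Section grid.
Context {R : realType} {d : nat}.
Implicit Types (s W K : R).

Definition grid_size W s : nat := (Num.trunc (W / s)).+1.

Lemma grid_index W s (t : R) : 0 < s -> 0 <= t <= W ->
  exists m : 'I_(grid_size W s), m%:R * s <= t < m%:R * s + s.
Proof.
move=> s0 /andP[t0 tW].
have ts : 0 <= t / s by rewrite divr_ge0// ltW.
have lt : (Num.trunc (t / s) < grid_size W s)%N.
  by rewrite ltnS Num.Theory.le_truncn// ler_pM2r// invr_gt0.
exists (Ordinal lt) => /=; have /andP[h1 h2] := Num.Theory.truncn_itv ts.
rewrite -ler_pdivlMr// h1/= -[X in _ + X]mul1r -mulrDl natr1.
by rewrite -ltr_pdivrMr.
Qed.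

Lemma grid_size_le W s : 0 < s -> 0 <= W -> (grid_size W s)%:R <= W / s + 1.
Proof.
move=> s0 W0; rewrite -natr1 lerD2r.
by have /andP[] := Num.Theory.truncn_itv (divr_ge0 W0 (ltW s0)).
Qed.

Definition grid_point K s N (m : {ffun 'I_d -> 'I_N}) : 'rV[R]_d :=
  \row_i (- K + (m i)%:R * s).

Definition grid_cell K s N (m : {ffun 'I_d -> 'I_N}) : set 'rV[R]_d :=
  rV_box (fun i => `[- K + (m i)%:R * s, - K + (m i)%:R * s + s[%classic).

Lemma grid_cell_cover K s (x : 'rV[R]_d) : 0 < s -> (forall i, `|x 0 i| <= K) ->
  exists m : {ffun 'I_d -> 'I_(grid_size (2 * K) s)}, grid_cell K s m x.
Proof.
move=> s0 xK.
have /choice[f Hf] : forall i, exists m : 'I_(grid_size (2 * K) s),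
    m%:R * s <= x 0 i + K < m%:R * s + s.
  by move=> i; apply: grid_index => //; have := xK i; rewrite ler_norml => /andP[? ?]; apply/andP; split; lra.
exists (finfun f) => i /=; rewrite in_itv/= ffunE.
by have /andP[h1 h2] := Hf i; apply/andP; split; lra.
Qed.

Lemma grid_cell_close K s N (m : {ffun 'I_d -> 'I_N}) (x y : 'rV[R]_d) :
  grid_cell K s m x -> grid_cell K s m y -> enorm (x - y) <= d%:R * s.
Proof.
move=> Hx Hy; apply: enorm_le_coord => i; rewrite !mxE.
have := Hx i; have := Hy i; rewrite /= !in_itv/= ler_norml.
by move=> /andP[? ?] /andP[? ?]; apply/andP; split; lra.
Qed.

Lemma measurable_grid_cell K s N (m : {ffun 'I_d -> 'I_N}) : measurable (grid_cell K s m).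
Proof. exact: measurable_rV_box. Qed.

Lemma lebesgue_grid_cell K s N (m : {ffun 'I_d -> 'I_N}) : 0 < s ->
  lebesgue_rV d (grid_cell K s m) = (s ^+ d)%:E.
Proof.
move=> s0; rewrite /grid_cell (lebesgue_rV_cube (a := fun i => - K + (m i)%:R * s) (b := fun i => - K + (m i)%:R * s + s)).
  rewrite (eq_bigr (fun=> s)) ?prodr_const ?card_ord//.
  by move=> i _; rewrite addrAC subrr add0r.
by move=> i; rewrite lerDl ltW.
Qed.

End grid.

Lemma min_close {R : realType} (lo hi q s e : R) : q <= e - lo < q + s -> e <= hi ->
  `|e - Num.min (lo + q) hi| <= s.
Proof.
by move=> /andP[? ?] ?; rewrite ler_norml; case: (leP (lo + q) hi) => ?; apply/andP; split; lra.
Qed.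

Lemma close3 {R : realType} (a b c e t : R) :
  `|a - b| <= t -> `|b - c| <= t -> `|e - c| <= t -> `|a - e| <= 3 * t.
Proof.
by rewrite !ler_norml => /andP[? ?] /andP[? ?] /andP[? ?]; apply/andP; split; lra.
Qed.

Section uniform_events.
Context {R : realType} {d : nat} {dT : measure_display} {T : measurableType dT}.
Variables (P : probability T R) (Q : probability 'rV[R]_d R) (X : nat -> {RV P >-> 'rV[R]_d}).
Hypothesis XQ : forall i A, measurable A -> P (X i @^-1` A) = Q A.
Hypothesis X_indep : forall (n : nat) (A : nat -> set 'rV[R]_d),
  (forall i, measurable (A i)) ->
  P (\bigcap_(i < n) (X i @^-1` A i)) = (\prod_(i < n) P (X i @^-1` A i))%E.

(* A deviation bound on a finite net of parameters extends to all parameters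
   because the statistics are Lipschitz in them. *)
Lemma uniform_deviation (I : finType) (psi : I -> R -> 'rV[R]_d -> R)
    (lo hi M Lam V K t s W : R) (n : nat) :
  lo <= hi -> 0 < M -> 0 < V -> 0 < Lam -> 0 < t -> t * M <= 2 * V -> 0 < s ->
  2 * K <= W -> hi - lo <= W ->
  Lam * ((d%:R + 1) * s) <= t ->
  (forall i e z, lo <= e <= hi -> `|psi i e z| <= M) ->
  (forall i e e' z z', lo <= e <= hi -> lo <= e' <= hi ->
     `|psi i e z - psi i e' z'| <= Lam * (enorm (z - z') + `|e - e'|)) ->
  (forall i e (x : 'rV[R]_d), lo <= e <= hi -> \int[Q]_y (psi i e (y - x) ^+ 2) <= V) ->
  exists2 A : set T,
    holds_up_to P (#|{: I * ({ffun 'I_d -> 'I_(grid_size W s)} * 'I_(grid_size W s))}|%:R *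
       (2 * expR (- (n%:R * t ^+ 2 / (8 * V))))) A &
    forall w, A w -> forall i e (x : 'rV[R]_d), lo <= e <= hi -> (forall j, `|x 0 j| <= K) ->
      `|\sum_(0 <= j < n) psi i e (X j w - x) - n%:R * \int[Q]_y psi i e (y - x)| <= 3 * (n%:R * t).
Proof.
move=> lohi M0 V0 Lam0 t0 tMV s0 KW hlW Ls psiM psiL psiV.
set N := grid_size W s.
(* The radii of the net are capped at [hi], because the statistics are controlled only for radii
   between [lo] and [hi]. *)
pose eps (l : 'I_N) : R := Num.min (lo + l%:R * s) hi.
have epsI l : lo <= eps l <= hi.
  rewrite /eps ge_min lexx orbT andbT le_min lohi andbT lerDl mulr_ge0//; exact: ltW.
pose pt (m : {ffun 'I_d -> 'I_N}) := grid_point K s m.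
pose f (k : I * ({ffun 'I_d -> 'I_N} * 'I_N)) (y : 'rV[R]_d) := psi k.1 (eps k.2.2) (y - pt k.2.1).
have lipf i e x : lo <= e <= hi -> forall y y', `|psi i e (y - x) - psi i e (y' - x)| <= Lam * enorm (y - y').
  move=> ei y y'; apply: le_trans (psiL _ _ _ _ _ ei ei) _.
  by rewrite subrr normr0 addr0 opprB addrA subrK.
have mpsi i e x : lo <= e <= hi -> measurable_fun setT ((fun y => psi i e (y - x)) : _ -> measurableTypeR R).
  by move=> ei; exact: lipschitz_measurable (lipf i e x ei).
have mf k : measurable_fun setT (f k : _ -> measurableTypeR R) by exact: mpsi.
have fM k y : `|f k y| <= M by exact: psiM.
have fV k : \int[Q]_y (f k y ^+ 2) <= V by exact: psiV.
have HB := bernstein_family XQ X_indep n mf fM M0 V0 fV t0 tMV.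
eexists; first exact: HB.
move=> w Hw i e x ei xK.
have /choice[m Hm] : forall j, exists m : 'I_N, m%:R * s <= x 0 j + K < m%:R * s + s.
  move=> j; apply: grid_index => //; have := xK j; rewrite ler_norml => /andP[? ?].
  by apply/andP; split; lra.
have [l Hl] : exists l : 'I_N, l%:R * s <= e - lo < l%:R * s + s.
  by apply: grid_index => //; case/andP: ei => ? ?; apply/andP; split; lra.
pose k := (i, (finfun m, l)) : I * ({ffun 'I_d -> 'I_N} * 'I_N).
have close : enorm (x - pt (finfun m)) <= d%:R * s.
  apply: enorm_le_coord => j; rewrite !mxE ffunE ler_norml.
  by have /andP[? ?] := Hm j; apply/andP; split; lra.
have closee : `|e - eps l| <= s.
  have /andP[_ e2] := ei.
  exact: min_close Hl e2.
have diff y : `|psi i e (y - x) - f k y| <= t.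
  apply: le_trans (psiL _ _ _ _ _ ei (epsI l)) _; apply: le_trans Ls.
  rewrite ler_pM2l// mulrDl mul1r lerD//.
  rewrite (_ : y - x - (y - pt (finfun m)) = - (x - pt (finfun m))) ?enormN//.
  by rewrite opprB addrC addrA subrK opprB.
have /= Hk := Hw k Logic.I.
have d1 : `|\sum_(0 <= j < n) psi i e (X j w - x) - \sum_(0 <= j < n) f k (X j w)| <= n%:R * t.
  rewrite -sumrB; apply: le_trans (ler_norm_sum _ _ _) _.
  apply: (@le_trans _ _ (\sum_(0 <= j < n) t)); first by apply: ler_sum => j _; exact: diff.
  by rewrite sumr_const_nat subn0 -(mulr_natl t).
have intQ (g : 'rV[R]_d -> R) (C : R) : measurable_fun setT (g : _ -> measurableTypeR R) ->
    (forall y, `|g y| <= C) -> Q.-integrable setT (EFin \o g).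
  move=> mg gC; apply: measurable_bounded_integrable => //.
    by apply: le_lt_trans (probability_le1 Q measurableT) _; rewrite ltry.
  by exists C; split; [exact: num_real|move=> D CD y _; apply: le_trans (gC _) (ltW CD)].
have d2 : `|\int[Q]_y psi i e (y - x) - \int[Q]_y f k y| <= t.
  have i1 := intQ _ M (mpsi i e x ei) (fun y => psiM i e _ ei).
  have i2 := intQ _ M (mf k) (fM k).
  rewrite -RintegralB//.
  have md : measurable_fun setT ((fun y => psi i e (y - x) - f k y) : _ -> measurableTypeR R).
    by apply: measurable_funB => //; exact: mpsi.
  have id := intQ _ t md diff.
  apply: le_trans (le_normr_Rintegral measurableT id) _.
  apply: (@le_trans _ _ (\int[Q]_y t)).
    apply: le_Rintegral => //.
      apply: (intQ _ t); first exact: measurableT_comp.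
      by move=> y; rewrite normr_id.
    by apply: (intQ _ t) => // y; rewrite gtr0_norm.
  rewrite Rintegral_cst//; have -> : fine (Q setT) = 1 by rewrite probability_setT.
  by rewrite mulr1.
have d3 : `|n%:R * \int[Q]_y psi i e (y - x) - n%:R * \int[Q]_y f k y| <= n%:R * t.
  by rewrite -mulrBr normrM (ger0_norm (ler0n _ n)) ler_wpM2l.
(* Three errors of size [n%:R * t]: the sum moved to the net point, the deviation there, and the
   mean moved back. *)
exact: close3 d1 Hk d3.
Qed.

Variables (Om : set 'rV[R]_d) (beta K : R).
Hypotheses (beta0 : 0 < beta) (OmK : forall x i, Om x -> `|x 0 i| <= K).
Hypothesis Q_ge : forall A, measurable A -> A `<=` Om -> (beta%:E * lebesgue_rV d A <= Q A)%E.
Hypothesis Q_le : forall A, measurable A -> (Q A <= (beta^-1)%:E * lebesgue_rV d A)%E.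

(** The grid cell of [p] has diameter at most [d%:R * s], so it lies in the given ball, hence in
    [Om], and contains a sample point. *)
Lemma filling_event (n : nat) (s : R) : 0 < s -> beta * s ^+ d <= 1 ->
  exists2 A : set T,
    holds_up_to P (#|{ffun 'I_d -> 'I_(grid_size (2 * K) s)}|%:R *
       expR (- (n%:R * (beta * s ^+ d)))) A &
    forall w, A w -> forall p, ecball p (d%:R * s) `<=` Om ->
      exists2 j, (j < n)%N & enorm (X j w - p) <= d%:R * s.
Proof.
move=> s0 bs1; pose I := {ffun 'I_d -> 'I_(grid_size (2 * K) s)}.
(* A cell that leaves [Om] may have small probability; it is replaced by the whole space, for which
   the lower bound holds because [beta * s ^+ d <= 1]. *)
pose C (m : I) : set 'rV[R]_d := if `[< grid_cell K s m `<=` Om >] then grid_cell K s m else setT.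
have mC m : measurable (C m).
  by rewrite /C; case: ifP => // _; exact: measurable_grid_cell.
have QC m : ((beta * s ^+ d)%:E <= Q (C m))%E.
  rewrite /C; case: asboolP => CO; last by rewrite probability_setT lee_fin.
  apply: le_trans (Q_ge (measurable_grid_cell _ _ _) CO).
  by rewrite lebesgue_grid_cell.
eexists; first exact: (cells_all_hit XQ X_indep n mC QC).
move=> w Hw p pO.
have Op : Om p by apply: pO; rewrite /ecball/= subrr enorm0 mulr_ge0// ltW.
have [m pm] := grid_cell_cover s0 (fun i => OmK i Op).
have mO : grid_cell K s m `<=` Om.
  by move=> y ym; apply: pO; exact: grid_cell_close ym pm.
have [j jn Cj] := Hw m Logic.I.
exists j => //; move: Cj; rewrite /C; case: asboolP => // _ Cj.
exact: grid_cell_close Cj pm.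
Qed.

Lemma distinct_event (n : nat) (s : R) : 0 < s -> (forall j w, Om (X j w)) ->
  exists2 A : set T,
    holds_up_to P ((n%:R ^+ 2 * (grid_size (2 * K) s)%:R ^+ d) * (beta^-1 * s ^+ d) ^+ 2) A &
    forall w, A w -> forall a b : 'I_n, X a w = X b w -> a = b.
Proof.
move=> s0 XO; pose I := {ffun 'I_d -> 'I_(grid_size (2 * K) s)}.
have mC (m : I) := @measurable_grid_cell R d K s _ m.
have QC (m : I) : (Q (grid_cell K s m) <= (beta^-1 * s ^+ d)%:E)%E.
  by apply: le_trans (Q_le (mC m)) _; rewrite lebesgue_grid_cell.
have [A HA HA'] := cells_no_collision XQ X_indep n mC QC.
exists A.
  have -> : n%:R ^+ 2 * (grid_size (2 * K) s)%:R ^+ d = #|{: 'I_n * 'I_n * I}|%:R :> R.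
    by rewrite !card_prod card_ffun !card_ord !natrM natrX expr2.
  exact: HA.
move=> w Aw a b ab.
have [m Hm] := grid_cell_cover s0 (fun i => OmK i (XO a w)).
by apply: (HA' w Aw a b m Hm); rewrite -ab.
Qed.

End uniform_events.

(** * The peak of the kernel *)

Section infinity_peak.
Context {R : realType} {d : nat}.
Variable eta : R -> R.
Hypothesis eta_adm : @admissible_kernel R d eta.
Implicit Types (z g nu : 'rV[R]_d) (A : 'I_d -> 'I_d -> R).

Definition bilin A z z' : R := \sum_i z 0 i * \sum_j z' 0 j * A i j.

Lemma bilinDl A x y z : bilin A (x + y) z = bilin A x z + bilin A y z.
Proof. by rewrite -big_split; apply: eq_bigr => i _; rewrite mxE mulrDl. Qed.

Lemma bilinZl A a x z : bilin A (a *: x) z = a * bilin A x z.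
Proof. by rewrite mulr_sumr; apply: eq_bigr => i _; rewrite mxE mulrA. Qed.

Lemma bilinDr A x y z : bilin A z (x + y) = bilin A z x + bilin A z y.
Proof.
rewrite -big_split; apply: eq_bigr => i _ /=; rewrite -mulrDr -big_split; congr (_ * _).
by apply: eq_bigr => j _; rewrite mxE mulrDl.
Qed.

Lemma bilinZr A a x z : bilin A z (a *: x) = a * bilin A z x.
Proof.
rewrite mulr_sumr; apply: eq_bigr => i _; rewrite mulrCA; congr (_ * _).
by rewrite mulr_sumr; apply: eq_bigr => j _; rewrite mxE mulrA.
Qed.

Lemma bilinN A z z' : bilin (fun i j => - A i j) z z' = - bilin A z z'.
Proof.
rewrite -sumrN; apply: eq_bigr => i _; rewrite -mulrN -sumrN; congr (_ * _).
by apply: eq_bigr => j _; rewrite mulrN.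
Qed.

Lemma bilin_expand A c x y : bilin A (c *: x + y) (c *: x + y) =
  c ^+ 2 * bilin A x x + c * bilin A x y + bilin A y (c *: x + y).
Proof. by rewrite bilinDl bilinZl [bilin A x (_ + _)]bilinDr bilinZr mulrDr mulrA -expr2. Qed.

Lemma bilin_le A N z z' : (forall i j, `|A i j| <= N) ->
  `|bilin A z z'| <= d%:R ^+ 2 * N * (enorm z * enorm z').
Proof.
move=> AN; apply: le_trans (@weighted_sum_le _ _ z _ (d%:R * (enorm z' * N)) _) _.
  by move=> i; exact: weighted_sum_le.
by rewrite le_eqVlt; apply/orP; left; apply/eqP; ring.
Qed.

Lemma eta_sqr_lipschitz L r r' : (forall s t, 0 <= s -> 0 <= t -> `|eta s - eta t| <= L * `|s - t|) ->
  0 <= r <= 1 -> 0 <= r' <= 1 ->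
  `|eta r * r ^+ 2 - eta r' * r' ^+ 2| <= (L + 2 * eta 0) * `|r - r'|.
Proof.
move=> HL /andP[r0 r1] /andP[r0' r1'].
rewrite (_ : _ - _ = (eta r - eta r') * r ^+ 2 + eta r' * ((r + r') * (r - r'))); last by ring.
apply: le_trans (ler_normD _ _) _; rewrite [leRHS]mulrDl lerD//.
  rewrite normrM -[leRHS]mulr1 ler_pM//; first exact: HL.
  by rewrite ger0_norm ?sqr_ge0// expr_le1.
rewrite !normrM (ger0_norm (eta_ge0 eta_adm r0')) mulrA ler_wpM2r// [2 * _]mulrC ler_pM//.
- exact: (eta_ge0 eta_adm).
- exact: (eta_le0 eta_adm).
- by rewrite ger0_norm ?addr_ge0//; lra.
Qed.

(* With [D = |z| - nu.z] the tangential part [tau = z - |z| nu] satisfies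
   [|tau|^2 = 2 |z| D]; the loss [|g| eta D] absorbs the cross terms of the
   quadratic form and the loss [theta (r - r0)^2] absorbs its radial change. *)
Lemma peak_upper (r0 theta L Nb G e : R) A nu z :
  (forall s t, 0 <= s -> 0 <= t -> `|eta s - eta t| <= L * `|s - t|) -> 0 <= L ->
  0 < r0 < 1 -> 0 < theta -> kernel_peak eta r0 theta ->
  0 < G -> 0 <= Nb -> 0 < e -> enorm nu = 1 ->
  (forall z z', `|bilin A z z'| <= Nb * (enorm z * enorm z')) ->
  enorm z <= e ->
  kernel eta e z * (G * dotr nu z + 2^-1 * bilin A z z) <=
  eta r0 * (r0 * e * G + 2^-1 * (r0 * e) ^+ 2 * bilin A nu nu) +
  (eta 0 ^+ 2 / r0 + (L + 2 * eta 0) ^+ 2) * (Nb ^+ 2 * e ^+ 3 / (G * theta)).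
Proof.
move=> HL L0 /andP[r00 r01] th0 pk G0 Nb0 e0 nu1 HA ze.
set r := enorm z / e.
have r1 : 0 <= r <= 1.
  by rewrite /r divr_ge0 ?(ltW e0)//= ler_pdivrMr// mul1r.
have zr : enorm z = r * e by rewrite /r divfK// gt_eqF.
have /andP[r_0 r_1] := r1.
have eta0 : 0 <= eta r by exact: (eta_ge0 eta_adm).
have etar0 : eta r <= eta 0 by exact: (eta_le0 eta_adm).
have e00 : 0 <= eta 0 by exact: le_trans etar0.
(* The cross terms leave an error without [theta]; this bound, from the peak condition at 0, lets it
   be written with [theta] in the denominator. *)
have thb : theta * r0 <= eta 0.
  have := pk 0; rewrite lexx ler01 mul0r add0r sub0r sqrrN => /(_ isT) H.
  have : theta * r0 * r0 <= eta 0 * r0.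
    rewrite -mulrA -expr2 (le_trans H)// mulrC ler_wpM2r ?(ltW r00)//.
    by rewrite (eta_le0 eta_adm)// ltW.
  by rewrite ler_pM2r.
pose D := enorm z - dotr nu z.
have nuz : `|dotr nu z| <= enorm z by have := dotr_le nu z; rewrite nu1 mul1r.
have D0 : 0 <= D by rewrite /D subr_ge0 (le_trans (ler_norm _)).
pose tau := z - enorm z *: nu.
have zE : z = enorm z *: nu + tau by rewrite /tau addrC subrK.
have tau2 : enorm tau ^+ 2 = 2 * enorm z * D.
  rewrite sqr_enorm /tau !(dotrDl, dotrDr) -!scaleNr !dotrZl !dotrZr -!sqr_enorm nu1 (dotrC z nu).
  by rewrite /D; ring.
pose q := bilin A nu nu.
have qN : `|q| <= Nb by have := HA nu nu; rewrite nu1 !mulr1.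
have cross : bilin A z z <= enorm z ^+ 2 * q + 2 * (Nb * enorm z * enorm tau).
  have E : bilin A z z = enorm z ^+ 2 * q + enorm z * bilin A nu tau + bilin A tau z.
    by have := bilin_expand A (enorm z) nu tau; rewrite -zE.
  rewrite E -addrA lerD2l.
  have h1 : enorm z * bilin A nu tau <= Nb * enorm z * enorm tau.
    rewrite mulrAC mulrC ler_wpM2r// (le_trans (ler_norm _))//.
    by have := HA nu tau; rewrite nu1 mul1r.
  have h2 : bilin A tau z <= Nb * enorm z * enorm tau.
    by rewrite (le_trans (ler_norm _))// (le_trans (HA _ _))// (mulrC (enorm tau)) mulrA.
  lra.
(* As [X ^+ 2 = 4 * (G * D) * Y], this is the inequality of arithmetic and geometric means. After
   multiplication by [eta r], the part [G * D] is exactly what the linear term loses. *)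
have amgm : Nb * enorm z * enorm tau <= G * D + Nb ^+ 2 * enorm z ^+ 3 / (2 * G).
  set X := Nb * _ * _; set Y := Nb ^+ 2 * _ / _.
  have Y0 : 0 <= Y by rewrite /Y divr_ge0 ?mulr_ge0 ?exprn_ge0// ltW.
  have GD0 : 0 <= G * D by rewrite mulr_ge0// ltW.
  have X0 : 0 <= X by rewrite /X !mulr_ge0.
  rewrite -(@ler_pXn2r _ 2) ?nnegrE ?addr_ge0//.
  have -> : X ^+ 2 = 4 * (G * D) * Y.
    rewrite /X /Y !exprMn tau2; field; rewrite gt_eqF//.
  rewrite -subr_ge0 (_ : _ - _ = (G * D - Y) ^+ 2) ?sqr_ge0//; ring.
have pkr := pk r r1.
have lip := eta_sqr_lipschitz HL r1 (r' := r0).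
have {}lip : `|eta r * r ^+ 2 - eta r0 * r0 ^+ 2| <= (L + 2 * eta 0) * `|r - r0|.
  by apply: lip; rewrite !ltW.
set L2 := L + 2 * eta 0 in lip *.
have L20 : 0 <= L2 by rewrite addr_ge0// mulr_ge0.
(* The same inequality with [P], the margin granted by the peak condition, as the absorbing term:
   [X ^+ 2 = 4 * P * Y] puts [theta] in the denominator of [Y]. *)
have rad : 2^-1 * (eta r * r ^+ 2 * q) * e ^+ 2 <= 2^-1 * (eta r0 * r0 ^+ 2 * q) * e ^+ 2
    + G * e * theta * (r - r0) ^+ 2 + L2 ^+ 2 * (Nb ^+ 2 * e ^+ 3 / (G * theta)) / 16.
  set X := L2 * `|r - r0| * Nb * e ^+ 2 / 2.
  set P := G * e * theta * (r - r0) ^+ 2.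
  set Y := L2 ^+ 2 * _ / 16.
  have Gt0 : 0 < G * theta by rewrite mulr_gt0.
  have P0 : 0 <= P by apply: mulr_ge0; [apply: ltW; rewrite !mulr_gt0|exact: sqr_ge0].
  have Y0 : 0 <= Y.
    apply: divr_ge0 => //; apply: mulr_ge0; first exact: sqr_ge0.
    by rewrite divr_ge0 ?mulr_ge0 ?exprn_ge0// ltW.
  have X0 : 0 <= X.
    by apply: divr_ge0 => //; apply: mulr_ge0; [rewrite !mulr_ge0|exact: sqr_ge0].
  have XPY : X <= P + Y.
    rewrite -(@ler_pXn2r _ 2) ?nnegrE ?addr_ge0//.
    have -> : X ^+ 2 = 4 * P * Y.
      rewrite /X /P /Y !exprMn real_normK ?num_real//; field.
      by rewrite !gt_eqF.
    by rewrite -subr_ge0 (_ : _ - _ = (P - Y) ^+ 2) ?sqr_ge0//; ring.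
  have : 2^-1 * (eta r * r ^+ 2 * q) * e ^+ 2 - 2^-1 * (eta r0 * r0 ^+ 2 * q) * e ^+ 2 <= X.
    rewrite (_ : _ - _ = (eta r * r ^+ 2 - eta r0 * r0 ^+ 2) * q * e ^+ 2 / 2); last by field.
    rewrite /X ler_pM2r ?invr_gt0// ler_wpM2r ?sqr_ge0// (le_trans (ler_norm _))//.
    by rewrite normrM ler_pM.
  lra.
have kz : kernel eta e z = eta r by [].
have m1 : eta r * (Nb ^+ 2 * enorm z ^+ 3 / (2 * G)) <= eta 0 ^+ 2 / r0 * (Nb ^+ 2 * e ^+ 3 / (G * theta)) / 2.
  rewrite (_ : eta 0 ^+ 2 / r0 * _ / 2 = eta 0 * (Nb ^+ 2 * e ^+ 3 / (2 * G) * (eta 0 / (r0 * theta)))); last first.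
    by field; rewrite !gt_eqF.
  have N0 : 0 <= Nb ^+ 2 * enorm z ^+ 3 / (2 * G).
    by rewrite divr_ge0 ?mulr_ge0 ?exprn_ge0// ltW.
  apply: ler_pM => //.
  rewrite -[leLHS]mulr1 ler_pM//.
    rewrite ler_pM2r ?invr_gt0 ?mulr_gt0// ler_wpM2l ?sqr_ge0//.
    by rewrite lerXn2r ?nnegrE// ltW.
  by rewrite ler_pdivlMr ?mulr_gt0// mul1r mulrC.
have n0 : 0 <= Nb ^+ 2 * e ^+ 3 / (G * theta).
  by rewrite divr_ge0 ?mulr_ge0 ?exprn_ge0// ltW.
have c1 : 0 <= eta 0 ^+ 2 / r0 * (Nb ^+ 2 * e ^+ 3 / (G * theta)).
  by rewrite mulr_ge0// divr_ge0 ?sqr_ge0// ltW.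
have c2 : 0 <= L2 ^+ 2 * (Nb ^+ 2 * e ^+ 3 / (G * theta)).
  by rewrite mulr_ge0// sqr_ge0.
have step1 : eta r * (G * dotr nu z) <= G * e * (r0 * eta r0 - theta * (r - r0) ^+ 2) - eta r * (G * D).
  have -> : eta r * (G * dotr nu z) = G * e * (r * eta r) - eta r * (G * D).
    by rewrite /D zr; ring.
  by rewrite lerD2r ler_pM2l ?mulr_gt0//; lra.
have step2 : eta r * (2^-1 * bilin A z z) <=
   2^-1 * (eta r * r ^+ 2 * q) * e ^+ 2 + eta r * (G * D) + eta r * (Nb ^+ 2 * enorm z ^+ 3 / (2 * G)).
  rewrite (_ : _ + _ = eta r * (2^-1 * (enorm z ^+ 2 * q) + (G * D + Nb ^+ 2 * enorm z ^+ 3 / (2 * G)))).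
    by rewrite ler_wpM2l//; lra.
  by rewrite zr; ring.
rewrite kz mulrDr.
move: step1 step2 rad m1 c1 c2.
rewrite (_ : eta r0 * (r0 * e * G + 2^-1 * (r0 * e) ^+ 2 * q) =
   G * e * (r0 * eta r0) + 2^-1 * (eta r0 * r0 ^+ 2 * q) * e ^+ 2); last by ring.
rewrite mulrBr [(_ + L2 ^+ 2) * _]mulrDl.
set v1 := eta 0 ^+ 2 / r0 * _; set v2 := L2 ^+ 2 * _.
set v3 := G * e * (r0 * eta r0); set v4 := eta r * (G * D); set v5 := G * e * (theta * _).
rewrite (_ : G * e * theta * (r - r0) ^+ 2 = v5); last by rewrite /v5; ring.
clearbody v1 v2 v3 v4 v5; lra.
Qed.

(** Around [r0 * e] times [nu] the linear part is flat: [enorm z - dotr nu z] is quadratic in the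
    displacement, and by [HC] so is the loss in [r * eta r]. A displacement [dl] therefore costs
    [dl ^+ 2 / e] in the linear part; only the quadratic form pays the first power of [dl]. *)
Lemma peak_lower (r0 L C Nb G e dl : R) A nu z :
  (forall s t, 0 <= s -> 0 <= t -> `|eta s - eta t| <= L * `|s - t|) -> 0 <= L ->
  0 < r0 < 1 -> 0 <= C ->
  (forall r, 0 <= r <= 2 -> r0 * eta r0 - C * (r - r0) ^+ 2 <= r * eta r) ->
  0 < G -> 0 <= Nb -> 0 < e -> 0 < dl -> dl <= r0 * e / 2 -> enorm nu = 1 ->
  (forall z z', `|bilin A z z'| <= Nb * (enorm z * enorm z')) ->
  enorm (z - (r0 * e) *: nu) <= dl ->
  eta r0 * (r0 * e * G + 2^-1 * (r0 * e) ^+ 2 * bilin A nu nu)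
  - G * (C + eta 0 / r0) * (dl ^+ 2 / e) - Nb * (2 * eta 0 + L) * (dl * e) <=
  kernel eta e z * (G * dotr nu z + 2^-1 * bilin A z z).
Proof.
move=> HL L0 /andP[r00 r01] C0 HC G0 Nb0 e0 dl0 dle nu1 HA zd.
pose zeta := z - (r0 * e) *: nu.
have zE : z = (r0 * e) *: nu + zeta by rewrite /zeta addrC subrK.
have zdl : enorm zeta <= dl by exact: zd.
clearbody zeta.
have re0 : 0 < r0 * e by rewrite mulr_gt0.
have re1 : r0 * e < e by rewrite gtr_pMl.
have nrm : enorm ((r0 * e) *: nu) = r0 * e by rewrite enormZ nu1 mulr1 gtr0_norm.
have zn : `|enorm z - r0 * e| <= dl.
  by rewrite -nrm; apply: le_trans (enorm_dist _ _) zd.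
set r := enorm z / e.
have r_0 : 0 <= r by rewrite /r divr_ge0// ltW.
have zr : enorm z = r * e by rewrite /r divfK// gt_eqF.
have znl := zn; rewrite ler_norml in znl; have /andP[zn1 zn2] := znl.
have r2 : r <= 2 by rewrite /r ler_pdivrMr//; lra.
have nuzeta : `|dotr nu zeta| <= dl.
  by have := dotr_le nu zeta; rewrite nu1 mul1r => /le_trans; apply.
have nuz : dotr nu z = r0 * e + dotr nu zeta.
  by rewrite zE dotrDr dotrZr -sqr_enorm nu1 expr1n mulr1.
have /andP[nz1 nz2] : - dl <= dotr nu zeta <= dl by rewrite -ler_norml.
pose D := enorm z - dotr nu z.
have nuz_le : `|dotr nu z| <= enorm z by have := dotr_le nu z; rewrite nu1 mul1r.
have D0 : 0 <= D by rewrite /D subr_ge0 (le_trans (ler_norm _)).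
(* The product of [D] with [enorm z + dotr nu z] is a difference of squares at most [dl ^+ 2], and
   the second factor is at least [2 * (r0 * e - dl) >= r0 * e]. *)
have Dle : D <= dl ^+ 2 / (r0 * e).
  rewrite ler_pdivlMr//.
  have E : D * (enorm z + dotr nu z) = enorm zeta ^+ 2 - dotr nu zeta ^+ 2.
    rewrite (_ : D * _ = enorm z ^+ 2 - dotr nu z ^+ 2); last by rewrite /D; ring.
    have zz : enorm z ^+ 2 = (r0 * e) ^+ 2 + 2 * (r0 * e) * dotr nu zeta + enorm zeta ^+ 2.
      rewrite [in LHS]zE sqr_enorm !(dotrDl, dotrDr) !dotrZl !dotrZr -!sqr_enorm nu1 (dotrC zeta nu).
      ring.
    by rewrite nuz zz; ring.
  apply: (@le_trans _ _ (D * (enorm z + dotr nu z))).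
    by rewrite ler_wpM2l// nuz; lra.
  rewrite E; apply: (@le_trans _ _ (enorm zeta ^+ 2)); first by rewrite gerBl sqr_ge0.
  by rewrite lerXn2r ?nnegrE// ltW.
have eta0 : 0 <= eta r by exact: (eta_ge0 eta_adm).
have etar0 : eta r <= eta 0 by exact: (eta_le0 eta_adm).
have e00 : 0 <= eta 0 by exact: le_trans etar0.
have rr0 : `|r - r0| <= dl / e.
  rewrite (_ : r - r0 = (enorm z - r0 * e) / e); last by rewrite zr; field; rewrite gt_eqF.
  by rewrite normrM (gtr0_norm (x := e^-1)) ?invr_gt0// ler_pM2r ?invr_gt0.
pose q := bilin A nu nu.
have qN : `|q| <= Nb by have := HA nu nu; rewrite nu1 !mulr1.
have Hr : r0 * eta r0 - C * (dl / e) ^+ 2 <= r * eta r.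
  apply: le_trans (HC r _); last by rewrite r_0.
  rewrite lerD2l lerN2 ler_wpM2l// -[leLHS]real_normK ?num_real//.
  by rewrite lerXn2r ?nnegrE// divr_ge0// ltW.
have lin : G * e * (r0 * eta r0) - G * (C + eta 0 / r0) * (dl ^+ 2 / e) <= eta r * (G * dotr nu z).
  have -> : eta r * (G * dotr nu z) = G * (e * (r * eta r) - eta r * D) by rewrite /D zr; ring.
  rewrite (_ : _ - _ = G * (e * (r0 * eta r0 - C * (dl / e) ^+ 2) - eta 0 * (dl ^+ 2 / (r0 * e)))); last first.
    by field; rewrite !gt_eqF.
  rewrite ler_pM2l// lerB//; first by rewrite ler_pM2l.
  by rewrite ler_pM.
have zbnd : enorm z <= 3 / 2 * e by lra.
have quad : `|bilin A z z - (r0 * e) ^+ 2 * q| <= Nb * (dl * (3 * e)).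
  have -> : bilin A z z - (r0 * e) ^+ 2 * q = r0 * e * bilin A nu zeta + bilin A zeta z.
    by have := bilin_expand A (r0 * e) nu zeta; rewrite -zE => ->; rewrite /q; ring.
  have h1 : `|bilin A nu zeta| <= Nb * dl.
    by apply: le_trans (HA _ _) _; rewrite nu1 mul1r ler_wpM2l.
  have h2 : `|bilin A zeta z| <= Nb * (dl * (3 / 2 * e)).
    by apply: le_trans (HA _ _) _; rewrite ler_wpM2l// ler_pM.
  apply: le_trans (ler_normD _ _) _; rewrite normrM (gtr0_norm re0).
  have h3 : r0 * e * `|bilin A nu zeta| <= e * (Nb * dl) by rewrite ler_pM// ltW.
  have p0 : 0 <= Nb * (dl * e) by rewrite !mulr_ge0// ltW.
  rewrite (_ : Nb * (dl * (3 * e)) = 3 * (Nb * (dl * e))); last by ring.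
  rewrite (_ : Nb * (dl * (3 / 2 * e)) = 3 / 2 * (Nb * (dl * e))) in h2; last by ring.
  rewrite (_ : e * (Nb * dl) = Nb * (dl * e)) in h3; last by ring.
  lra.
have etadiff : `|eta r - eta r0| <= L * (dl / e).
  by apply: le_trans (HL _ _ r_0 (ltW r00)) _; rewrite ler_wpM2l.
have quad2 : 2^-1 * (eta r0 * (r0 * e) ^+ 2 * q) - Nb * (2 * eta 0 + L) * (dl * e) <= eta r * (2^-1 * bilin A z z).
  have E : eta r * (2^-1 * bilin A z z) - 2^-1 * (eta r0 * (r0 * e) ^+ 2 * q) =
      2^-1 * (eta r * (bilin A z z - (r0 * e) ^+ 2 * q)) + 2^-1 * ((eta r - eta r0) * (r0 * e) ^+ 2 * q) by ring.
  have k1 : `|eta r * (bilin A z z - (r0 * e) ^+ 2 * q)| <= eta 0 * (Nb * (dl * (3 * e))).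
    by rewrite normrM (ger0_norm eta0) ler_pM.
  have k2 : `|(eta r - eta r0) * (r0 * e) ^+ 2 * q| <= L * (dl / e) * e ^+ 2 * Nb.
    rewrite normrM [X in X * _ <= _]normrM; apply: ler_pM => //; apply: ler_pM => //.
    by rewrite (ger0_norm (sqr_ge0 _)) lerXn2r ?nnegrE ?(ltW re0) ?(ltW e0) ?(ltW re1).
  have k3 : L * (dl / e) * e ^+ 2 * Nb = L * (Nb * (dl * e)) by field; rewrite gt_eqF.
  rewrite k3 in k2.
  have p0 : 0 <= Nb * (dl * e) by rewrite !mulr_ge0// ltW.
  have p1 : 0 <= eta 0 * (Nb * (dl * e)) by rewrite mulr_ge0.
  have p2 : 0 <= L * (Nb * (dl * e)) by rewrite mulr_ge0.
  rewrite (_ : eta 0 * (Nb * (dl * (3 * e))) = 3 * (eta 0 * (Nb * (dl * e)))) in k1; last by ring.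
  rewrite (_ : Nb * (2 * eta 0 + L) * (dl * e) = 2 * (eta 0 * (Nb * (dl * e))) + L * (Nb * (dl * e))); last by ring.
  move: E k1 k2 p1 p2; rewrite !ler_norml.
  set a1 := eta r * (2^-1 * _); set a2 := 2^-1 * (eta r0 * _ * q); set a3 := eta r * (_ - _).
  set a4 := (eta r - eta r0) * _ * q; set a5 := eta 0 * _; set a6 := L * _.
  clearbody a1 a2 a3 a4 a5 a6; move=> E /andP[? ?] /andP[? ?]; lra.
have -> : kernel eta e z = eta r by [].
rewrite [leRHS]mulrDr.
rewrite (_ : eta r0 * (r0 * e * G + 2^-1 * (r0 * e) ^+ 2 * bilin A nu nu) =
   G * e * (r0 * eta r0) + 2^-1 * (eta r0 * (r0 * e) ^+ 2 * q)); last by rewrite /q; ring.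
lra.
Qed.

End infinity_peak.

(** * The statistics controlled on the net *)

Section statistics.
Context {R : realType} {d : nat}.
Variable eta : R -> R.
Hypothesis eta_adm : @admissible_kernel R d eta.
Implicit Types (z : 'rV[R]_d).

Definition clamp (lo hi t : R) : R := Num.max lo (Num.min hi t).

Lemma clamp_bounds lo hi t : lo <= hi -> lo <= clamp lo hi t <= hi.
Proof. by move=> lh; rewrite /clamp le_max lexx/= ge_max lh ge_min lexx. Qed.

Lemma clamp_id lo hi t : lo <= t <= hi -> clamp lo hi t = t.
Proof. by move=> /andP[h1 h2]; rewrite /clamp min_r// max_r. Qed.

Lemma clamp_lipschitz lo hi s t : `|clamp lo hi s - clamp lo hi t| <= `|s - t|.
Proof.
have := ler_norm (s - t); have := ler_norm (- (s - t)); rewrite normrN => h1 h2.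
rewrite /clamp ler_norml; case: (leP hi s); case: (leP hi t) => h3 h4;
  do ! (case: (leP lo _) => ?); apply/andP; split; lra.
Qed.

(** A Lipschitz substitute for the indicator of the ball of radius [e]: 1 on the ball, 0 from radius
    [e + w] on, linear in between. *)
Definition cutoff (w e : R) z : R := clamp 0 1 ((e + w - enorm z) / w).

(** Coordinates in units of [h], truncated so that the statistics are globally bounded and
    Lipschitz. For radii up to [2 * b * h] the truncation is inactive wherever the kernel is
    nonzero. *)
Definition scaled_coord (b h : R) (a : option 'I_d) z : R :=
  if a is Some i then clamp (- (2 * b)) (2 * b) (z 0 i / h) else 1.

(* [None] counts points; [Some (a, b)] are the kernel moments of order 0, 1, 2. *)
Definition statistic (w b h : R) (k : option (option 'I_d * option 'I_d)) (e : R) z : R :=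
  if k is Some (a, a') then kernel eta e z * scaled_coord b h a z * scaled_coord b h a' z
  else cutoff w e z.

Lemma cutoff_bounds w e z : 0 <= cutoff w e z <= 1.
Proof. exact: clamp_bounds. Qed.

Lemma cutoff1 w e z : 0 < w -> enorm z <= e -> cutoff w e z = 1.
Proof.
move=> w0 ze; rewrite /cutoff /clamp min_l ?max_r//.
by rewrite ler_pdivlMr// mul1r; lra.
Qed.

Lemma cutoff0 w e z : 0 < w -> e + w <= enorm z -> cutoff w e z = 0.
Proof.
move=> w0 ze; rewrite /cutoff /clamp max_l// ge_min.
by apply/orP; right; rewrite ler_pdivrMr// mul0r; lra.
Qed.

Lemma cutoff_lipschitz w e e' z z' : 0 < w ->
  `|cutoff w e z - cutoff w e' z'| <= w^-1 * (enorm (z - z') + `|e - e'|).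
Proof.
move=> w0; apply: le_trans (clamp_lipschitz _ _ _ _) _.
rewrite (_ : _ - _ = w^-1 * ((e - e') - (enorm z - enorm z'))); last by ring.
rewrite normrM (gtr0_norm (x := w^-1)) ?invr_gt0// ler_pM2l ?invr_gt0//.
by apply: le_trans (ler_normB _ _) _; rewrite addrC lerD2r enorm_dist.
Qed.

Lemma scaled_coord_le b h a z : 0 <= b -> `|scaled_coord b h a z| <= 1 + 2 * b.
Proof.
move=> b0; case: a => [i|] /=; last by rewrite normr1; lra.
have /andP[h1 h2] : - (2 * b) <= clamp (- (2 * b)) (2 * b) (z 0 i / h) <= 2 * b.
  by apply: clamp_bounds; lra.
by rewrite ler_norml; apply/andP; split; lra.
Qed.

Lemma scaled_coord_lipschitz b h a z z' : 0 < h ->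
  `|scaled_coord b h a z - scaled_coord b h a z'| <= h^-1 * enorm (z - z').
Proof.
move=> h0; case: a => [i|] /=; last by rewrite subrr normr0 mulr_ge0// invr_ge0 ltW.
apply: le_trans (clamp_lipschitz _ _ _ _) _.
rewrite -mulrBl mulrC normrM (gtr0_norm (x := h^-1)) ?invr_gt0// ler_pM2l ?invr_gt0//.
by have := coord_le_enorm (z - z') i; rewrite !mxE.
Qed.

Lemma scaled_coordE b h i z : 0 < h -> enorm z <= 2 * b * h -> scaled_coord b h (Some i) z = z 0 i / h.
Proof.
move=> h0 zb; apply: clamp_id; rewrite -ler_norml normrM (gtr0_norm (x := h^-1)) ?invr_gt0//.
by rewrite ler_pdivrMr// (le_trans (coord_le_enorm z i)).
Qed.

Lemma kernel_joint_lipschitz (L lo e e' : R) z z' : 0 < lo -> lo <= e -> lo <= e' -> 0 <= L ->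
  (forall s t, 0 <= s -> 0 <= t -> `|eta s - eta t| <= L * `|s - t|) ->
  `|kernel eta e z - kernel eta e' z'| <= L / lo * (enorm (z - z') + `|e - e'|).
Proof.
move=> lo0 le1 le2 L0 HL.
have e0 : 0 < e by exact: lt_le_trans le1. have e0' : 0 < e' by exact: lt_le_trans le2.
have Llo q : lo <= q -> L / q <= L / lo.
  by move=> lq; rewrite ler_wpM2l// lef_pV2 ?posrE// (lt_le_trans lo0).
rewrite -(subrKA (kernel eta e z')) mulrDr; apply: le_trans (ler_normD _ _) _; apply: lerD.
  by apply: le_trans (kernel_lipschitz e0 HL L0 z z') _; rewrite ler_wpM2r// Llo.
wlog ee : e e' le1 le2 e0 e0' / e <= e'.
  move=> W; have [ee|/ltW ee] := leP e e'; first exact: W.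
  by rewrite distrC (distrC e); exact: W.
(* From radius [e'] on both kernels vanish. Otherwise [enorm z' / e' <= 1], and the difference of
   the two quotients is at most [(e' - e) / e]. *)
have [z1|z1] := leP e' (enorm z').
  rewrite !(kernel_supp eta_adm) ?(le_trans ee)// subrr normr0 mulr_ge0// divr_ge0// ltW//.
apply: le_trans (HL _ _ (divr_ge0 (enorm_ge0 _) (ltW e0)) (divr_ge0 (enorm_ge0 _) (ltW e0'))) _.
rewrite (_ : enorm z' / e - enorm z' / e' = (enorm z' / e') * ((e' - e) / e)); last first.
  by field; rewrite !gt_eqF.
rewrite normrM; apply: (@le_trans _ _ (L * (1 * `|(e' - e) / e|))).
  rewrite ler_wpM2l// ler_wpM2r// ger0_norm ?divr_ge0 ?(ltW e0')//.
  by rewrite ler_pdivrMr// mul1r ltW.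
rewrite mul1r normrM (gtr0_norm (x := e^-1)) ?invr_gt0// mulrCA (distrC e) [leRHS]mulrC.
by rewrite ler_wpM2l// Llo.
Qed.

Lemma statistic_bound w b h k e z : 0 < e -> 0 <= b ->
  `|statistic w b h k e z| <= (eta 0 + 1) * (1 + 2 * b) ^+ 2.
Proof.
move=> e0 b0; have E0 : 0 <= eta 0 by exact: (eta_ge0 eta_adm).
have B1 : 1 <= 1 + 2 * b by lra.
case: k => [[a a']|] /=.
  rewrite !normrM expr2 mulrA; apply: ler_pM; rewrite ?mulr_ge0//; last exact: scaled_coord_le.
  apply: ler_pM => //; last exact: scaled_coord_le.
  by apply: le_trans (kernel_norm_le eta_adm z e0) _; rewrite lerDl.
have /andP[c0 c1] := cutoff_bounds w e z; rewrite ger0_norm//; apply: le_trans c1 _.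
rewrite -[leLHS]mulr1 ler_pM ?exprn_ege1//; lra.
Qed.

Lemma statistic_lipschitz (L lo w b h : R) k e e' z z' : 0 < lo -> lo <= e -> lo <= e' -> 0 <= L ->
  0 < w -> 0 < h -> 0 <= b ->
  (forall s t, 0 <= s -> 0 <= t -> `|eta s - eta t| <= L * `|s - t|) ->
  `|statistic w b h k e z - statistic w b h k e' z'| <=
  (w^-1 + L / lo * (1 + 2 * b) ^+ 2 + 2 * (eta 0 * (1 + 2 * b)) / h) * (enorm (z - z') + `|e - e'|).
Proof.
move=> lo0 le1 le2 L0 w0 h0 b0 HL; have E0 : 0 <= eta 0 by exact: (eta_ge0 eta_adm).
have e0 : 0 < e by exact: lt_le_trans le1. have e0' : 0 < e' by exact: lt_le_trans le2.
set D := enorm (z - z') + `|e - e'|.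
have D0 : 0 <= D by rewrite addr_ge0.
have zD : enorm (z - z') <= D by rewrite lerDl.
have p1 : 0 <= w^-1 * D by rewrite mulr_ge0// invr_ge0 ltW.
have p2 : 0 <= L / lo * (1 + 2 * b) ^+ 2 * D.
  by apply: mulr_ge0 => //; apply: mulr_ge0; [rewrite divr_ge0// ltW|exact: sqr_ge0].
have p3 : 0 <= 2 * (eta 0 * (1 + 2 * b)) / h * D.
  rewrite mulr_ge0// divr_ge0 ?(ltW h0)// mulr_ge0// mulr_ge0//; lra.
rewrite 2![(_ + _) * D]mulrDl; case: k => [[a a']|] /=; last first.
  by apply: le_trans (cutoff_lipschitz e e' z z' w0) _; rewrite -addrA lerDl addr_ge0.
set B := 1 + 2 * b in p2 p3 *.
have B0 : 0 <= B by rewrite /B; lra.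
set f := kernel eta e z; set f' := kernel eta e' z'.
set g := scaled_coord b h a z; set g' := scaled_coord b h a z'.
set k := scaled_coord b h a' z; set k' := scaled_coord b h a' z'.
have df : `|f - f'| <= L / lo * D by exact: kernel_joint_lipschitz.
have hg : h^-1 * enorm (z - z') <= h^-1 * D by rewrite ler_pM2l ?invr_gt0.
have dg : `|g - g'| <= h^-1 * D by exact: le_trans (scaled_coord_lipschitz b a z z' h0) hg.
have dk : `|k - k'| <= h^-1 * D by exact: le_trans (scaled_coord_lipschitz b a' z z' h0) hg.
have gB : `|g| <= B by exact: scaled_coord_le.
have gB' : `|g'| <= B by exact: scaled_coord_le.
have kB : `|k| <= B by exact: scaled_coord_le.
have fE : `|f'| <= eta 0 by exact: (kernel_norm_le eta_adm).
rewrite (_ : f * g * k - f' * g' * k' = (f - f') * g * k + f' * (g - g') * k + f' * g' * (k - k')); last by ring.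
have t1 : `|(f - f') * g * k| <= L / lo * B ^+ 2 * D.
  rewrite !normrM (_ : L / lo * B ^+ 2 * D = (L / lo * D) * B * B); last by ring.
  by apply: ler_pM; rewrite ?mulr_ge0//; apply: ler_pM.
have t2 : `|f' * (g - g') * k| <= eta 0 * B / h * D.
  rewrite !normrM (_ : eta 0 * B / h * D = eta 0 * (h^-1 * D) * B); last by ring.
  by apply: ler_pM; rewrite ?mulr_ge0//; apply: ler_pM.
have t3 : `|f' * g' * (k - k')| <= eta 0 * B / h * D.
  rewrite !normrM (_ : eta 0 * B / h * D = eta 0 * B * (h^-1 * D)); last by ring.
  by apply: ler_pM; rewrite ?mulr_ge0//; apply: ler_pM.
have n1 := ler_normD ((f - f') * g * k + f' * (g - g') * k) (f' * g' * (k - k')).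
have n2 := ler_normD ((f - f') * g * k) (f' * (g - g') * k).
rewrite (_ : 2 * (eta 0 * B) / h * D = 2 * (eta 0 * B / h * D)); last by ring.
lra.
Qed.

Lemma measurable_statistic w b h k e : 0 < w -> 0 < h -> 0 <= b -> 0 < e ->
  measurable_fun setT (statistic w b h k e : _ -> measurableTypeR R).
Proof.
move=> w0 h0 b0 e0; have [L L0 HL] := eta_lipschitz eta_adm.
apply: lipschitz_measurable => x y.
have := statistic_lipschitz k x y e0 (lexx _) (lexx e) (ltW L0) w0 h0 b0 HL.
by rewrite subrr normr0 addr0; exact.
Qed.

Lemma statistic_supp w b h k e r z : 0 < w -> 0 < e -> e + w <= r -> r < enorm z -> statistic w b h k e z = 0.
Proof.
move=> w0 e0 er rz; case: k => [[a a']|] /=; last by rewrite cutoff0//; lra.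
by rewrite (kernel_supp eta_adm) ?mul0r//; lra.
Qed.

End statistics.

(** * The nearest neighbor radius *)

Section nearest_neighbors.
Context {R : realType} {d : nat}.
Implicit Types (x z : 'rV[R]_d) (S : seq 'rV[R]_d).

Lemma nb_points_cutoff_ge S w e x : 0 < w ->
  (nb_points S e x)%:R <= \sum_(y <- S) cutoff w e (y - x).
Proof.
move=> w0; rewrite /nb_points -sum1_count natr_sum big_mkcond/=; apply: ler_sum => y _.
rewrite enormB; case: ifP => [h|_]; first by rewrite cutoff1.
by have /andP[] := cutoff_bounds w e (y - x).
Qed.

Lemma nb_points_cutoff_le S w e x : 0 < w ->
  \sum_(y <- S) cutoff w e (y - x) <= (nb_points S (e + w) x)%:R.
Proof.
move=> w0; rewrite /nb_points -sum1_count natr_sum [leRHS]big_mkcond/=; apply: ler_sum => y _.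
rewrite enormB; case: (leP (enorm (y - x)) (e + w)) => [_|h]; last by rewrite cutoff0// ltW.
by have /andP[] := cutoff_bounds w e (y - x).
Qed.

Lemma nb_points_mono S x e e' : e <= e' -> (nb_points S e x <= nb_points S e' x)%N.
Proof. by move=> ee; apply: sub_count => y /= h; exact: le_trans ee. Qed.

Section radius.
Variables (S : seq 'rV[R]_d) (k : nat) (x : 'rV[R]_d).

Lemma knn_radius_has_inf e : 0 < e -> (k <= nb_points S e x)%N ->
  has_inf [set eps : R | 0 < eps /\ (k <= nb_points S eps x)%N].
Proof. by move=> e0 ke; split; [exists e|exists 0 => y [/ltW]]. Qed.

Lemma knn_radius_le e : 0 < e -> (k <= nb_points S e x)%N -> knn_radius k S x <= e.
Proof.
by move=> e0 ke; apply: ge_inf; [case: (knn_radius_has_inf e0 ke)|].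
Qed.

(** The radius [e0] witnesses that the defining set is nonempty. This matters because [inf] of the
    empty set is 0, which would spoil a lower bound. *)
Lemma knn_radius_ge e0 e : 0 < e0 -> (k <= nb_points S e0 x)%N ->
  (nb_points S e x < k)%N -> e <= knn_radius k S x.
Proof.
move=> e00 ke0 ke; apply: lb_le_inf; first by exists e0.
move=> y [y0 ky]; rewrite leNgt; apply/negP => /ltW ye.
by have := leq_trans ky (nb_points_mono S x ye); rewrite leqNgt ke.
Qed.

(** The strict inequality avoids deciding whether the infimum is attained; the layer of the cutoff
    absorbs the gap. *)
Lemma nb_points_above e0 e : 0 < e0 -> (k <= nb_points S e0 x)%N ->
  knn_radius k S x < e -> (k <= nb_points S e x)%N.
Proof.
move=> e00 ke0 re; have e1 : 0 < e - knn_radius k S x by rewrite subr_gt0.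
have [y [y0 ky] ye] := inf_adherent e1 (knn_radius_has_inf e00 ke0).
apply: leq_trans ky _; apply: nb_points_mono; apply: ltW; apply: lt_le_trans ye _.
by rewrite addrC subrK.
Qed.

Lemma nb_points_below e : 0 < e -> e < knn_radius k S x -> (nb_points S e x < k)%N.
Proof.
move=> e0 er; rewrite ltnNge; apply/negP => ke.
by have := knn_radius_le e0 ke; rewrite leNgt er.
Qed.

End radius.

(** A rough estimate locates the radius before the finer one can be applied to it. At [a * h] the
    count is at most [k / 4 + k / 4], below [k]; at [b * h / 2] the cutoff sum is at least
    [5 k / 4 - k / 4 = k]. *)
Lemma knn_radius_coarse S n k x (c w a b h : R) (F : R -> R) :
  (forall e, F e = n%:R^-1 * \sum_(y <- S) cutoff w e (y - x)) -> (0 < n)%N ->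
  0 < h -> h ^+ d = k%:R / n%:R -> 0 < a -> a <= b / 2 -> 0 < w -> w <= b * h / 2 ->
  (forall e, a * h <= e <= b * h -> `|F e - c * e ^+ d| <= 4^-1 * h ^+ d) ->
  c * a ^+ d <= 4^-1 -> 5%:R / 4 <= c * (b / 2) ^+ d ->
  a * h <= knn_radius k S x <= b * h.
Proof.
move=> FE n0 h0 hk a0 ab w0 wb HF ca cb.
have n0' : 0 < n%:R :> R by rewrite ltr0n.
have hd0 : 0 < h ^+ d by rewrite exprn_gt0.
have kE : k%:R = n%:R * h ^+ d by rewrite hk mulrCA divff ?mulr1// gt_eqF.
have nbF e : n%:R * F e = \sum_(y <- S) cutoff w e (y - x) by rewrite FE mulrA divff ?mul1r// gt_eqF.
have ah : a * h <= b * h / 2 by rewrite mulrAC ler_pM2r.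
have bh0 : 0 < b * h by apply: lt_le_trans (_ : a * h * 2 <= _); [rewrite !mulr_gt0|lra].
have up : (k <= nb_points S (b * h) x)%N.
  rewrite -(ler_nat R) kE; apply: (@le_trans _ _ (n%:R * F (b * h / 2))).
    rewrite ler_pM2l//.
    have := HF (b * h / 2); rewrite ah/= (_ : b * h / 2 <= b * h) ?ler_norml; last lra.
    move=> /(_ isT)/andP[+ _]; rewrite [b * h / 2]mulrAC exprMn mulrA.
    have : 5%:R / 4 * h ^+ d <= c * (b / 2) ^+ d * h ^+ d by rewrite ler_pM2r.
    set u := c * _ * _; lra.
  rewrite nbF; apply: le_trans (nb_points_cutoff_le S _ x w0) _.
  by rewrite ler_nat nb_points_mono//; lra.
have lo : (nb_points S (a * h) x < k)%N.
  rewrite -(ltr_nat R) kE; apply: le_lt_trans (nb_points_cutoff_ge S _ x w0) _.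
  rewrite -nbF ltr_pM2l//.
  have := HF (a * h); rewrite lexx/= (_ : a * h <= b * h) ?ler_norml; last lra.
  move=> /(_ isT)/andP[_]; rewrite exprMn mulrA.
  have : c * a ^+ d * h ^+ d <= 4^-1 * h ^+ d by rewrite ler_pM2r.
  set u := c * _ * _; lra.
by rewrite (knn_radius_ge bh0 up lo) knn_radius_le.
Qed.

(** Slightly above the radius there are at least [k] points and slightly below it fewer; the cutoff
    sums on both sides squeeze [c] times the power of the radius, up to shells of width [2 * w]. *)
Lemma knn_radius_fine S n k x (c w a b h E : R) (F : R -> R) :
  (forall e, F e = n%:R^-1 * \sum_(y <- S) cutoff w e (y - x)) -> (0 < n)%N -> (0 < d)%N ->
  0 < h -> h ^+ d = k%:R / n%:R -> 0 < a -> 0 < w -> 4 * w <= a * h -> 4 * w <= b * h -> 0 <= c ->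
  (forall e, a * h / 2 <= e <= 2 * b * h -> `|F e - c * e ^+ d| <= E * h ^+ d) ->
  a * h <= knn_radius k S x <= b * h ->
  `|c * knn_radius k S x ^+ d - h ^+ d| <= E * h ^+ d + c * 3 ^+ d * (2 * w * (b * h) ^+ d.-1).
Proof.
move=> FE n0 d0 h0 hk a0 w0 wa wb c0 HF; set ep := knn_radius k S x => /andP[aep epb].
have n0' : 0 < n%:R :> R by rewrite ltr0n.
have kE : k%:R = n%:R * h ^+ d by rewrite hk mulrCA divff ?mulr1// gt_eqF.
have nbF e : n%:R * F e = \sum_(y <- S) cutoff w e (y - x) by rewrite FE mulrA divff ?mul1r// gt_eqF.
have ah0 : 0 < a * h by rewrite mulr_gt0.
have ep0 : 0 < ep by exact: lt_le_trans aep.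
have powD (e q : R) : 0 <= e -> 0 <= q <= e -> (e + q) ^+ d <= e ^+ d + 3 ^+ d * (q * e ^+ d.-1).
  by move=> e0 qe; move: (exprD_le d.-1 e0 qe); rewrite prednK.
have Epow e : 0 <= e -> e <= ep -> c * (3 ^+ d * (2 * w * e ^+ d.-1)) <= c * 3 ^+ d * (2 * w * (b * h) ^+ d.-1).
  move=> e0 ee; rewrite mulrA ler_wpM2l ?mulr_ge0// ler_wpM2l ?mulr_ge0 ?(ltW w0)//.
  by apply: lerXn2r; rewrite ?nnegrE// ?(le_trans ee)//; lra.
have up : h ^+ d <= c * ep ^+ d + E * h ^+ d + c * 3 ^+ d * (2 * w * (b * h) ^+ d.-1).
  have k1 : (k <= nb_points S (ep + w) x)%N.
    (* The radius is positive, so its defining set cannot be empty: the infimum would be 0 by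
       default. *)
    have [e [e0 ke]] : exists e, 0 < e /\ (k <= nb_points S e x)%N.
      apply: contrapT => no; have : [set eps : R | 0 < eps /\ (k <= nb_points S eps x)%N] = set0.
        by rewrite -subset0 => e He; apply: no; exists e.
      by move=> E0; move: ep0; rewrite /ep /knn_radius E0 inf0 ltxx.
    by apply: (nb_points_above e0 ke); rewrite -/ep; lra.
  have h1 : h ^+ d <= F (ep + w).
    rewrite -(ler_pM2l n0') -kE nbF; apply: le_trans (nb_points_cutoff_ge S _ x w0).
    by rewrite ler_nat.
  have := HF (ep + w); rewrite ler_norml => /(_ _)/andP[]; first by apply/andP; split; lra.
  move=> _ h2.
  have h3 : c * (ep + w) ^+ d <= c * ep ^+ d + c * (3 ^+ d * (2 * w * ep ^+ d.-1)).
    rewrite -mulrDr ler_wpM2l//; apply: (@le_trans _ _ (ep ^+ d + 3 ^+ d * (w * ep ^+ d.-1))).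
      by apply: powD; [exact: ltW|apply/andP; split; lra].
    rewrite lerD2l ler_wpM2l// ler_wpM2r ?exprn_ge0 ?(ltW ep0)//; lra.
  have := Epow ep (ltW ep0) (lexx _); lra.
have lo : c * ep ^+ d <= h ^+ d + E * h ^+ d + c * 3 ^+ d * (2 * w * (b * h) ^+ d.-1).
  (* The cutoff of radius [ep - 2 * w] reaches out to [ep - w], still strictly below the nearest
     neighbor radius; hence the double width. *)
  have e0 : 0 <= ep - 2 * w by lra.
  have k1 : (nb_points S (ep - w) x < k)%N by apply: nb_points_below; rewrite -/ep; lra.
  have h1 : F (ep - 2 * w) <= h ^+ d.
    rewrite -(ler_pM2l n0') -kE nbF; apply: le_trans (nb_points_cutoff_le S _ x w0) _.
    have -> : ep - 2 * w + w = ep - w by ring.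
    by rewrite ler_nat; exact: ltnW.
  have := HF (ep - 2 * w); rewrite ler_norml => /(_ _)/andP[]; first by apply/andP; split; lra.
  move=> h2 _.
  have h3 : c * ep ^+ d <= c * (ep - 2 * w) ^+ d + c * (3 ^+ d * (2 * w * (ep - 2 * w) ^+ d.-1)).
    rewrite -mulrDr ler_wpM2l// -[X in X ^+ d <= _](subrK (2 * w) ep).
    by apply: powD; [lra|apply/andP; split; lra].
  have e1 : ep - 2 * w <= ep by lra.
  have := Epow (ep - 2 * w) e0 e1. lra.
rewrite ler_norml; apply/andP; split; lra.
Qed.

End nearest_neighbors.

(** * Empirical moments at a point *)

Lemma chain_close {R : realType} (F I J p q k t A B : R) :
  `|F - I| <= t -> `|I - J| <= k -> p <= J -> J <= p + q -> q <= A -> k <= B -> `|F - p| <= A + B + t.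
Proof.
by rewrite !ler_norml => /andP[? ?] /andP[? ?] ? ? ? ?; apply/andP; split; lra.
Qed.

Section moments.
Context {R : realType} {d : nat}.
Variables (i0 : 'I_d) (eta : R -> R).
Hypothesis eta_adm : @admissible_kernel R d eta.
Variables (Om : set 'rV[R]_d) (rho : 'rV[R]_d -> R) (beta K1 K2 : R).
Variable Q : probability 'rV[R]_d R.
Hypotheses (oOm : open Om) (beta0 : 0 < beta).
Hypothesis rho_cont : forall x, Om x -> {for x, continuous rho}.
Hypothesis rho_bounds : forall x, Om x -> beta <= rho x <= beta^-1.
Hypothesis QE : forall A, measurable A ->
  Q A = (\int[lebesgue_rV d]_(x in A `&` Om) (rho x)%:E)%E.
Hypotheses (K1_ge0 : 0 <= K1) (K2_ge0 : 0 <= K2).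
Hypothesis rho1 : forall x z r, ecball x r `<=` Om -> enorm z <= r ->
  `|rho (x + z) - rho x| <= K1 * enorm z.
Hypothesis rho2 : forall x z r, ecball x r `<=` Om -> enorm z <= r ->
  `|rho (x + z) - rho x - \sum_i z 0 i * partial i rho x| <= K2 * enorm z ^+ 2.
Local Notation mu := (lebesgue_rV d).
Local Notation B := (ecball (0 : 'rV[R]_d)).
Local Notation al := (ball_volume R d).

Variables (n : nat) (Y : nat -> 'rV[R]_d) (x : 'rV[R]_d) (a b om tau lam h : R).
Hypothesis dpos : (0 < d)%N.
Hypotheses (n0 : (0 < n)%N) (a0 : 0 < a) (ab : a <= b) (b1 : 1 <= b) (om0 : 0 < om) (oma : om <= a).
Hypotheses (tau0 : 0 < tau) (lam0 : 0 < lam) (lam4 : 4 * lam <= 1) (h0 : 0 < h) (h1 : h <= 1).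
Hypothesis xOm : ecball x (3 * b * h) `<=` Om.
(** The factor [lam] makes the layer of the cutoff a fraction of order [lam] of the ball. The
    deviation [t] is the fraction [tau * lam * h] of [h ^+ d], the order of magnitude of the
    means. *)
Let w : R := lam * om * h.
Let t : R := tau * lam * h ^+ d.+1.
Hypothesis dev : forall k e, a * h / 2 <= e <= 2 * b * h ->
  `|\sum_(0 <= j < n) statistic eta w b h k e (Y j - x)
    - n%:R * \int[Q]_y statistic eta w b h k e (y - x)| <= 3 * (n%:R * t).

Let scales : [/\ 0 < a, a <= b, 1 <= b & 0 < om] /\ [/\ om <= a, 0 < tau, 0 < lam & 4 * lam <= 1] /\ (0 < h <= 1).
Proof. by rewrite h0 h1. Qed.
Let w0 : 0 < w. Proof. by rewrite /w !mulr_gt0. Qed.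
Let wa : 4 * w <= a * h.
Proof.
have h3 : 4 * lam * om <= a by apply: le_trans oma; rewrite ler_piMl// ltW.
by rewrite /w (_ : 4 * (lam * om * h) = 4 * lam * om * h); [rewrite ler_pM2r|ring].
Qed.
Let Omx : Om x.
Proof. by apply: xOm; rewrite /ecball/= subrr enorm0; apply: mulr_ge0; [apply: mulr_ge0 => //; exact: le_trans b1|exact: ltW]. Qed.
Let al0 : 0 < al. Proof. by apply: ball_volume_gt0. Qed.

Let dev_mean k e : a * h / 2 <= e <= 2 * b * h ->
  `|n%:R^-1 * \sum_(0 <= j < n) statistic eta w b h k e (Y j - x)
    - \int[Q]_y statistic eta w b h k e (y - x)| <= 3 * t.
Proof.
move=> He; have n0' : 0 < n%:R :> R by rewrite ltr0n.
rewrite -(ler_pM2l n0') -[X in X * `|_|](gtr0_norm n0') -normrM mulrBr mulVKf ?gt_eqF//.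
by rewrite (mulrCA n%:R); exact: dev.
Qed.

Lemma bvol_le_cutoff (e : R) : 0 < e -> bvol d e <= \int[mu]_(z in B (e + w)) cutoff w e z.
Proof.
move=> e0; have mc : measurable_fun setT (cutoff w e : 'rV[R]_d -> measurableTypeR R).
  exact: (measurable_statistic eta_adm None w0 h0 (le_trans ler01 b1) e0).
have ic : mu.-integrable (B (e + w)) (EFin \o cutoff w e).
  apply: (@ball_integrable _ _ _ 1) => // z _.
  by have /andP[c0 c1] := cutoff_bounds w e z; rewrite ger0_norm.
rewrite /bvol /Rintegral; apply: fine_le.
- by rewrite ge0_fin_numE// ecball_finite.
- by apply: integrable_fin_num => //; exact: measurable_ecball.
- rewrite -[leLHS]mul1e -(integral_cst mu); last exact: measurable_ecball.
  apply: (@le_trans _ _ (\int[mu]_(z in B e) (cutoff w e z)%:E)%E).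
    by rewrite le_eqVlt; apply/orP; left; apply/eqP; apply: eq_integral => z /set_mem; rewrite /ecball/= subr0 => ze; rewrite cutoff1.
  apply: ge0_subset_integral; [exact: measurable_ecball|exact: measurable_ecball| | |].
  + by apply/measurable_EFinP; exact: measurable_funTS.
  + by move=> z _; rewrite lee_fin; have /andP[] := cutoff_bounds w e z.
  + by move=> z; rewrite /ecball/= => /le_trans; apply; rewrite lerDl ltW.
Qed.

(** The three terms come from the layer of the cutoff, the variation of [rho] over the ball, and the
    deviation of the sample. *)
Lemma counts_close (e : R) : a * h / 2 <= e <= 2 * b * h ->
  `|n%:R^-1 * \sum_(0 <= j < n) cutoff w e (Y j - x) - rho x * al * e ^+ d| <=
  (beta^-1 * 3 ^+ d * al * om * (2 * b) ^+ d.-1 * lam + (K1 * (3 * b) ^+ d.+1 * al + 3 * tau * lam) * h) * h ^+ d.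
Proof.
move=> He; have /andP[He1 He2] := He.
have [[a0' ab' b1' om0'] [[oma' tau0' lam0' lam4'] /andP[h0' h1']]] := scales.
have ah0 : 0 < a * h by rewrite mulr_gt0.
have ah : a * h <= b * h by rewrite ler_pM2r.
have e0 : 0 < e by lra.
have /andP[rb1 rb2] := rho_bounds Omx.
have rx0 : 0 < rho x by exact: lt_le_trans rb1.
have wa' := wa; have w0' := w0.
pose r := e + w; have r0 : 0 < r by rewrite /r addr_gt0.
have r3 : r <= 3 * b * h by rewrite /r; lra.
have := dev_mean None He; rewrite /= => D.
have mc : measurable_fun setT (cutoff w e : 'rV[R]_d -> measurableTypeR R).
  exact: (measurable_statistic eta_adm None w0 h0 (le_trans ler01 b1) e0).
have cM (z : 'rV[R]_d) : `|cutoff w e z| <= 1.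
  by have /andP[c0 c1] := cutoff_bounds w e z; rewrite ger0_norm.
have rOm : ecball x r `<=` Om by move=> y /= yr; apply: xOm; exact: le_trans r3.
have cS (z : 'rV[R]_d) : r < enorm z -> cutoff w e z = 0 by move=> rz; rewrite cutoff0// ltW.
have cK z : enorm z <= r -> `|rho (x + z) - rho x| <= K1 * r.
  by move=> zr; apply: le_trans (rho1 rOm zr) _; rewrite ler_wpM2l.
have L1 := law_integral_order1 oOm beta0 rho_cont rho_bounds QE mc cM cS rOm cK.
have J1 := bvol_le_cutoff e0; rewrite -/r in J1 *.
have J2 : \int[mu]_(z in B r) cutoff w e z <= bvol d r.
  have := Rintegral_ball_le (r := r) mc (fun z _ => cM z); rewrite mul1r.
  by apply: le_trans; exact: ler_norm.
have J3 : bvol d r <= bvol d e + 3 ^+ d * al * (w * e ^+ d.-1).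
  by apply: bvolD_le => //; apply/andP; split; lra.
move: D L1 J1 J2 J3; set I := \int[Q]_y _; set J := \int[mu]_(z in _) _.
rewrite (bvol_scale r0) (bvol_scale e0) mul1r; set F := _ * \sum_(_ <= _ < _) _.
move=> D L1 J1 J2 J3.
have p0 : 0 <= h ^+ d by rewrite exprn_ge0// ltW.
have t1 : rho x * (3 ^+ d * al * (w * e ^+ d.-1)) <=
    beta^-1 * 3 ^+ d * al * om * (2 * b) ^+ d.-1 * lam * h ^+ d.
  have -> : beta^-1 * 3 ^+ d * al * om * (2 * b) ^+ d.-1 * lam * h ^+ d =
      beta^-1 * (3 ^+ d * al * (w * (2 * b * h) ^+ d.-1)).
    have -> : h ^+ d = h * h ^+ d.-1 by rewrite -exprS prednK.
    by rewrite [(2 * b * h) ^+ _](exprMn _ (2 * b) h) /w; ring.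
  apply: ler_pM; [exact: ltW| |exact: rb2|].
    by apply: mulr_ge0; [apply: mulr_ge0 => //; exact: ltW|apply: mulr_ge0; [exact: ltW|apply: exprn_ge0; exact: ltW]].
  rewrite ler_pM2l ?mulr_gt0// ler_pM2l//.
  by apply: lerXn2r; [exact: ltW|exact: le_trans (ltW e0) He2|exact: He2].
have t2 : K1 * r * (r ^+ d * al) <= K1 * (3 * b) ^+ d.+1 * al * h * h ^+ d.
  have -> : K1 * r * (r ^+ d * al) = K1 * al * r ^+ d.+1 by rewrite exprS; ring.
  have -> : K1 * (3 * b) ^+ d.+1 * al * h * h ^+ d = K1 * al * (3 * b * h) ^+ d.+1 by rewrite [in RHS](exprMn _ (3 * b) h) [h ^+ d.+1]exprS; ring.
  rewrite ler_wpM2l ?mulr_ge0 ?(ltW al0)//.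
  by apply: lerXn2r; [exact: ltW|exact: le_trans (ltW r0) r3|exact: r3].
have t3 : 3 * t = 3 * tau * lam * h * h ^+ d by rewrite /t exprS; ring.
have u1 : rho x * (e ^+ d * al) <= rho x * J by rewrite ler_pM2l.
have u2 : rho x * J <= rho x * (e ^+ d * al) + rho x * (3 ^+ d * al * (w * e ^+ d.-1)).
  by rewrite -mulrDr ler_pM2l//; exact: le_trans J3.
rewrite (_ : rho x * al * e ^+ d = rho x * (e ^+ d * al)); last by ring.
rewrite [leRHS](_ : _ = beta^-1 * 3 ^+ d * al * om * (2 * b) ^+ d.-1 * lam * h ^+ d
  + K1 * (3 * b) ^+ d.+1 * al * h * h ^+ d + 3 * t); last by rewrite t3; ring.
exact: chain_close D L1 u1 u2 t1 t2.
Qed.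

Let M : R := (eta 0 + 1) * (1 + 2 * b) ^+ 2.

Definition moment_const : R := M * (K1 + K2) * b ^+ d.+2 * al + 3 * tau.

Section kernel_moments.
Variable e : R.
Hypotheses (ea : a * h <= e) (eb : e <= b * h).
Let He : a * h / 2 <= e <= 2 * b * h.
Proof.
have [[a0' ab' b1' om0'] [[oma' tau0' lam0' lam4'] /andP[h0' h1']]] := scales.
have h2 : 0 < a * h by rewrite mulr_gt0.
have h3 : 0 < b * h by rewrite mulr_gt0// (lt_le_trans _ b1).
have h4 := ea; have h5 := eb; apply/andP; split; lra.
Qed.
Let e0 : 0 < e. Proof. by apply: lt_le_trans ea; rewrite mulr_gt0. Qed.
Let b0 : 0 <= b. Proof. exact: le_trans b1. Qed.
Let psi (c c' : option 'I_d) z := kernel eta e z * scaled_coord b h c z * scaled_coord b h c' z.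

Let mpsi c c' : measurable_fun setT (psi c c' : _ -> measurableTypeR R).
Proof. exact: (measurable_statistic eta_adm (Some (c, c')) w0 h0 b0 e0). Qed.
Let psiM c c' z : `|psi c c' z| <= M.
Proof. exact: (statistic_bound eta_adm w h (Some (c, c')) z e0 b0). Qed.
Let psi_supp c c' z : e < enorm z -> psi c c' z = 0.
Proof. by move=> ez; rewrite /psi (kernel_supp eta_adm) ?mul0r// ltW. Qed.
Let eOm : ecball x e `<=` Om.
Proof.
move=> y /= ye; apply: xOm; apply: le_trans ye _; apply: le_trans eb _.
rewrite ler_pM2r// ler_peMl ?ler1n//.
Qed.

Let psi_dev c c' : `|n%:R^-1 * \sum_(0 <= j < n) psi c c' (Y j - x) - \int[Q]_y psi c c' (y - x)| <= 3 * t.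
Proof. exact: (dev_mean (Some (c, c')) He). Qed.

Let bvol_e : bvol d e <= b ^+ d * al * h ^+ d.
Proof.
rewrite bvol_scale// (_ : b ^+ d * al * h ^+ d = (b * h) ^+ d * al); last by rewrite exprMn; ring.
by rewrite ler_pM2r//; apply: lerXn2r; rewrite ?nnegrE ?mulr_ge0 ?(ltW e0) ?(ltW h0).
Qed.

Let psi_scaled c c' z : psi c c' z = kernel eta e z *
  (if c is Some i then z 0 i / h else 1) * (if c' is Some i then z 0 i / h else 1).
Proof.
have [ze|ze] := leP (enorm z) e; last first.
  by rewrite psi_supp// (kernel_supp eta_adm) ?mul0r// ltW.
have zb : enorm z <= 2 * b * h by apply: le_trans ze _; case/andP: He.
by rewrite /psi; congr (_ * _ * _); case: c; case: c' => // *; exact: scaled_coordE.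
Qed.

Let M_ge0 : 0 <= M. Proof. exact: le_trans (psiM None None 0). Qed.

Let moment_const_ge : M * (K1 + K2) * b ^+ d.+2 * al + 3 * tau = moment_const.
Proof. by []. Qed.

Let first_order c c' :
  `|n%:R^-1 * \sum_(0 <= j < n) psi c c' (Y j - x) - rho x * \int[mu]_(z in B e) psi c c' z|
  <= moment_const * h ^+ d.+1.
Proof.
have K z : enorm z <= e -> `|rho (x + z) - rho x| <= K1 * e.
  by move=> ze; apply: le_trans (rho1 eOm ze) _; rewrite ler_wpM2l.
have D := psi_dev c c'.
have L := law_integral_order1 oOm beta0 rho_cont rho_bounds QE (@mpsi c c') (@psiM c c') (@psi_supp c c') eOm K.
move: D L; set F := _ * \sum_(_ <= _ < _) _; set I := \int[Q]_y _; set J := rho x * _ => D L.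
have t1 : M * (K1 * e) * bvol d e <= M * (K1 + K2) * b ^+ d.+2 * al * h ^+ d.+1.
  apply: (@le_trans _ _ (M * (K1 * (b * h)) * (b ^+ d * al * h ^+ d))).
    apply: ler_pM; [|exact: bvol_ge0| |exact: bvol_e].
      by apply: mulr_ge0 => //; apply: mulr_ge0 => //; exact: ltW.
    by apply: ler_wpM2l => //; exact: ler_wpM2l.
  rewrite (_ : M * (K1 * (b * h)) * (b ^+ d * al * h ^+ d) = M * (al * h ^+ d.+1) * (K1 * b ^+ d.+1)); last by rewrite !exprS; ring.
  rewrite [leRHS](_ : _ = M * (al * h ^+ d.+1) * ((K1 + K2) * b ^+ d.+2)); last by ring.
  apply: ler_wpM2l.
    by apply: mulr_ge0 => //; apply: mulr_ge0; [exact: ltW|apply: exprn_ge0; exact: ltW].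
  apply: ler_pM => //; [exact: exprn_ge0|by rewrite lerDl|].
  by rewrite [leRHS]exprS ler_peMl// exprn_ge0.
have t2 : 3 * t <= 3 * tau * h ^+ d.+1.
  rewrite /t (_ : 3 * (tau * lam * h ^+ d.+1) = lam * (3 * tau * h ^+ d.+1)); last by ring.
  have [_ [[_ _ lam0' lam4'] _]] := scales.
  by rewrite ler_piMl ?mulr_ge0 ?exprn_ge0 ?(ltW h0) ?(ltW tau0)//; lra.
rewrite -moment_const_ge [leRHS]mulrDl.
have := ler_normD (F - I) (I - J); rewrite addrA subrK; lra.
Qed.

Let second_order c c' :
  `|n%:R^-1 * \sum_(0 <= j < n) psi c c' (Y j - x) - rho x * \int[mu]_(z in B e) psi c c' z
   - \sum_i partial i rho x * \int[mu]_(z in B e) (psi c c' z * z 0 i)|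
  <= moment_const * (lam + h) * h ^+ d.+1.
Proof.
have K z : enorm z <= e -> `|rho (x + z) - rho x - \sum_i z 0 i * partial i rho x| <= K2 * e ^+ 2.
  move=> ze; apply: le_trans (rho2 eOm ze) _; rewrite ler_wpM2l//.
  by apply: lerXn2r; rewrite ?nnegrE// ltW.
have D := psi_dev c c'.
have L := law_integral_order2 oOm beta0 rho_cont rho_bounds QE (@mpsi c c') (@psiM c c') (@psi_supp c c') eOm K.
move: D L; set F := _ * \sum_(_ <= _ < _) _; set I := \int[Q]_y _; set J := rho x * _; set G := \sum_i _ => D L.
have hd : 0 <= h ^+ d.+1 by rewrite exprn_ge0// ltW.
have t1 : M * (K2 * e ^+ 2) * bvol d e <= M * (K1 + K2) * b ^+ d.+2 * al * (lam + h) * h ^+ d.+1.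
  apply: (@le_trans _ _ (M * (K2 * (b * h) ^+ 2) * (b ^+ d * al * h ^+ d))).
    apply: ler_pM; [|exact: bvol_ge0| |exact: bvol_e].
      by apply: mulr_ge0 => //; apply: mulr_ge0 => //; exact: sqr_ge0.
    apply: ler_wpM2l => //; apply: ler_wpM2l => //; apply: lerXn2r; rewrite ?nnegrE ?mulr_ge0 ?(ltW h0) ?(ltW e0)//.
  rewrite (_ : M * (K2 * (b * h) ^+ 2) * (b ^+ d * al * h ^+ d) = M * (al * b ^+ d.+2 * h ^+ d.+1) * (K2 * h)); last by rewrite !exprS; ring.
  rewrite [leRHS](_ : _ = M * (al * b ^+ d.+2 * h ^+ d.+1) * ((K1 + K2) * (lam + h))); last by ring.
  apply: ler_wpM2l.
    by apply: mulr_ge0 => //; apply: mulr_ge0 => //; apply: mulr_ge0; [exact: ltW|exact: exprn_ge0].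
  by apply: ler_pM; rewrite ?(ltW h0)// ?lerDr// ltW.
have t2 : 3 * t <= 3 * tau * (lam + h) * h ^+ d.+1.
  rewrite /t mulrA ler_wpM2r// mulrA ler_wpM2l ?mulr_ge0 ?(ltW tau0)// lerDl ltW//.
rewrite -moment_const_ge [_ * (lam + h)]mulrDl [leRHS]mulrDl.
have := ler_normD (F - I) (I - J - G); rewrite (_ : F - I + (I - J - G) = F - J - G); last by ring.
lra.
Qed.

Let kern_sum c c' : \sum_(0 <= j < n) psi c c' (Y j - x) = \sum_(0 <= j < n) (kernel eta e (Y j - x) *
  (if c is Some i then (Y j - x) 0 i / h else 1) * (if c' is Some i then (Y j - x) 0 i / h else 1)).
Proof. by apply: eq_bigr => j _; rewrite psi_scaled. Qed.

Lemma kernel_sum_order0 :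
  `|n%:R^-1 * \sum_(0 <= j < n) kernel eta e (Y j - x) - rho x * e ^+ d| <= moment_const * h ^+ d.+1.
Proof.
have := first_order None None; rewrite kern_sum -(kernel_moment0 eta_adm e0).
rewrite (@eq_Rintegral _ _ _ _ _ (kernel eta e)); last by move=> z _; rewrite psi_scaled !mulr1.
by under eq_bigr do rewrite !mulr1.
Qed.

Let kernelM c (f : 'rV[R]_d -> R) : measurable_fun setT (f : _ -> measurableTypeR R) ->
  (forall z, enorm z <= e -> `|f z| <= e ^+ 2 + e) ->
  \int[mu]_(z in B e) (c * (kernel eta e z * f z)) = c * \int[mu]_(z in B e) (kernel eta e z * f z).
Proof.
move=> mf fM; rewrite RintegralZl//; first exact: measurable_ecball.
apply: (@ball_integrable _ _ _ (eta 0 * (e ^+ 2 + e))).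
  by apply: measurable_funM => //; exact: (measurable_kernel eta_adm e0).
move=> z; rewrite /ecball/= subr0 => ze; rewrite normrM.
by apply: ler_pM => //; [exact: (kernel_norm_le eta_adm)|exact: fM].
Qed.

Let e2 : 0 <= e ^+ 2. Proof. exact: sqr_ge0. Qed.

Let coordM i (z : 'rV[R]_d) : enorm z <= e -> `|z 0 i| <= e ^+ 2 + e.
Proof. by move=> ze; apply: le_trans (coord_le_enorm z i) _; rewrite (le_trans ze)// lerDr. Qed.

Let coord2M i j (z : 'rV[R]_d) : enorm z <= e -> `|z 0 i * z 0 j| <= e ^+ 2 + e.
Proof.
move=> ze; rewrite normrM; apply: (@le_trans _ _ (e ^+ 2)); last by rewrite lerDl ltW.
by rewrite expr2; apply: ler_pM => //; exact: le_trans (coord_le_enorm z _) ze.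
Qed.

Let mzz i j : measurable_fun setT (fun z : 'rV[R]_d => z 0 i * z 0 j : measurableTypeR R).
Proof. by apply: (@measurable_funM _ _ R); exact: measurable_coord. Qed.

(** The first moment of the kernel vanishes by symmetry, so the gradient of [rho] gives the leading
    term and the expansion of [rho] to second order is required. The statistic carries a factor
    [h^-1]; removing it gains one power of [h]. *)
Lemma kernel_sum_order1 i :
  `|n%:R^-1 * \sum_(0 <= j < n) kernel eta e (Y j - x) * (Y j - x) 0 i
    - partial i rho x * (e ^+ d.+2 * sigma_eta i0 eta)| <= moment_const * (lam + h) * h ^+ d.+2.
Proof.
have mz j : measurable_fun setT (fun z : 'rV[R]_d => z 0 j : measurableTypeR R) by exact: measurable_coord.
have := second_order (Some i) None; rewrite kern_sum.
have -> : \int[mu]_(z in B e) psi (Some i) None z = 0.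
  transitivity (\int[mu]_(z in B e) (h^-1 * (kernel eta e z * z 0 i))).
    by apply: eq_Rintegral => z _; rewrite psi_scaled; ring.
  by rewrite kernelM//; [rewrite (kernel_moment1 eta_adm)// mulr0|exact: coordM].
have kE j : \int[mu]_(z in B e) (psi (Some i) None z * z 0 j) =
    h^-1 * ((i == j)%:R * (e ^+ d.+2 * sigma_eta i0 eta)).
  transitivity (\int[mu]_(z in B e) (h^-1 * (kernel eta e z * (z 0 i * z 0 j)))).
    by apply: eq_Rintegral => z _; rewrite psi_scaled; ring.
  rewrite kernelM; [by rewrite (kernel_moment2 eta_adm i j i0)|exact: mzz|exact: coord2M].
rewrite mulr0 subr0 [\sum_(l < d) _](bigD1 i)//= [\sum_(l < d | _) _]big1 ?addr0 => [|j ji]; last first.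
  by rewrite kE eq_sym (negbTE ji) mul0r !mulr0.
rewrite kE eqxx mul1r => H.
rewrite [h ^+ d.+2]exprS [leRHS]mulrCA -ler_pdivrMl//.
apply: le_trans H; rewrite -[h^-1 in leLHS]ger0_norm ?invr_ge0 ?(ltW h0)// -normrM.
rewrite mulrBr mulrCA (mulrCA h^-1 (partial _ _ _)) mulr_sumr.
rewrite le_eqVlt; apply/orP; left; apply/eqP; congr (`| _ * _ - _|); apply: eq_bigr => j _; ring.
Qed.

Lemma kernel_sum_order2 i j :
  `|n%:R^-1 * \sum_(0 <= l < n) kernel eta e (Y l - x) * ((Y l - x) 0 i * (Y l - x) 0 j)
    - rho x * ((i == j)%:R * (e ^+ d.+2 * sigma_eta i0 eta))| <= moment_const * h ^+ d.+3.
Proof.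
have mz l : measurable_fun setT (fun z : 'rV[R]_d => z 0 l : measurableTypeR R) by exact: measurable_coord.
have := first_order (Some i) (Some j); rewrite kern_sum.
have -> : \int[mu]_(z in B e) psi (Some i) (Some j) z =
    h^-1 ^+ 2 * ((i == j)%:R * (e ^+ d.+2 * sigma_eta i0 eta)).
  transitivity (\int[mu]_(z in B e) (h^-1 ^+ 2 * (kernel eta e z * (z 0 i * z 0 j)))).
    by apply: eq_Rintegral => z _; rewrite psi_scaled; ring.
  rewrite kernelM; [by rewrite (kernel_moment2 eta_adm i j i0)|exact: mzz|exact: coord2M].
move=> H.
rewrite (_ : h ^+ d.+3 = h ^+ 2 * h ^+ d.+1); last by rewrite -exprD.
rewrite [leRHS]mulrCA -ler_pdivrMl ?exprn_gt0//.
apply: le_trans H; rewrite -[_^-1 in leLHS]ger0_norm ?invr_ge0 ?sqr_ge0// -normrM.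
rewrite mulrBr mulrCA (mulrCA _^-1 (rho x)) mulr_sumr exprVn.
rewrite le_eqVlt; apply/orP; left; apply/eqP; congr (`| _ * _ - _|); apply: eq_bigr => l _.
by field; rewrite gt_eqF.
Qed.

End kernel_moments.
End moments.

(** * Maximum and minimum of the weighted increments *)

Section extremal_values.
Context {R : realType} {d : nat}.
Variable eta : R -> R.
Hypothesis eta_adm : @admissible_kernel R d eta.
Implicit Types (x y z nu : 'rV[R]_d) (A : 'I_d -> 'I_d -> R).

(** The same form has two bounds because they enter differently: the upper estimate is quadratic in
    [Nb], later a C^2 norm, and the lower one linear in [Nb'], later a C^3 norm. *)
Lemma sup_kernel_close (S : seq 'rV[R]_d) (r0 theta L C Nb Nb' G e dl D : R) A nu x (v : 'rV[R]_d -> R) :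
  (forall s t, 0 <= s -> 0 <= t -> `|eta s - eta t| <= L * `|s - t|) -> 0 <= L ->
  0 < r0 < 1 -> 0 < theta -> kernel_peak eta r0 theta -> 0 <= C ->
  (forall r, 0 <= r <= 2 -> r0 * eta r0 - C * (r - r0) ^+ 2 <= r * eta r) ->
  0 < G -> 0 <= Nb -> 0 <= Nb' -> 0 < e -> 0 < dl -> dl <= r0 * e / 2 -> enorm nu = 1 -> 0 <= D ->
  (forall z z', `|bilin A z z'| <= Nb * (enorm z * enorm z')) ->
  (forall z z', `|bilin A z z'| <= Nb' * (enorm z * enorm z')) ->
  (forall y, y \in S -> enorm (y - x) <= e ->
    `|v y - v x - (G * dotr nu (y - x) + 2^-1 * bilin A (y - x) (y - x))| <= D) ->
  (exists2 y, y \in S & enorm (y - x - (r0 * e) *: nu) <= dl) ->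
  `|sup [set kernel eta e (y - x) * (v y - v x) | y in [set` S]] -
    eta r0 * (r0 * e * G + 2^-1 * (r0 * e) ^+ 2 * bilin A nu nu)| <=
  (eta 0 ^+ 2 / r0 + (L + 2 * eta 0) ^+ 2) * (Nb ^+ 2 * e ^+ 3 / (G * theta)) +
  G * (C + eta 0 / r0) * (dl ^+ 2 / e) + Nb' * (2 * eta 0 + L) * (dl * e) + eta 0 * D.
Proof.
move=> HL L0 r01 th0 pk C0 HC G0 Nb0 Nb0' e0 dl0 dle nu1 D0 HA HA' HT [y0 y0S y0d].
have E0 : 0 <= eta 0 by exact: (eta_ge0 eta_adm).
have /andP[r00 _] := r01.
pose f y := kernel eta e (y - x) * (v y - v x).
pose q y := kernel eta e (y - x) * (G * dotr nu (y - x) + 2^-1 * bilin A (y - x) (y - x)).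
have fq y : y \in S -> `|f y - q y| <= eta 0 * D.
  move=> yS; rewrite /f /q -mulrBr; have [ze|ze] := leP (enorm (y - x)) e.
    rewrite normrM; apply: ler_pM => //; first exact: (kernel_norm_le eta_adm).
    exact: HT.
  by rewrite (kernel_supp eta_adm) ?(ltW ze)// mul0r normr0 mulr_ge0.
set V := eta r0 * _; set E1 := _ * (Nb ^+ 2 * _ / _); set E2 := _ * (dl ^+ 2 / e); set E3 := _ * (dl * e).
have E10 : 0 <= E1.
  rewrite /E1 mulr_ge0//.
    by rewrite addr_ge0 ?sqr_ge0// divr_ge0 ?sqr_ge0// ltW.
  rewrite divr_ge0//; last by rewrite ltW// mulr_gt0.
  by rewrite mulr_ge0 ?sqr_ge0// exprn_ge0// ltW.
have E20 : 0 <= E2.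
  rewrite /E2 mulr_ge0//; last by rewrite divr_ge0 ?sqr_ge0// ltW.
  by rewrite mulr_ge0 ?(ltW G0)// addr_ge0// divr_ge0// ltW.
have E30 : 0 <= E3.
  by rewrite /E3 mulr_ge0 ?(ltW (mulr_gt0 dl0 e0))// mulr_ge0// addr_ge0// mulr_ge0.
have q_le z : kernel eta e z * (G * dotr nu z + 2^-1 * bilin A z z) <= V + E1.
  have up := peak_upper eta_adm HL L0 r01 th0 pk G0 Nb0 e0 nu1 HA.
  have [ze|ze] := leP (enorm z) e; first exact: up.
  rewrite (kernel_supp eta_adm) ?(ltW ze)// mul0r.
  (* Outside the support the left-hand side is 0, as it is at the origin, where the bound is already
     known. *)
  have := up 0; rewrite enorm0 => /(_ (ltW e0)); apply: le_trans.
  rewrite (_ : G * dotr nu 0 + 2^-1 * bilin A 0 0 = 0) ?mulr0//.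
  rewrite /dotr /bilin !big1 ?mulr0 ?addr0// => i _; by rewrite mxE ?mul0r ?mulr0.
have ub y : y \in S -> f y <= V + E1 + eta 0 * D.
  by move=> yS; have := fq y yS; rewrite ler_norml => /andP[_]; have := q_le (y - x); rewrite -/(q y); lra.
have lb : V - E2 - E3 - eta 0 * D <= f y0.
  have := peak_lower eta_adm HL L0 r01 C0 HC G0 Nb0' e0 dl0 dle nu1 HA' y0d.
  rewrite -/(q y0) -/V -/E2 -/E3.
  by have := fq y0 y0S; rewrite ler_norml => /andP[+ _]; lra.
have hs : has_sup [set f y | y in [set` S]].
  split; first by exists (f y0), y0.
  by exists (V + E1 + eta 0 * D) => _ [y /= yS <-]; exact: ub.
have s1 : sup [set f y | y in [set` S]] <= V + E1 + eta 0 * D.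
  by apply: ge_sup; [case: hs|move=> _ [y /= yS <-]; exact: ub].
have s2 : V - E2 - E3 - eta 0 * D <= sup [set f y | y in [set` S]].
  by apply: le_trans lb _; apply: ub_le_sup; [case: hs|exists y0].
rewrite -/(f _) ler_norml; apply/andP; split; lra.
Qed.

Lemma inf_kernel_opp (S : seq 'rV[R]_d) e x (v : 'rV[R]_d -> R) :
  inf [set kernel eta e (y - x) * (v y - v x) | y in [set` S]] =
  - sup [set kernel eta e (y - x) * (- v y - - v x) | y in [set` S]].
Proof.
rewrite /inf image_comp; congr (- sup _); apply: eq_imagel => y _ /=.
by rewrite -mulrN; congr (_ * _); ring.
Qed.

(* Applied to [u] and to [- u], the first-order terms of the maximum and of the
   minimum cancel. *)
Lemma inf_sup_kernel_close (S : seq 'rV[R]_d) (r0 theta L C Nb Nb' e dl D : R) A (g : 'I_d -> R) x (u : 'rV[R]_d -> R) :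
  (forall s t, 0 <= s -> 0 <= t -> `|eta s - eta t| <= L * `|s - t|) -> 0 <= L ->
  0 < r0 < 1 -> 0 < theta -> kernel_peak eta r0 theta -> 0 <= C ->
  (forall r, 0 <= r <= 2 -> r0 * eta r0 - C * (r - r0) ^+ 2 <= r * eta r) ->
  0 < enorm (\row_i g i) -> 0 <= Nb -> 0 <= Nb' -> 0 < e -> 0 < dl -> dl <= r0 * e / 2 -> 0 <= D ->
  (forall z z', `|bilin A z z'| <= Nb * (enorm z * enorm z')) ->
  (forall z z', `|bilin A z z'| <= Nb' * (enorm z * enorm z')) ->
  (forall y, y \in S -> enorm (y - x) <= e ->
    `|u y - u x - \sum_i (y - x) 0 i * g i - 2^-1 * bilin A (y - x) (y - x)| <= D) ->
  (forall nu, enorm nu = 1 -> exists2 y, y \in S & enorm (y - x - (r0 * e) *: nu) <= dl) ->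
  `|inf [set kernel eta e (y - x) * (u y - u x) | y in [set` S]] +
    sup [set kernel eta e (y - x) * (u y - u x) | y in [set` S]] -
    eta r0 * r0 ^+ 2 * e ^+ 2 * ((enorm (\row_i g i) ^+ 2)^-1 * bilin A (\row_i g i) (\row_i g i))| <=
  2 * ((eta 0 ^+ 2 / r0 + (L + 2 * eta 0) ^+ 2) * (Nb ^+ 2 * e ^+ 3 / (enorm (\row_i g i) * theta)) +
  enorm (\row_i g i) * (C + eta 0 / r0) * (dl ^+ 2 / e) + Nb' * (2 * eta 0 + L) * (dl * e) + eta 0 * D).
Proof.
set gv := \row_i g i; set G := enorm gv.
move=> HL L0 r01 th0 pk C0 HC G0 Nb0 Nb0' e0 dl0 dle D0 HA HA' HT Hnu.
pose nu : 'rV[R]_d := G^-1 *: gv.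
have nu1 : enorm nu = 1 by rewrite /nu enormZ gtr0_norm ?invr_gt0// mulVf// gt_eqF.
have gE z : \sum_i z 0 i * g i = G * dotr nu z.
  rewrite /nu dotrZl mulVKf ?gt_eqF// dotrC /dotr; apply: eq_bigr => i _; by rewrite mxE.
have AE : bilin A nu nu = (G ^+ 2)^-1 * bilin A gv gv.
  by rewrite /nu bilinZl bilinZr; field; rewrite gt_eqF.
clearbody nu.
pose A' i j := - A i j.
have A'E z z' : bilin A' z z' = - bilin A z z' by exact: bilinN.
have HT' y : y \in S -> enorm (y - x) <= e ->
    `|u y - u x - (G * dotr nu (y - x) + 2^-1 * bilin A (y - x) (y - x))| <= D.
  by move=> yS ye; have := HT y yS ye; rewrite gE opprD addrA.
have s1 := @sup_kernel_close S r0 theta L C Nb Nb' G e dl D A nu x u HL L0 r01 th0 pk C0 HC G0 Nb0 Nb0' e0 dl0 dle nu1 D0 HA HA' HT' (Hnu _ nu1).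
rewrite inf_kernel_opp -AE.
(* For [- u] the direction is [- nu] and the form is the opposite of [A]: the first-order value
   [r0 * e * G] is unchanged, and only the second-order one changes sign. *)
have s2 : `|sup [set kernel eta e (y - x) * (- u y - - u x) | y in [set` S]] -
   eta r0 * (r0 * e * G - 2^-1 * (r0 * e) ^+ 2 * bilin A nu nu)| <=
  (eta 0 ^+ 2 / r0 + (L + 2 * eta 0) ^+ 2) * (Nb ^+ 2 * e ^+ 3 / (G * theta)) +
  G * (C + eta 0 / r0) * (dl ^+ 2 / e) + Nb' * (2 * eta 0 + L) * (dl * e) + eta 0 * D.
  have nuN : bilin A' (- nu) (- nu) = - bilin A nu nu by rewrite A'E -(scaleN1r nu) bilinZl bilinZr; ring.
  have nu1' : enorm (- nu) = 1 by rewrite enormN.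
  have := @sup_kernel_close S r0 theta L C Nb Nb' G e dl D A' (- nu) x (fun y => - u y) HL L0 r01 th0 pk C0 HC G0 Nb0 Nb0' e0 dl0 dle nu1' D0.
  rewrite nuN (_ : r0 * e * G - _ = r0 * e * G + 2^-1 * (r0 * e) ^+ 2 * - bilin A nu nu); last by ring.
  apply.
  - by move=> z z'; rewrite A'E normrN.
  - by move=> z z'; rewrite A'E normrN.
  - move=> y yS ye; have := HT y yS ye; rewrite gE A'E -normrN; congr (_ <= _); congr (`| _ |).
    by rewrite -(scaleN1r nu) dotrZl; ring.
  - exact: Hnu.
move: s1 s2; set a1 := sup _; set a2 := sup _; set E := (_ + eta 0 * D); clearbody a1 a2 E => s1 s2.
rewrite (_ : - a2 + a1 - _ = (a1 - eta r0 * (r0 * e * G + 2^-1 * (r0 * e) ^+ 2 * bilin A nu nu))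
  - (a2 - eta r0 * (r0 * e * G - 2^-1 * (r0 * e) ^+ 2 * bilin A nu nu))); last by field.
by apply: le_trans (ler_normB _ _) _; rewrite mulr_natl mulr2n lerD.
Qed.

End extremal_values.

(** * From moments to the random-walk operator *)

Section weighted_sums.
Context {R : realType} {d : nat}.

(** Here [g] and [A] stand for the gradient and Hessian of [u], [r] and [rx] for the gradient and
    value of [rho], and [tau] for the common second moment of the kernel. *)
Lemma weighted_taylor_close (n : nat) (k v : nat -> R) (z : nat -> 'rV[R]_d) (g r : 'I_d -> R)
    (A : 'I_d -> 'I_d -> R) (rx tau D d1 d2 N : R) :
  (forall l, 0 <= k l) ->
  (forall l, (l < n)%N -> k l * `|v l - \sum_i z l 0 i * g i - 2^-1 * bilin A (z l) (z l)| <= k l * D) ->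
  (forall i, `|n%:R^-1 * \sum_(0 <= l < n) k l * z l 0 i - r i * tau| <= d1) ->
  (forall i j, `|n%:R^-1 * \sum_(0 <= l < n) k l * (z l 0 i * z l 0 j) - rx * ((i == j)%:R * tau)| <= d2) ->
  (forall i, `|g i| <= N) -> (forall i j, `|A i j| <= N) ->
  `|n%:R^-1 * \sum_(0 <= l < n) k l * v l - tau * (\sum_i g i * r i + 2^-1 * rx * \sum_i A i i)| <=
  d%:R * (N * d1) + d%:R * (d%:R * (N * d2)) + n%:R^-1 * \sum_(0 <= l < n) k l * D.
Proof.
move=> k0 HD H1 H2 gN AN.
pose rem l := v l - \sum_i z l 0 i * g i - 2^-1 * bilin A (z l) (z l).
have E1 : n%:R^-1 * \sum_(0 <= l < n) k l * \sum_i z l 0 i * g i =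
    \sum_i g i * (n%:R^-1 * \sum_(0 <= l < n) k l * z l 0 i).
  under [in LHS]eq_bigr do rewrite mulr_sumr.
  rewrite exchange_big/= mulr_sumr; apply: eq_bigr => i _.
  rewrite mulrCA; congr (_ * _); rewrite mulr_sumr; apply: eq_bigr => l _; ring.
have E2 : n%:R^-1 * \sum_(0 <= l < n) k l * (2^-1 * bilin A (z l) (z l)) =
    2^-1 * \sum_i \sum_j A i j * (n%:R^-1 * \sum_(0 <= l < n) k l * (z l 0 i * z l 0 j)).
  transitivity (\sum_(0 <= l < n) \sum_i \sum_j (2^-1 * n%:R^-1 * (A i j * (k l * (z l 0 i * z l 0 j))))).
    rewrite mulr_sumr; apply: eq_bigr => l _; rewrite /bilin.
    rewrite (mulrCA (k l)) !mulr_sumr; apply: eq_bigr => i _.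
    rewrite !mulr_sumr; apply: eq_bigr => j _; ring.
  rewrite exchange_big/= mulr_sumr; apply: eq_bigr => i _.
  rewrite exchange_big/= mulr_sumr; apply: eq_bigr => j _.
  rewrite -mulr_sumr -mulrA; congr (_ * _); rewrite mulrCA; congr (_ * _).
  by rewrite -mulr_sumr.
have E3 : n%:R^-1 * \sum_(0 <= l < n) k l * v l =
    \sum_i g i * (n%:R^-1 * \sum_(0 <= l < n) k l * z l 0 i) +
    2^-1 * \sum_i \sum_j A i j * (n%:R^-1 * \sum_(0 <= l < n) k l * (z l 0 i * z l 0 j)) +
    n%:R^-1 * \sum_(0 <= l < n) k l * rem l.
  rewrite -E1 -E2 -!mulrDr -!big_split/=; congr (_ * _); apply: eq_bigr => l _.
  rewrite /rem; ring.
have E4 : tau * (\sum_i g i * r i + 2^-1 * rx * \sum_i A i i) =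
    \sum_i g i * (r i * tau) + 2^-1 * \sum_i \sum_j A i j * (rx * ((i == j)%:R * tau)).
  rewrite mulrDr mulr_sumr; congr (_ + _); first by apply: eq_bigr => i _; ring.
  rewrite !mulr_sumr; apply: eq_bigr => i _.
  rewrite (bigD1 i)//= big1 ?addr0 ?eqxx ?mul1r; first by field.
  by move=> j ji; rewrite eq_sym (negbTE ji) mul0r !mulr0.
rewrite E3 E4.
have T1 : `|\sum_i g i * (n%:R^-1 * \sum_(0 <= l < n) k l * z l 0 i) - \sum_i g i * (r i * tau)| <= d%:R * (N * d1).
  rewrite -sumrB; apply: le_trans (ler_norm_sum _ _ _) _.
  rewrite -[X in X%:R * _]card_ord -sum1_card natr_sum mulr_suml; apply: ler_sum => i _.
  by rewrite mul1r -mulrBr normrM; apply: ler_pM.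
have T2 : `|\sum_i \sum_j A i j * (n%:R^-1 * \sum_(0 <= l < n) k l * (z l 0 i * z l 0 j))
    - \sum_i \sum_j A i j * (rx * ((i == j)%:R * tau))| <= d%:R * (d%:R * (N * d2)).
  rewrite -sumrB; apply: le_trans (ler_norm_sum _ _ _) _.
  rewrite -[X in X%:R * _]card_ord -sum1_card natr_sum mulr_suml; apply: ler_sum => i _.
  rewrite mul1r -sumrB; apply: le_trans (ler_norm_sum _ _ _) _.
  rewrite -[X in X%:R * _]card_ord -sum1_card natr_sum mulr_suml; apply: ler_sum => j _.
  by rewrite mul1r -mulrBr normrM; apply: ler_pM.
have T3 : `|n%:R^-1 * \sum_(0 <= l < n) k l * rem l| <= n%:R^-1 * \sum_(0 <= l < n) k l * D.
  rewrite normrM ger0_norm ?invr_ge0// ler_wpM2l ?invr_ge0//.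
  apply: le_trans (ler_norm_sum _ _ _) _.
  rewrite !big_nat; apply: ler_sum => l /andP[_ ln].
  by rewrite normrM (ger0_norm (k0 l)); exact: HD.
move: T1 T2 T3; set a1 := \sum_i _; set a1' := \sum_i _; set a2 := \sum_i _; set a2' := \sum_i _.
set a3 := _ * \sum_(_ <= _ < _) _; set b1 := d%:R * _; set b2 := d%:R * _; set b3 := _ * \sum_(_ <= _ < _) _.
clearbody a1 a1' a2 a2' a3 b1 b2 b3; rewrite !ler_norml => /andP[? ?] /andP[? ?] /andP[? ?].
by apply/andP; split; lra.
Qed.

(** An exact decomposition replaces in turn the degree [s0], the scaling [kap * e ^+ 2] and the
    increment sum [s] by their limits; the factor [ed] cancels in the quotient. *)
Lemma quotient_close (s0 s rx ed e sig U kap Rx d0 d1 d2 : R) :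
  0 < s0 -> 0 < rx -> 0 < sig -> 0 <= kap ->
  `|s0 - rx * ed| <= d0 -> `|s - ed * e ^+ 2 * sig * U| <= d1 -> `|kap * e ^+ 2 - Rx| <= d2 ->
  `|2 / (sig * s0) * kap * s - Rx * (2 * U / rx)| <=
  kap * e ^+ 2 * `|2 * U / rx| * d0 / s0 + d2 * `|2 * U / rx| + 2 * kap * d1 / (sig * s0).
Proof.
move=> s00 rx0 sig0 kap0 H0 H1 H2.
rewrite (_ : _ - _ = kap * e ^+ 2 * (2 * U / rx) * (rx * ed - s0) / s0 +
   (kap * e ^+ 2 - Rx) * (2 * U / rx) + 2 * kap * (s - ed * e ^+ 2 * sig * U) / (sig * s0)); last first.
  by field; rewrite !gt_eqF.
have c0 : 0 <= kap * e ^+ 2 by apply: mulr_ge0 => //; exact: sqr_ge0.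
move: (2 * U / rx) (kap * e ^+ 2) H2 c0 => T c H2 c0.
apply: le_trans (ler_normD _ _) _; apply: lerD.
  apply: le_trans (ler_normD _ _) _; apply: lerD; last by rewrite normrM; apply: ler_wpM2r.
  rewrite !normrM (gtr0_norm (x := s0^-1)) ?invr_gt0// ler_pM2r ?invr_gt0//.
  by rewrite (ger0_norm c0) distrC; apply: ler_wpM2l => //; exact: mulr_ge0.
rewrite normrM (gtr0_norm (x := (sig * s0)^-1)) ?invr_gt0 ?mulr_gt0// ler_pM2r ?invr_gt0 ?mulr_gt0//.
by rewrite normrM ger0_norm ?mulr_ge0//; apply: ler_wpM2l; rewrite ?mulr_ge0.
Qed.

End weighted_sums.

Section scaling.
Context {R : realType}.

(** The cofactor of [v - 1] in [v ^+ m - 1] is a sum of nonnegative powers that contains 1. *)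
Lemma root_close (m : nat) (v delta : R) : (0 < m)%N -> 0 <= v -> `|v ^+ m - 1| <= delta -> `|v - 1| <= delta.
Proof.
case: m => // m _ v0; apply: le_trans.
rewrite subrX1 normrM ler_peMr// ger0_norm; last by apply: sumr_ge0 => i _; exact: exprn_ge0.
by rewrite big_ord_recl/= expr0 lerDl; apply: sumr_ge0 => i _; exact: exprn_ge0.
Qed.

Lemma powR_root (m : nat) (y r : R) : (0 < m)%N -> 0 <= y -> (y ^+ m) `^ (r / m%:R) = y `^ r.
Proof.
move=> m0 y0; rewrite -powR_mulrn// -powRrM mulrC divfK// pnatr_eq0 -lt0n//.
Qed.

(** With the relative radius [v = c * e / h], where [c ^+ d = rx * ball_volume R d], the scaled
    square is exactly the limit times [v ^+ 2], and [v] is close to 1 by [root_close]. *)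
Lemma knn_scaling_close (d n k : nat) (rx h e delta : R) :
  (0 < d)%N -> (0 < n)%N -> (0 < k)%N -> 0 < h -> h ^+ d = k%:R / n%:R -> 0 < rx -> 0 < e ->
  `|rx * ball_volume R d * e ^+ d - h ^+ d| <= delta * h ^+ d ->
  `|@knn_scaling R d n k * e ^+ 2 - rx `^ (- (2 / d%:R))| <= rx `^ (- (2 / d%:R)) * ((2 + delta) * delta).
Proof.
move=> d0 n0 k0 h0 hk rx0 e0 H; set al := ball_volume R d.
have al0 : 0 < al by apply: ball_volume_gt0.
have hd0 : 0 < h ^+ d by rewrite exprn_gt0.
have dR : d%:R != 0 :> R by rewrite pnatr_eq0 -lt0n.
pose c := (rx * al) `^ d%:R^-1.
have c0 : 0 <= c by exact: powR_ge0.
have cd : c ^+ d = rx * al.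
  by rewrite -powR_mulrn// /c -powRrM mulVf// powRr1// mulr_ge0// ltW.
pose v := c * e / h.
have v0 : 0 <= v by rewrite /v divr_ge0 ?(ltW h0)// mulr_ge0// ltW.
have vd : `|v - 1| <= delta.
  apply: (root_close d0 v0); rewrite /v expr_div_n exprMn cd.
  rewrite (_ : _ - 1 = (rx * al * e ^+ d - h ^+ d) / h ^+ d); last by field; rewrite gt_eqF.
  by rewrite normrM [X in _ * X]gtr0_norm ?invr_gt0// ler_pdivrMr.
have kE : @knn_scaling R d n k = rx `^ (- (2 / d%:R)) * (c / h) ^+ 2.
  rewrite /knn_scaling -/al.
  have -> : n%:R * al / k%:R = rx^-1 * (c / h) ^+ d.
    rewrite expr_div_n cd hk; field.
    by rewrite !gt_eqF// ltr0n.
  rewrite powRM ?invr_ge0 ?(ltW rx0)//; last by rewrite exprn_ge0// divr_ge0// ltW.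
  rewrite powR_root//; last by rewrite divr_ge0// ltW.
  by rewrite -(powR_inv1 (ltW rx0)) -powRrM mulN1r powR_mulrn// divr_ge0// ltW.
rewrite kE (_ : _ - _ = rx `^ (- (2 / d%:R)) * ((v - 1) * (v + 1))); last by rewrite /v; field; rewrite gt_eqF.
rewrite normrM ger0_norm ?powR_ge0// ler_wpM2l ?powR_ge0//.
rewrite normrM mulrC; have dl0 : 0 <= delta by apply: le_trans vd.
apply: ler_pM => //.
by rewrite ger0_norm ?addr_ge0//; move: vd; rewrite ler_norml => /andP[? ?]; lra.
Qed.

End scaling.

Lemma derive_sqrM {R : realType} {V : normedModType R} (f g : V -> R) (x v : V) :
  derivable f x v -> derivable g x v ->
  'D_v (fun y => f y ^+ 2 * g y) x = f x ^+ 2 * 'D_v g x + 2 * f x * g x * 'D_v f x.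
Proof.
move=> df dg; have dff : derivable (f * f) x v := derivableM df df.
have -> : (fun y => f y ^+ 2 * g y) = (f * f) * g by apply/funext => y; rewrite expr2.
transitivity ((f x * f x) * 'D_v g x + g x * (f x * 'D_v f x + f x * 'D_v f x)); last by ring.
by rewrite (deriveM dff dg) (deriveM df df).
Qed.

(** * Expansions of density and test function, and the continuum operators *)

Section taylor_in_balls.
Context {R : realType} {d : nat}.
Variable Om : set 'rV[R]_d.
Hypothesis oOm : open Om.
Implicit Types (x z : 'rV[R]_d) (u rho : 'rV[R]_d -> R).

Lemma segment_in_ball x z (r t : R) : enorm z <= r -> 0 <= t <= 1 ->
  ecball x r (x + t *: z).
Proof.
move=> zr /andP[t0 t1]; rewrite /ecball/= addrC addKr enormZ ger0_norm//.
by apply: le_trans zr; rewrite ler_piMl.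
Qed.

Lemma density_taylor rho : bounded_set Om -> is_Ck_closure 2 Om rho ->
  exists2 K : R, 0 <= K &
   [/\ forall x z r, ecball x r `<=` Om -> enorm z <= r -> `|rho (x + z) - rho x| <= K * enorm z,
       forall x z r, ecball x r `<=` Om -> enorm z <= r ->
         `|rho (x + z) - rho x - \sum_i z 0 i * partial i rho x| <= K * enorm z ^+ 2 &
       forall x i, Om x -> `|partial i rho x| <= K].
Proof.
move=> bOm rhoC; have [rk _ _] := rhoC.
have [M HM] : exists M, forall s x, (size s <= 2)%N -> Om x -> `|partials s rho x| <= M.
  have H (s : seq 'I_d) : exists M, (size s <= 2)%N -> forall x, Om x -> `|partials s rho x| <= M.
    have [ss|] := boolP (size s <= 2)%N; last by move=> _; exists 0.
    by have [M HM] := partials_bounded bOm rhoC ss; exists M.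
  have [f Hf] := choice H.
  (* One bound for all derivatives of order at most two: the sum of the individual bounds over the
     finitely many words. *)
  exists (\sum_(m < 3) \sum_(s : m.-tuple 'I_d) `|f s|) => s x ss Ox.
  apply: le_trans (Hf s ss x Ox) _; apply: le_trans (ler_norm _) _.
  have sE : s = tval (in_tuple s) by [].
  rewrite (bigD1 (Ordinal (n := 3) (m := size s) ss))//= (bigD1 (in_tuple s))//=.
  by rewrite -addrA lerDl addr_ge0// ?sumr_ge0// => i _; apply: sumr_ge0.
have [[x0 Ox0]|noOm] := pselect (exists x, Om x); last first.
  exists 0 => //; split=> [x z r xO zr|x z r xO zr|x i Ox].
  - exfalso; apply: noOm; exists x; apply: xO; rewrite /ecball/= subrr enorm0; exact: le_trans zr.
  - exfalso; apply: noOm; exists x; apply: xO; rewrite /ecball/= subrr enorm0; exact: le_trans zr.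
  - by exfalso; apply: noOm; exists x.
have M0 : 0 <= M by apply: le_trans (HM [::] x0 _ Ox0).
exists (d%:R * M + d%:R * (d%:R * M) + M); first by rewrite !addr_ge0// !mulr_ge0.
split=> [x z r xO zr|x z r xO zr|x i Ox].
- have seg t : 0 <= t <= 1 -> Om (x + t *: z) by move=> t01; apply: xO; exact: (segment_in_ball x zr t01).
  apply: (@le_trans _ _ (d%:R * (enorm z * M))).
    have rk1 : is_Ck 1 Om rho by apply: (is_Ck_le rk).
    apply: (taylor1_le oOm seg rk1).
    by move=> i y [t t01 ->]; apply: HM => //; exact: seg.
  rewrite mulrCA mulrC ler_wpM2r//; have := mulr_ge0 (ler0n R d) (mulr_ge0 (ler0n R d) M0); lra.
- have seg t : 0 <= t <= 1 -> Om (x + t *: z) by move=> t01; apply: xO; exact: (segment_in_ball x zr t01).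
  apply: (@le_trans _ _ (d%:R * (enorm z * (d%:R * (enorm z * M))))).
    apply: (taylor2_le oOm seg) => //.
    by move=> i j y [t t01 ->]; apply: HM => //; exact: seg.
  rewrite [leLHS](_ : _ = d%:R * (d%:R * M) * enorm z ^+ 2); last by ring.
  by rewrite ler_wpM2r ?sqr_ge0//; have := mulr_ge0 (ler0n R d) M0; lra.
- apply: le_trans (HM [:: i] x _ Ox) _ => //.
  by rewrite lerDr addr_ge0// !mulr_ge0.
Qed.

Lemma taylor_Ck_norm u x (r : R) z : bounded_set Om -> is_Ck_closure 3 Om u ->
  ecball x r `<=` Om -> enorm z <= r ->
  `|u (x + z) - u x - \sum_i z 0 i * partial i u x -
    2^-1 * bilin (fun i j => partials [:: j; i] u x) z z| <=
  d%:R ^+ 3 * enorm z ^+ 3 * Ck_norm 3 (ecball x r) u.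
Proof.
move=> bOm uC xO zr; have [uk _ _] := uC.
rewrite [leRHS](_ : _ = d%:R * (enorm z * (d%:R * (enorm z * (d%:R * (enorm z * Ck_norm 3 (ecball x r) u)))))); last by ring.
apply: (taylor3_le oOm) => //.
- by move=> t t01; apply: xO; exact: (segment_in_ball x zr t01).
- move=> i j l y [t t01 ->]; apply: (partials_le_Ck_norm oOm bOm uC) => //.
  exact: (segment_in_ball x zr t01).
Qed.

(** This puts the diffusion part of the limit operator in the form in which the kernel moments
    deliver it. *)
Lemma weighted_divergence rho u x : is_Ck 2 Om rho -> is_Ck 3 Om u -> Om x -> 0 < rho x ->
  (rho x ^+ 2)^-1 * \sum_i partial i (fun y => rho y ^+ 2 * partial i u y) x =
  2 * (\sum_i partial i u x * partial i rho x + 2^-1 * rho x * \sum_i partials [:: i; i] u x) / rho x.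
Proof.
move=> rk uk Ox r0.
have E i : partial i (fun y => rho y ^+ 2 * partial i u y) x =
    rho x ^+ 2 * partials [:: i; i] u x + 2 * rho x * (partial i u x * partial i rho x).
  have dr : derivable rho x (delta_mx 0 i) by have := (rk [::]).1 isT i x Ox.
  have du : derivable (partial i u) x (delta_mx 0 i) by have := (uk [:: i]).1 isT i x Ox.
  have -> : partials [:: i; i] u x = 'D_(delta_mx 0 i) (partial i u) x by [].
  have -> : partial i rho x = 'D_(delta_mx 0 i) rho x by [].
  by rewrite [LHS](derive_sqrM dr du); ring.
under eq_bigr do rewrite E.
rewrite big_split/= -!mulr_sumr.
by field; rewrite gt_eqF.
Qed.

Lemma infty_laplacianE u x : infty_laplacian u x =
  (enorm (grad u x) ^+ 2)^-1 * bilin (fun i j => partials [:: j; i] u x) (grad u x) (grad u x).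
Proof.
rewrite /infty_laplacian; congr (_ * _); apply: eq_bigr => i _.
rewrite mulr_sumr; apply: eq_bigr => j _.
by rewrite !mxE -mulrA mulrC -mulrA.
Qed.

End taylor_in_balls.

(** * Consistency at a point *)

Section pointwise.
Context {R : realType} {d : nat}.
Variables (i0 : 'I_d) (eta : R -> R).
Hypothesis eta_adm : @admissible_kernel R d eta.
Variables (Om : set 'rV[R]_d) (rho : 'rV[R]_d -> R) (beta K : R).
Variable Q : probability 'rV[R]_d R.
Hypotheses (oOm : open Om) (bOm : bounded_set Om) (beta0 : 0 < beta).
Hypothesis rho_cont : forall x, Om x -> {for x, continuous rho}.
Hypothesis rho_bounds : forall x, Om x -> beta <= rho x <= beta^-1.
Hypothesis QE : forall A, measurable A ->
  Q A = (\int[lebesgue_rV d]_(x in A `&` Om) (rho x)%:E)%E.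
Hypothesis K_ge0 : 0 <= K.
Hypothesis rho1 : forall x z r, ecball x r `<=` Om -> enorm z <= r ->
  `|rho (x + z) - rho x| <= K * enorm z.
Hypothesis rho2 : forall x z r, ecball x r `<=` Om -> enorm z <= r ->
  `|rho (x + z) - rho x - \sum_i z 0 i * partial i rho x| <= K * enorm z ^+ 2.
Hypothesis rho_Ck : is_Ck 2 Om rho.
Hypothesis rho_partial : forall x i, Om x -> `|partial i rho x| <= K.
Local Notation al := (ball_volume R d).
Local Notation sig := (sigma_eta i0 eta).

Variables (a b om tau : R).
Hypotheses (a0 : 0 < a) (ab : a <= b / 2) (b1 : 1 <= b) (om0 : 0 < om) (oma : om <= a) (tau0 : 0 < tau).
(** [c_om] and [c_h] are the coefficients of [lam] and [h] in the relative error of [counts_close],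
    where the factor [lam <= 1] of the deviation is dropped. *)
Let c_om : R := beta^-1 * 3 ^+ d * al * om * (2 * b) ^+ d.-1.
Let c_h : R := K * (3 * b) ^+ d.+1 * al + 3 * tau.
Hypothesis om_small : c_om <= 2^-1.
Hypothesis a_small : beta^-1 * al * a ^+ d <= 4^-1.
Hypothesis b_large : 5%:R / 4 <= beta * al * (b / 2) ^+ d.

(** Per unit of [lam + h], [radius_const], [scaling_const], [increment_const] and [rw_const] bound
    the errors of the volume of the nearest neighbor ball, the scaling, the averaged increments and
    the whole random-walk operator. [scaling_bound] and [drift_bound] bound the limiting factors
    themselves; [lam + h <= 2] is used to linearize. *)
Definition radius_const : R := c_om + c_h + beta^-1 * al * 3 ^+ d * (2 * om * b ^+ d.-1).
Definition scaling_const : R := beta^-1 `^ (2 / d%:R) * ((2 + 2 * radius_const) * radius_const).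
Definition scaling_bound : R := beta^-1 `^ (2 / d%:R) + 2 * scaling_const.
Let Cm : R := moment_const (d := d) eta K K b tau.
Definition increment_const : R :=
  d%:R * Cm + d%:R ^+ 2 * Cm + (beta^-1 * b ^+ d + Cm) * (d%:R ^+ 3 * b ^+ 3).
Definition drift_bound : R := 2 * (d%:R * K + 2^-1 * beta^-1 * d%:R) / beta.
Definition rw_const : R :=
  scaling_bound * drift_bound * Cm / (beta * a ^+ d / 2) + scaling_const * drift_bound +
  2 * (scaling_bound / a ^+ 2) * increment_const / (sig * (beta * a ^+ d / 2)).

Variables (n k : nat) (Y : nat -> 'rV[R]_d) (x : 'rV[R]_d) (lam h : R).
Hypotheses (n0 : (0 < n)%N) (k0 : (0 < k)%N) (hk : h ^+ d = k%:R / n%:R).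
Hypotheses (lam0 : 0 < lam) (lam4 : 4 * lam <= 1) (h0 : 0 < h) (h1 : h <= 1).
Hypotheses (h_small1 : c_h * h <= 8^-1) (h_small2 : Cm * h <= beta * a ^+ d / 2).
Hypothesis xOm : ecball x (3 * b * h) `<=` Om.
Hypothesis dev : forall l e, a * h / 2 <= e <= 2 * b * h ->
  `|\sum_(0 <= j < n) statistic eta (lam * om * h) b h l e (Y j - x)
    - n%:R * \int[Q]_y statistic eta (lam * om * h) b h l e (y - x)|
  <= 3 * (n%:R * (tau * lam * h ^+ d.+1)).

Let scales : [/\ 0 < a, a <= b / 2, 1 <= b & 0 < om] /\ [/\ om <= a, 0 < tau, 0 < lam & 4 * lam <= 1] /\
  [/\ 0 < h, h <= 1, 0 <= K & 0 < beta].
Proof. by []. Qed.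
Let dpos : (0 < d)%N. Proof. by case: d i0 => [[]|]. Qed.
Let ab' : a <= b.
Proof. have [[? ? ? ?] _] := scales; lra. Qed.
Let b0 : 0 <= b. Proof. exact: le_trans b1. Qed.
Let al0 : 0 < al. Proof. by apply: ball_volume_gt0. Qed.
Let Omx : Om x.
Proof. by apply: xOm; rewrite /ecball/= subrr enorm0 mulr_ge0 ?mulr_ge0 ?(ltW h0). Qed.
Let rx_ge : beta <= rho x. Proof. by have /andP[] := rho_bounds Omx. Qed.
Let rx_le : rho x <= beta^-1. Proof. by have /andP[] := rho_bounds Omx. Qed.
Let rx0 : 0 < rho x. Proof. exact: lt_le_trans rx_ge. Qed.
Let hd0 : 0 < h ^+ d. Proof. by rewrite exprn_gt0. Qed.
Let c_om0 : 0 <= c_om.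
Proof.
apply: mulr_ge0; last by rewrite exprn_ge0// mulr_ge0.
apply: mulr_ge0; last exact: ltW.
apply: mulr_ge0; last exact: ltW.
by rewrite mulr_ge0 ?exprn_ge0// invr_ge0 ltW.
Qed.
Let c_h0 : 0 <= c_h.
Proof.
apply: addr_ge0; last by rewrite mulr_ge0// ltW.
apply: mulr_ge0; last exact: ltW.
by apply: mulr_ge0 => //; rewrite exprn_ge0// mulr_ge0.
Qed.

Let S : seq 'rV[R]_d := [seq Y i | i <- iota 0 n].
Let e : R := knn_radius k S x.

Let sumS (f : 'rV[R]_d -> R) : \sum_(y <- S) f y = \sum_(0 <= j < n) f (Y j).
Proof. by rewrite /S big_map /index_iota subn0. Qed.

Let F (r : R) : R := n%:R^-1 * \sum_(y <- S) cutoff (lam * om * h) r (y - x).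

Let F_close r : a * h / 2 <= r <= 2 * b * h ->
  `|F r - rho x * al * r ^+ d| <= (c_om * lam + c_h * h) * h ^+ d.
Proof.
move=> Hr; rewrite /F sumS.
apply: le_trans (counts_close eta_adm oOm beta0 rho_cont rho_bounds QE K_ge0 rho1 dpos n0 a0 ab' b1 om0 oma tau0 lam0 lam4 h0 h1 xOm dev Hr) _.
rewrite ler_pM2r// lerD2l ler_pM2r// lerD2l ler_piMr ?mulr_ge0 ?(ltW tau0)//.
have [_ [[_ _ ? ?] _]] := scales; lra.
Qed.

Lemma radius_bounds : a * h <= e <= b * h.
Proof.
have [[a0' ab1 b1' om0'] [[oma' tau0' lam0' lam4'] [h0' h1' K0' beta0']]] := scales.
have ah : 0 < a * h by rewrite mulr_gt0.
have abh : a * h <= b / 2 * h by rewrite ler_pM2r.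
have omh : om * h <= a * h by rewrite ler_pM2r.
have w0 : 0 < lam * om * h by rewrite !mulr_gt0.
have w4 : 4 * (lam * om * h) <= a * h.
  rewrite (_ : 4 * (lam * om * h) = 4 * lam * (om * h)); last by ring.
  by apply: le_trans omh; rewrite ler_piMl// mulr_ge0// ltW.
apply: (@knn_radius_coarse _ _ S n k x (rho x * al) (lam * om * h) a b h F) => //.
- lra.
- move=> r /andP[r1 r2]; apply: le_trans (F_close _) _.
    by apply/andP; split; lra.
  rewrite ler_pM2r//.
  (* The budget of one quarter in the coarse estimate is split evenly: one eighth for the layer, by
     [om_small] and [4 * lam <= 1], and one eighth for [c_h * h]. *)
  have t1 : c_om * lam <= 8^-1.
    apply: (@le_trans _ _ (2^-1 * 4^-1)); last by lra.
    by apply: ler_pM => //; [exact: ltW|lra].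
  have := h_small1; move: t1; set u1 := c_om * lam; set u2 := c_h * h; clearbody u1 u2; lra.
- by apply: le_trans a_small; rewrite ler_pM2r ?exprn_gt0// ler_pM2r.
- by apply: le_trans b_large _; rewrite ler_wpM2r ?exprn_ge0 ?divr_ge0// ler_pM2r.
Qed.

Let e0 : 0 < e.
Proof. by have /andP[+ _] := radius_bounds; apply: lt_le_trans; rewrite mulr_gt0. Qed.

Let radius_const0 : 0 <= radius_const.
Proof.
apply: addr_ge0; first exact: addr_ge0.
apply: mulr_ge0; last by rewrite mulr_ge0 ?exprn_ge0// mulr_ge0// ltW.
by rewrite mulr_ge0 ?exprn_ge0// mulr_ge0 ?invr_ge0 ?(ltW al0)// ltW.
Qed.

Let lamh2 : lam + h <= 2.
Proof. have [_ [[_ _ ? ?] [? ? _ _]]] := scales; lra. Qed.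

Let radius_close : `|rho x * al * e ^+ d - h ^+ d| <= radius_const * (lam + h) * h ^+ d.
Proof.
have [[a0' ab1 b1' om0'] [[oma' tau0' lam0' lam4'] [h0' h1' K0' beta0']]] := scales.
have ah : 0 < a * h by rewrite mulr_gt0.
have abh : a * h <= b * h by rewrite ler_pM2r.
have omh : om * h <= a * h by rewrite ler_pM2r.
have w0 : 0 < lam * om * h by rewrite !mulr_gt0.
have w4 : 4 * (lam * om * h) <= a * h.
  rewrite (_ : 4 * (lam * om * h) = 4 * lam * (om * h)); last by ring.
  by apply: le_trans omh; rewrite ler_piMl// mulr_ge0// ltW.
have w4b := le_trans w4 abh.
have := @knn_radius_fine _ _ S n k x (rho x * al) (lam * om * h) a b h (c_om * lam + c_h * h) F
  (fun r => erefl) n0 dpos h0 hk a0 w0 w4 w4b (ltW (mulr_gt0 rx0 al0)) F_close radius_bounds.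
move/le_trans; apply.
have hS : h ^+ d = h * h ^+ d.-1 by rewrite -exprS prednK.
have t1 : rho x * al * 3 ^+ d * (2 * (lam * om * h) * (b * h) ^+ d.-1) <=
    beta^-1 * al * 3 ^+ d * (2 * om * b ^+ d.-1) * lam * h ^+ d.
  rewrite exprMn hS [leRHS](_ : _ = beta^-1 * (al * 3 ^+ d * (2 * (lam * om * h) * (b ^+ d.-1 * h ^+ d.-1)))); last by ring.
  rewrite -2!(mulrA (rho x)) ler_wpM2r//.
  apply: mulr_ge0; first by rewrite mulr_ge0 ?exprn_ge0// ltW.
  apply: mulr_ge0; first by apply: mulr_ge0 => //; exact: ltW.
  by apply: mulr_ge0; apply: exprn_ge0 => //; exact: ltW.
apply: le_trans (lerD (lexx _) t1) _; rewrite -mulrDl ler_pM2r//.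
set c3 := _ * (2 * om * _); have c30 : 0 <= c3.
  apply: mulr_ge0; last by rewrite mulr_ge0 ?exprn_ge0// mulr_ge0// ltW.
  by rewrite mulr_ge0 ?exprn_ge0// mulr_ge0 ?invr_ge0 ?(ltW al0)// ltW.
rewrite /radius_const -/c3.
have p1 : 0 <= c_om * h by rewrite mulr_ge0// ltW.
have p2 : 0 <= c_h * lam by rewrite mulr_ge0// ltW.
have p3 : 0 <= c3 * h by rewrite mulr_ge0// ltW.
move: p1 p2 p3; lra.
Qed.

Let Rx : R := rho x `^ (- (2 / d%:R)).
Let kap : R := @knn_scaling R d n k.

Let Rx_le : Rx <= beta^-1 `^ (2 / d%:R).
Proof.
rewrite /Rx -mulN1r powRrM powR_inv1 ?(ltW rx0)//; apply: ge0_ler_powR; rewrite ?nnegrE ?invr_ge0 ?(ltW rx0) ?(ltW beta0)//.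
by rewrite lef_pV2 ?posrE.
Qed.

Let scaling_const0 : 0 <= scaling_const.
Proof. by rewrite mulr_ge0 ?powR_ge0// mulr_ge0// addr_ge0// mulr_ge0. Qed.

Lemma scaling_close : `|kap * e ^+ 2 - Rx| <= scaling_const * (lam + h).
Proof.
have lh0 : 0 <= lam + h by rewrite addr_ge0// ltW.
have := knn_scaling_close dpos n0 k0 h0 hk rx0 e0 radius_close.
move/le_trans; apply; rewrite -/Rx /scaling_const -[leRHS]mulrA; apply: ler_pM => //; first exact: powR_ge0.
  by rewrite mulr_ge0 ?mulr_ge0// addr_ge0// mulr_ge0.
rewrite -[leRHS]mulrA ler_wpM2r ?mulr_ge0//.
by rewrite lerD2l mulrC ler_wpM2r.
Qed.

Lemma scaling_le : kap * e ^+ 2 <= scaling_bound.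
Proof.
have := scaling_close; rewrite ler_norml => /andP[_ H].
have t1 : scaling_const * (lam + h) <= 2 * scaling_const by rewrite mulrC ler_wpM2r.
have t2 := Rx_le; rewrite /scaling_bound; move: H t1 t2; lra.
Qed.

Let ea : a * h <= e. Proof. by have /andP[] := radius_bounds. Qed.
Let eb : e <= b * h. Proof. by have /andP[] := radius_bounds. Qed.
Let SB0 : 0 <= scaling_bound.
Proof. by apply: addr_ge0; [exact: powR_ge0|exact: mulr_ge0]. Qed.

Let kap0 : 0 <= kap. Proof. exact: powR_ge0. Qed.

Let kap_le X : 0 <= X -> kap * X <= scaling_bound * (X / e ^+ 2).
Proof.
move=> X0; have -> : kap * X = kap * e ^+ 2 * (X / e ^+ 2) by field; rewrite gt_eqF.
by rewrite ler_wpM2r ?scaling_le// divr_ge0// sqr_ge0.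
Qed.

Variable u : 'rV[R]_d -> R.
Hypothesis uC : is_Ck_closure 3 Om u.
Let N3 : R := Ck_norm 3 (ecball x (3 * b * h)) u.
Let g (i : 'I_d) : R := partial i u x.
Let A (i j : 'I_d) : R := partials [:: j; i] u x.
(** The diffusion part of the limit operator is [2 * U / rho x], by [weighted_divergence]. *)
Let U : R := \sum_i g i * partial i rho x + 2^-1 * rho x * \sum_i A i i.

Let xx : ecball x (3 * b * h) x.
Proof. by rewrite /ecball/= subrr enorm0 mulr_ge0 ?mulr_ge0 ?(ltW h0). Qed.
Let partials_le (s : seq 'I_d) : (size s <= 3)%N -> `|partials s u x| <= N3.
Proof. by move=> ss; exact: (partials_le_Ck_norm oOm bOm uC ss xOm xx). Qed.
Let N30 : 0 <= N3. Proof. exact: le_trans (partials_le (s := [::]) _). Qed.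
Let gN i : `|g i| <= N3. Proof. exact: (partials_le (s := [:: i])). Qed.
Let AN i j : `|A i j| <= N3. Proof. exact: (partials_le (s := [:: j; i])). Qed.

Let taylor_e (y : 'rV[R]_d) : enorm (y - x) <= e ->
  `|u y - u x - \sum_i (y - x) 0 i * g i - 2^-1 * bilin A (y - x) (y - x)| <= d%:R ^+ 3 * e ^+ 3 * N3.
Proof.
move=> ye; have y3 : enorm (y - x) <= 3 * b * h.
  apply: le_trans ye _; apply: le_trans eb _; rewrite ler_pM2r//.
  by rewrite ler_peMl// ler1n.
have := taylor_Ck_norm oOm bOm uC xOm y3; rewrite (addrC x) subrK => /le_trans; apply.
rewrite ler_wpM2r// ler_wpM2l ?exprn_ge0//; apply: lerXn2r; rewrite ?nnegrE ?(ltW e0)//.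
Qed.

Let s0 : R := n%:R^-1 * \sum_(0 <= l < n) kernel eta e (Y l - x).
Let s1 : R := n%:R^-1 * \sum_(0 <= l < n) kernel eta e (Y l - x) * (u (Y l) - u x).

Let s0_close : `|s0 - rho x * e ^+ d| <= Cm * h ^+ d.+1.
Proof.
exact: (kernel_sum_order0 eta_adm oOm beta0 rho_cont rho_bounds QE K_ge0 K_ge0 rho1 n0 a0 ab' b1 om0 oma tau0 lam0 lam4 h0 h1 xOm dev ea eb).
Qed.

Let Cm0 : 0 <= Cm.
Proof.
by have := le_trans (normr_ge0 _) s0_close; rewrite pmulr_lge0// exprn_gt0.
Qed.

Let m : R := beta * a ^+ d / 2.
Let m0 : 0 < m. Proof. by rewrite divr_gt0// mulr_gt0// exprn_gt0. Qed.

(** The mean is at least [2 * m * h ^+ d], and [h_small2] keeps the deviation below half of that, so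
    the degree is safely away from 0. *)
Let s0_ge : m * h ^+ d <= s0.
Proof.
have := s0_close; rewrite ler_norml => /andP[+ _].
have t1 : 2 * m * h ^+ d <= rho x * e ^+ d.
  rewrite (_ : 2 * m * h ^+ d = beta * (a * h) ^+ d); last by rewrite /m exprMn; field.
  apply: ler_pM => //; [exact: ltW|by rewrite exprn_ge0// mulr_ge0// ltW|].
  by apply: lerXn2r; rewrite ?nnegrE// ltW// mulr_gt0.
have t2 : Cm * h ^+ d.+1 <= m * h ^+ d by rewrite exprS mulrA ler_pM2r.
rewrite -mulrA in t1 *; move: t1 t2; set q := m * _; lra.
Qed.

Let s00 : 0 < s0. Proof. by apply: lt_le_trans s0_ge; exact: mulr_gt0. Qed.

Let s0_le : s0 <= (beta^-1 * b ^+ d + Cm) * h ^+ d.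
Proof.
have := s0_close; rewrite ler_norml => /andP[_].
have t1 : rho x * e ^+ d <= beta^-1 * b ^+ d * h ^+ d.
  rewrite -[leRHS]mulrA -exprMn; apply: ler_pM => //; [exact: ltW|by rewrite exprn_ge0// ltW|].
  by apply: lerXn2r; rewrite ?nnegrE ?(ltW e0)// mulr_ge0// ltW.
have t2 : Cm * h ^+ d.+1 <= Cm * h ^+ d by rewrite ler_wpM2l// exprS ler_piMl// ltW.
by move=> H; rewrite mulrDl; apply: le_trans (lerD t1 (le_trans H t2)); rewrite addrC subrK.
Qed.

Let bC0 : 0 <= beta^-1 * b ^+ d + Cm.
Proof. by apply: addr_ge0 => //; rewrite mulr_ge0 ?invr_ge0 ?(ltW beta0)// exprn_ge0. Qed.
Let db0 : 0 <= d%:R ^+ 3 * b ^+ 3. Proof. by rewrite mulr_ge0 ?exprn_ge0. Qed.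

Let increment_const0 : 0 <= increment_const.
Proof.
rewrite addr_ge0//; first by rewrite addr_ge0// mulr_ge0// exprn_ge0.
exact: mulr_ge0.
Qed.

Let lh0 : 0 <= lam + h. Proof. by rewrite addr_ge0// ltW. Qed.

(** First moments, second moments and Taylor remainder contribute in this order. The last two are of
    order [h ^+ d.+3], hence absorbed by [(lam + h) * h ^+ d.+2]. *)
Let increment_close : `|s1 - e ^+ d * e ^+ 2 * sig * U| <= N3 * increment_const * (lam + h) * h ^+ d.+2.
Proof.
have tauE : e ^+ d * e ^+ 2 * sig * U = e ^+ d.+2 * sig * U by rewrite -exprD addn2.
have H1 := kernel_sum_order1 i0 eta_adm oOm beta0 rho_cont rho_bounds QE K_ge0 K_ge0 rho2 n0 a0 ab' b1 om0 oma tau0 lam0 lam4 h0 h1 xOm dev ea eb.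
have H2 := kernel_sum_order2 i0 eta_adm oOm beta0 rho_cont rho_bounds QE K_ge0 K_ge0 rho1 n0 a0 ab' b1 om0 oma tau0 lam0 lam4 h0 h1 xOm dev ea eb.
have kp l : 0 <= kernel eta e (Y l - x) by exact: (kernel_ge0 eta_adm _ e0).
have HD l : (l < n)%N -> kernel eta e (Y l - x) * `|u (Y l) - u x - \sum_i (Y l - x) 0 i * g i
     - 2^-1 * bilin A (Y l - x) (Y l - x)| <= kernel eta e (Y l - x) * (d%:R ^+ 3 * e ^+ 3 * N3).
  move=> _; have [ye|ye] := leP (enorm (Y l - x)) e; first by rewrite ler_wpM2l// taylor_e.
  by rewrite (kernel_supp eta_adm) ?(ltW ye)// !mul0r.
have := weighted_taylor_close kp HD H1 H2 gN AN.
rewrite tauE => /le_trans; apply.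
rewrite -mulr_suml [n%:R^-1 * (_ * _)]mulrA -/s0 -/Cm.
have h3 : h ^+ d.+3 <= (lam + h) * h ^+ d.+2.
  by rewrite [leLHS]exprS ler_pM2r ?exprn_gt0// lerDr ltW.
have t3 : s0 * (d%:R ^+ 3 * e ^+ 3 * N3) <= (beta^-1 * b ^+ d + Cm) * (d%:R ^+ 3 * b ^+ 3) * N3 * ((lam + h) * h ^+ d.+2).
  apply: (@le_trans _ _ ((beta^-1 * b ^+ d + Cm) * h ^+ d * (d%:R ^+ 3 * (b * h) ^+ 3 * N3))).
    apply: ler_pM => //; [exact: ltW|by rewrite !mulr_ge0 ?exprn_ge0// ltW|].
    rewrite ler_wpM2r// ler_wpM2l ?exprn_ge0//; apply: lerXn2r; rewrite ?nnegrE ?mulr_ge0 ?(ltW e0) ?(ltW h0)//.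
  rewrite (_ : _ * _ = (beta^-1 * b ^+ d + Cm) * (d%:R ^+ 3 * b ^+ 3) * N3 * h ^+ d.+3).
    by apply: ler_wpM2l => //; apply: mulr_ge0 => //; exact: mulr_ge0.
  by rewrite !exprS exprMn; ring.
have t2 : d%:R * (d%:R * (N3 * (Cm * h ^+ d.+3))) <= d%:R ^+ 2 * Cm * N3 * ((lam + h) * h ^+ d.+2).
  rewrite (_ : d%:R * _ = d%:R ^+ 2 * Cm * N3 * h ^+ d.+3); last by ring.
  by rewrite ler_wpM2l// mulr_ge0// mulr_ge0// exprn_ge0.
rewrite [leRHS](_ : _ = d%:R * (N3 * (Cm * (lam + h) * h ^+ d.+2)) + d%:R ^+ 2 * Cm * N3 * ((lam + h) * h ^+ d.+2) +
  (beta^-1 * b ^+ d + Cm) * (d%:R ^+ 3 * b ^+ 3) * N3 * ((lam + h) * h ^+ d.+2)).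
  by apply: lerD t3; rewrite lerD2l.
by rewrite /increment_const; ring.
Qed.

Let drift_bound0 : 0 <= drift_bound.
Proof.
by rewrite divr_ge0 ?(ltW beta0)// mulr_ge0// addr_ge0 ?mulr_ge0// ?invr_ge0// ltW.
Qed.

Let drift_le : `|2 * U / rho x| <= drift_bound * N3.
Proof.
have U_le : `|U| <= (d%:R * K + 2^-1 * beta^-1 * d%:R) * N3.
  rewrite mulrDl; apply: le_trans (ler_normD _ _) _; apply: lerD.
    apply: le_trans (ler_norm_sum _ _ _) _.
    rewrite -[X in X%:R * _ * _]card_ord -sum1_card natr_sum !mulr_suml; apply: ler_sum => i _.
    by rewrite mul1r normrM mulrC; apply: ler_pM => //; exact: rho_partial.
  rewrite !normrM ger0_norm ?invr_ge0// -!mulrA ler_wpM2l ?invr_ge0//.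
  apply: ler_pM => //; first by rewrite ger0_norm// ltW.
  apply: le_trans (ler_norm_sum _ _ _) _.
  rewrite -[X in X%:R * _]card_ord -sum1_card natr_sum mulr_suml; apply: ler_sum => i _.
  by rewrite mul1r.
rewrite !normrM normfV (ger0_norm (ltW rx0)) ger0_norm// /drift_bound.
rewrite (_ : _ / beta * N3 = 2 * ((d%:R * K + 2^-1 * beta^-1 * d%:R) * N3) * beta^-1); last by ring.
apply: ler_pM => //; rewrite ?mulr_ge0 ?invr_ge0 ?(ltW rx0)//; first by rewrite ler_pM2l.
by rewrite lef_pV2 ?posrE.
Qed.

Lemma L_rw_close : `|L_rw i0 eta n k S u x - Rx * (2 * U / rho x)| <= rw_const * N3 * (lam + h).
Proof.
have nR : n%:R != 0 :> R by rewrite pnatr_eq0 -lt0n.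
have sig0 : 0 < sig by exact: sigma_eta_gt0.
have wE y : knn_weight eta k S x y = kernel eta e (y - x) by rewrite /knn_weight enormB.
have -> : L_rw i0 eta n k S u x = 2 / (sig * s0) * kap * s1.
  rewrite /L_rw /knn_degree -/kap.
  under eq_bigr do rewrite wE.
  under [X in _ * X = _]eq_bigr do rewrite wE.
  rewrite !sumS /s1 /s0; field.
  have qn : \sum_(0 <= l < n) kernel eta e (Y l - x) != 0.
    by apply/eqP => q0; move: (s00); rewrite /s0 q0 mulr0 ltxx.
  by rewrite nR qn gt_eqF.
have := quotient_close s00 rx0 sig0 kap0 s0_close increment_close scaling_close.
move/le_trans; apply.
have q2 : h ^+ d / s0 <= m^-1.
  by rewrite ler_pdivrMr// mulrC ler_pdivlMr// mulrC.
have q1 : Cm * h ^+ d.+1 / s0 <= Cm / m * (lam + h).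
  rewrite [leLHS](_ : _ = Cm * (h * (h ^+ d / s0))); last by rewrite exprS; ring.
  rewrite -mulrA ler_wpM2l// [m^-1 * _]mulrC; apply: ler_pM => //; first exact: ltW.
    by rewrite divr_ge0 ?(ltW s00) ?(ltW hd0).
  by rewrite lerDr ltW.
have q3 : kap * h ^+ 2 <= scaling_bound / a ^+ 2.
  apply: le_trans (kap_le (sqr_ge0 h)) _; rewrite ler_wpM2l//.
  rewrite ler_pdivrMr ?exprn_gt0// mulrC ler_pdivlMr ?exprn_gt0// -exprMn mulrC.
  by apply: lerXn2r; rewrite ?nnegrE ?(ltW e0)// mulr_ge0// ltW.
have t1 : kap * e ^+ 2 * `|2 * U / rho x| * (Cm * h ^+ d.+1) / s0 <=
    scaling_bound * (drift_bound * N3) * (Cm / m * (lam + h)).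
  rewrite -[leLHS]mulrA; apply: ler_pM => //.
  - by apply: mulr_ge0 => //; apply: mulr_ge0 => //; exact: sqr_ge0.
  - by rewrite divr_ge0 ?(ltW s00)// mulr_ge0// exprn_ge0// ltW.
  - apply: ler_pM => //; [by apply: mulr_ge0 => //; exact: sqr_ge0|exact: scaling_le].
have t2 : scaling_const * (lam + h) * `|2 * U / rho x| <= scaling_const * (lam + h) * (drift_bound * N3).
  by apply: ler_wpM2l => //; exact: mulr_ge0.
have t3 : 2 * kap * (N3 * increment_const * (lam + h) * h ^+ d.+2) / (sig * s0) <=
    2 * (scaling_bound / a ^+ 2 * (N3 * increment_const * (lam + h)) * m^-1) / sig.
  rewrite [leLHS](_ : _ = 2 * (kap * h ^+ 2 * (N3 * increment_const * (lam + h)) * (h ^+ d / s0)) / sig); last first.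
    by rewrite !exprS; field; rewrite !gt_eqF.
  rewrite ler_pM2r ?invr_gt0// ler_pM2l//.
  have p : 0 <= N3 * increment_const * (lam + h) by apply: mulr_ge0 => //; exact: mulr_ge0.
  apply: ler_pM => //.
  - by apply: mulr_ge0 => //; apply: mulr_ge0 => //; exact: sqr_ge0.
  - by rewrite divr_ge0 ?(ltW s00) ?(ltW hd0).
  - by apply: ler_wpM2r.
apply: le_trans (lerD (lerD t1 t2) t3) _.
rewrite le_eqVlt; apply/orP; left; apply/eqP; rewrite /rw_const -/m.
by field; rewrite !gt_eqF.
Qed.

Variables (r0 theta L C dl : R).
Hypotheses (r01 : 0 < r0 < 1) (th0 : 0 < theta) (pk : kernel_peak eta r0 theta).
Hypothesis HL : forall s t, 0 <= s -> 0 <= t -> `|eta s - eta t| <= L * `|s - t|.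
Hypotheses (L0 : 0 <= L) (C0 : 0 <= C).
Hypothesis HC : forall r, 0 <= r <= 2 -> r0 * eta r0 - C * (r - r0) ^+ 2 <= r * eta r.
(** At this distance [dl ^+ 2 / e ^+ 3] is of order [lam] and [dl / e] is at most [lam + h], since
    the root of [lam * h] is; the factor [r0 * a / 2] ensures [dl <= r0 * e / 2]. *)
Hypothesis dlE : dl = r0 * a / 2 * (h * Num.sqrt (lam * h)).
Hypothesis filled : forall p, ecball p dl `<=` Om -> exists2 j, (j < n)%N & enorm (Y j - p) <= dl.
Hypothesis grad0 : grad u x != 0.
Let N2 : R := Ck_norm 2 (ecball x (3 * b * h)) u.
Let G : R := enorm (grad u x).

Definition infty_factor : R := scaling_bound * (2 / (r0 ^+ 2 * eta r0)).
Definition infty_const1 : R :=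
  infty_factor * ((eta 0 ^+ 2 / r0 + (L + 2 * eta 0) ^+ 2) * (d%:R ^+ 4 * b)).
Definition infty_const2 : R :=
  infty_factor * (d%:R * (C + eta 0 / r0) / a + d%:R ^+ 2 * (2 * eta 0 + L) + eta 0 * d%:R ^+ 3 * b)
  + scaling_const * d%:R ^+ 2.

Let r00 : 0 < r0. Proof. by have /andP[] := r01. Qed.
Let G0 : 0 < G. Proof. by rewrite enorm_gt0. Qed.
Let eta0 : 0 <= eta 0. Proof. exact: (eta_ge0 eta_adm). Qed.
(** At 0 the peak condition reads [theta * r0 ^+ 2 <= r0 * eta r0]. *)
Let etar0 : 0 < eta r0.
Proof.
have := pk (r := 0); rewrite lexx ler01 mul0r add0r sub0r sqrrN => /(_ isT).
by move=> H; rewrite -(pmulr_rgt0 _ r00); apply: lt_le_trans H; rewrite mulr_gt0// exprn_gt0.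
Qed.
Let lh1 : 0 < lam * h. Proof. exact: mulr_gt0. Qed.
Let sq0 : 0 < Num.sqrt (lam * h). Proof. by rewrite sqrtr_gt0. Qed.
Let sq_le : Num.sqrt (lam * h) <= lam + h.
Proof.
rewrite -(ler_pXn2r (n := 2)) ?nnegrE ?(ltW sq0)// sqr_sqrtr ?(ltW lh1)//.
have p1 := ltW lh1; have p2 := sqr_ge0 lam; have p3 := sqr_ge0 h.
rewrite sqrrD; move: p1 p2 p3; set q1 := lam * h; set q2 := lam ^+ 2; set q3 := h ^+ 2; lra.
Qed.
Let sq_le1 : Num.sqrt (lam * h) <= 1.
Proof.
rewrite -(sqrtr1 R) ler_sqrt//; apply: le_trans (_ : 1 * 1 <= _); last by rewrite mulr1.
have [_ [[_ _ ? ?] _]] := scales.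
by apply: ler_pM => //; [exact: ltW|exact: ltW|lra].
Qed.
Let dl0 : 0 < dl.
Proof. by rewrite dlE mulr_gt0 ?(mulr_gt0 h0)// divr_gt0// mulr_gt0. Qed.
Let dle : dl <= r0 * e / 2.
Proof.
rewrite dlE (_ : _ * _ = r0 / 2 * (a * h * Num.sqrt (lam * h))); last by ring.
rewrite [leRHS]mulrAC ler_pM2l ?divr_gt0//; apply: le_trans ea.
by rewrite ler_piMr// mulr_ge0// ltW.
Qed.

(** The ball of radius [dl] around the peak stays within distance [3 * b * h] of [x], so the filling
    property applies to it. *)
Let sample_near nu : enorm nu = 1 -> exists2 y, y \in S & enorm (y - x - (r0 * e) *: nu) <= dl.
Proof.
move=> nu1; have re : r0 * e <= e by rewrite ler_piMl ?(ltW e0)//; have /andP[_ /ltW] := r01.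
have [|j jn Hj] := @filled (x + (r0 * e) *: nu).
  move=> y /= yp; apply: xOm; rewrite /ecball/=.
  have -> : y - x = (y - (x + (r0 * e) *: nu)) + (r0 * e) *: nu by rewrite opprD addrA subrK.
  apply: le_trans (enorm_triangle _ _) _.
  rewrite enormZ nu1 mulr1 ger0_norm; last by rewrite mulr_ge0 ?(ltW r00) ?(ltW e0).
  have bh : 0 <= b * h by rewrite mulr_ge0// ltW.
  have eb' := eb; have dle' := dle; have e0' := e0.
  rewrite -[3 * b * h]mulrA; move: yp re bh eb' dle' e0'; rewrite /ecball/=; set q := b * h; set q2 := r0 * e; set q3 := enorm (y - _); lra.
exists (Y j); first by apply/mapP; exists j; rewrite // mem_iota.
by move: Hj; rewrite opprD addrA.
Qed.

Let bilin_N (N : R) : (forall i j, `|A i j| <= N) -> forall z z', `|bilin A z z'| <= d%:R ^+ 2 * N * (enorm z * enorm z').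
Proof. by move=> AN' z z'; exact: bilin_le. Qed.

Let AN2 i j : `|A i j| <= N2.
Proof.
have [uk uc ue] := uC.
have u2 : is_Ck_closure 2 Om u.
  split; [exact: (is_Ck_le uk)|exact: uc|].
  by move=> s ss; apply: ue; exact: leq_trans ss _.
exact: (partials_le_Ck_norm (k := 2) (s := [:: j; i]) oOm bOm u2 isT xOm xx).
Qed.

Let N20 : 0 <= N2. Proof. exact: le_trans (AN2 i0 i0). Qed.

Let infty_laplacian_le : `|infty_laplacian u x| <= d%:R ^+ 2 * N3.
Proof.
rewrite infty_laplacianE normrM ger0_norm ?invr_ge0 ?sqr_ge0// -/G mulrC ler_pdivrMr ?exprn_gt0//.
by rewrite expr2; exact: (bilin_N AN).
Qed.

Let infty_factor0 : 0 <= infty_factor.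
Proof. by rewrite mulr_ge0// divr_ge0// mulr_ge0 ?sqr_ge0// ltW. Qed.

Lemma L_infty_close : `|L_infty eta r0 n k S u x - Rx * infty_laplacian u x| <=
  infty_const1 * (N2 ^+ 2 * G^-1 * theta^-1 * h) + infty_const2 * (N3 * (lam + h)).
Proof.
have wE : [set knn_weight eta k S x y * (u y - u x) | y in [set` S]] =
    [set kernel eta e (y - x) * (u y - u x) | y in [set` S]].
  by apply: eq_imagel => y _; rewrite /knn_weight enormB.
have D0 : 0 <= d%:R ^+ 3 * e ^+ 3 * N3 by rewrite mulr_ge0// mulr_ge0 ?exprn_ge0// ltW.
have gE : grad u x = \row_i g i by [].
have := @inf_sup_kernel_close _ _ eta eta_adm S r0 theta L C (d%:R ^+ 2 * N2) (d%:R ^+ 2 * N3) e dl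
  (d%:R ^+ 3 * e ^+ 3 * N3) A g x u HL L0 r01 th0 pk C0 HC.
rewrite -gE -/G => /(_ G0 (mulr_ge0 (exprn_ge0 _ (ler0n _ _)) N20) (mulr_ge0 (exprn_ge0 _ (ler0n _ _)) N30) e0 dl0 dle D0
  (bilin_N AN2) (bilin_N AN) (fun y _ => @taylor_e y) sample_near).
rewrite -infty_laplacianE /L_infty wE -/kap.
set I := inf _; set J := sup _; set Del := infty_laplacian u x.
set E1 := _ * (_ ^+ 2 * _ / _); set E2 := _ * (dl ^+ 2 / e); set E3 := _ * (dl * e); set E4 := eta 0 * _.
move=> H.
have rr : 0 < r0 ^+ 2 * eta r0 by rewrite mulr_gt0 ?exprn_gt0.
have e20 : 0 < e ^+ 2 by rewrite exprn_gt0.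
(* Splits off the error of the scaling, so that the extremal values are compared with their
   expansion at the actual radius [e]. *)
rewrite (_ : _ - _ = (r0 ^+ 2 * eta r0)^-1 * (kap * (I + J - eta r0 * r0 ^+ 2 * e ^+ 2 * Del)) + (kap * e ^+ 2 - Rx) * Del);
  last by field; rewrite !gt_eqF.
apply: le_trans (ler_normD _ _) _.
have T0 : `|(kap * e ^+ 2 - Rx) * Del| <= scaling_const * d%:R ^+ 2 * (N3 * (lam + h)).
  rewrite normrM (_ : _ * (N3 * _) = scaling_const * (lam + h) * (d%:R ^+ 2 * N3)); last by ring.
  by apply: ler_pM => //; exact: scaling_close.
have P1 : 0 <= eta 0 ^+ 2 / r0 + (L + 2 * eta 0) ^+ 2.
  by rewrite addr_ge0 ?sqr_ge0// divr_ge0 ?sqr_ge0// ltW.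
have P2 : 0 <= C + eta 0 / r0 by rewrite addr_ge0// divr_ge0// ltW.
have P3 : 0 <= 2 * eta 0 + L by rewrite addr_ge0// mulr_ge0.
have GN : G <= d%:R * N3 by apply: enorm_le_coord => i; rewrite mxE; exact: gN.
have dl2 : dl ^+ 2 / e / e ^+ 2 <= lam / a.
  rewrite -mulrA -invfM ler_pdivrMr ?mulr_gt0//.
  apply: (@le_trans _ _ (lam / a * (a * h) ^+ 3)).
    have -> : dl ^+ 2 = (r0 / 2) ^+ 2 * (lam * a ^+ 2 * h ^+ 3).
      by rewrite dlE !exprMn sqr_sqrtr ?(ltW lh1)// !exprS; ring.
    have -> : lam / a * (a * h) ^+ 3 = lam * a ^+ 2 * h ^+ 3 by rewrite !exprS; field; rewrite gt_eqF.
    rewrite ler_piMl//; first by rewrite !mulr_ge0 ?exprn_ge0 ?(ltW lam0) ?(ltW h0) ?(ltW a0).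
    rewrite expr2; have /andP[r0p r0q] := r01.
    by rewrite -[leRHS]mulr1; apply: ler_pM; rewrite ?divr_ge0 ?(ltW r00)//; move: r0p r0q; lra.
  rewrite ler_pM2l ?divr_gt0// (_ : e * e ^+ 2 = e ^+ 3)//.
  by apply: lerXn2r; rewrite ?nnegrE ?(ltW e0)// mulr_ge0// ltW.
have dl1 : dl * e / e ^+ 2 <= lam + h.
  have -> : dl * e / e ^+ 2 = dl / e by field; rewrite gt_eqF.
  rewrite ler_pdivrMr//; apply: (@le_trans _ _ ((lam + h) * (a * h))).
    rewrite dlE (_ : _ * (h * _) = r0 / 2 * (Num.sqrt (lam * h) * (a * h))); last by ring.
    apply: (@le_trans _ _ (1 * ((lam + h) * (a * h)))); last by rewrite mul1r.
    have /andP[r0p r0q] := r01.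
    apply: ler_pM; rewrite ?divr_ge0 ?mulr_ge0 ?(ltW r00) ?(ltW sq0) ?(ltW a0) ?(ltW h0)//.
      by move: r0p r0q; lra.
    by rewrite ler_pM2r// mulr_gt0.
  by rewrite ler_wpM2l.
(* The only error with [theta] in the denominator; [d%:R ^+ 4] is the square of the factor that
   bounds the Hessian form by the norm [N2]. *)
have B1 : E1 / e ^+ 2 <= (eta 0 ^+ 2 / r0 + (L + 2 * eta 0) ^+ 2) * (d%:R ^+ 4 * b) * (N2 ^+ 2 * G^-1 * theta^-1 * h).
  rewrite (_ : E1 / _ = (eta 0 ^+ 2 / r0 + (L + 2 * eta 0) ^+ 2) * (d%:R ^+ 4 * (N2 ^+ 2 * G^-1 * theta^-1)) * e); last first.
    by rewrite /E1; field; rewrite !gt_eqF.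
  rewrite [leRHS](_ : _ = (eta 0 ^+ 2 / r0 + (L + 2 * eta 0) ^+ 2) * (d%:R ^+ 4 * (N2 ^+ 2 * G^-1 * theta^-1)) * (b * h)); last by ring.
  apply: ler_wpM2l => //; apply: mulr_ge0 => //; apply: mulr_ge0; first exact: exprn_ge0.
  by rewrite !mulr_ge0 ?sqr_ge0 ?invr_ge0 ?(ltW G0) ?(ltW th0).
have B2 : E2 / e ^+ 2 <= d%:R * (C + eta 0 / r0) / a * (N3 * (lam + h)).
  rewrite /E2 -[leLHS]mulrA [leRHS](_ : _ = d%:R * N3 * (C + eta 0 / r0) * ((lam + h) / a)); last by ring.
  apply: ler_pM => //.
  - by rewrite mulr_ge0 ?(ltW G0).
  - by rewrite divr_ge0 ?sqr_ge0// divr_ge0 ?sqr_ge0// ltW.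
  - by rewrite ler_wpM2r.
  - by apply: le_trans dl2 _; rewrite ler_pM2r ?invr_gt0// lerDl ltW.
have B3 : E3 / e ^+ 2 <= d%:R ^+ 2 * (2 * eta 0 + L) * (N3 * (lam + h)).
  rewrite /E3 -[leLHS]mulrA [leRHS](_ : _ = d%:R ^+ 2 * N3 * (2 * eta 0 + L) * (lam + h)); last by ring.
  by apply: ler_wpM2l => //; apply: mulr_ge0 => //; apply: mulr_ge0 => //; exact: exprn_ge0.
have B4 : E4 / e ^+ 2 <= eta 0 * d%:R ^+ 3 * b * (N3 * (lam + h)).
  rewrite (_ : E4 / _ = eta 0 * d%:R ^+ 3 * N3 * e); last by rewrite /E4; field; rewrite gt_eqF.
  rewrite [leRHS](_ : _ = eta 0 * d%:R ^+ 3 * N3 * (b * (lam + h))); last by ring.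
  apply: ler_wpM2l; first by apply: mulr_ge0 => //; apply: mulr_ge0 => //; exact: exprn_ge0.
  by apply: le_trans eb _; rewrite ler_wpM2l// lerDr ltW.
have T1 : `|(r0 ^+ 2 * eta r0)^-1 * (kap * (I + J - eta r0 * r0 ^+ 2 * e ^+ 2 * Del))| <=
   infty_factor * ((E1 + E2 + E3 + E4) / e ^+ 2).
  rewrite normrM ger0_norm ?invr_ge0 ?(ltW rr)// normrM (ger0_norm kap0).
  have E0 : 0 <= E1 + E2 + E3 + E4 by have := le_trans (normr_ge0 _) H; rewrite pmulr_rge0.
  apply: (@le_trans _ _ ((r0 ^+ 2 * eta r0)^-1 * (2 * (kap * (E1 + E2 + E3 + E4))))).
    by rewrite ler_pM2l ?invr_gt0// [leRHS]mulrCA ler_wpM2l.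
  rewrite /infty_factor [leRHS](_ : _ = (r0 ^+ 2 * eta r0)^-1 * (2 * (scaling_bound * ((E1 + E2 + E3 + E4) / e ^+ 2)))); last by ring.
  by rewrite ler_pM2l ?invr_gt0// ler_pM2l// kap_le.
apply: le_trans (lerD T1 T0) _.
have B := lerD (lerD (lerD B1 B2) B3) B4.
move: B; rewrite -!mulrDl /infty_const1 /infty_const2.
move: (N2 ^+ 2 / G / theta * h) (N3 * (lam + h)) => W1 W2 B.
rewrite [leRHS](_ : _ = infty_factor * ((eta 0 ^+ 2 / r0 + (L + 2 * eta 0) ^+ 2) * (d%:R ^+ 4 * b) * W1 +
  (d%:R * (C + eta 0 / r0) / a * W2 + d%:R ^+ 2 * (2 * eta 0 + L) * W2 + eta 0 * d%:R ^+ 3 * b * W2))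
  + scaling_const * d%:R ^+ 2 * W2); last by ring.
by rewrite lerD2r ler_wpM2l//; apply: le_trans B _; rewrite !mulrDl !addrA.
Qed.

Lemma L_p_close (p : \bar R) : `|L_p i0 eta r0 n k S p u x - Rx * p_laplacian rho p u x| <=
  `|inv_p p| * (rw_const * N3 * (lam + h)) + `|1 - 2 * inv_p p| *
  (infty_const1 * (N2 ^+ 2 * G^-1 * theta^-1 * h) + infty_const2 * (N3 * (lam + h))).
Proof.
have -> : L_p i0 eta r0 n k S p u x - Rx * p_laplacian rho p u x =
    inv_p p * (L_rw i0 eta n k S u x - Rx * (2 * U / rho x)) +
    (1 - 2 * inv_p p) * (L_infty eta r0 n k S u x - Rx * infty_laplacian u x).
  have [uk _ _] := uC.
  rewrite /L_p /p_laplacian -(mulrA (inv_p p)) (weighted_divergence rho_Ck uk Omx rx0) -/U; ring.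
apply: le_trans (ler_normD _ _) _; rewrite !normrM.
by apply: lerD; apply: ler_wpM2l => //; [exact: L_rw_close|exact: L_infty_close].
Qed.

End pointwise.

(** * Probability of the good events *)

Section counting.
Context {R : realType}.

Lemma grid_size_poly (W s C : R) (n : nat) : (0 < n)%N -> 0 < s -> 0 <= W -> s^-1 <= C * n%:R ^+ 3 ->
  (grid_size W s)%:R <= (W * C + 1) * n%:R ^+ 3 :> R.
Proof.
move=> n0 s0 W0 sC; apply: le_trans (grid_size_le s0 W0) _.
rewrite mulrDl mul1r -mulrA; apply: lerD; first exact: ler_wpM2l.
by rewrite exprn_ege1// ler1n.
Qed.

(* The polynomial factor is absorbed by giving up a factor [m] in the exponent. *)
Lemma absorb_polynomial (m n : nat) (N B c C2 C3 E : R) : (0 < m)%N -> 0 <= B -> 0 <= E ->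
  N <= B * (n%:R ^+ 3) ^+ m -> C3 * m%:R <= c -> 1 <= C2 -> 2 * B <= C2 ->
  C2 * n%:R ^+ 3 * expR (- (C3 * E)) < 1 ->
  N * expR (- (c * E)) <= 2^-1 * (C2 * n%:R ^+ 3 * expR (- (C3 * E))).
Proof.
move=> m0 B0 E0 NB C3c C21 BC X1.
set X := n%:R ^+ 3 * expR (- (C3 * E)).
have X0 : 0 <= X by rewrite mulr_ge0 ?exprn_ge0// expR_ge0.
have Xle : X <= 1.
  apply: le_trans (ltW X1); rewrite -mulrA -/X; exact: ler_peMl.
apply: (@le_trans _ _ (B * X)); last first.
  rewrite -mulrA -/X; have := ler_wpM2r X0 BC; lra.
apply: (@le_trans _ _ (B * X ^+ m)); last first.
  by rewrite ler_wpM2l// -[leRHS]expr1; apply: ler_wiXn2l.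
apply: le_trans (ler_wpM2r (expR_ge0 _) NB) _.
rewrite /X [X in _ <= _ * X](exprMn m (n%:R ^+ 3)) [leRHS]mulrA; apply: ler_wpM2l; first by rewrite mulr_ge0// !exprn_ge0.
rewrite -expRM_natl ler_expR mulrN lerN2 mulrA ler_wpM2r//.
by rewrite mulrC.
Qed.

End counting.

Section events.
Context {R : realType} {d : nat} {dT : measure_display} {T : measurableType dT}.
Variables (P : probability T R) (Q : probability 'rV[R]_d R) (X : nat -> {RV P >-> 'rV[R]_d}).
Hypothesis XQ : forall i A, measurable A -> P (X i @^-1` A) = Q A.
Hypothesis X_indep : forall (n : nat) (A : nat -> set 'rV[R]_d),
  (forall i, measurable (A i)) -> P (\bigcap_(i < n) (X i @^-1` A i)) = (\prod_(i < n) P (X i @^-1` A i))%E.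
Variables (eta : R -> R) (Om : set 'rV[R]_d) (rho : 'rV[R]_d -> R) (beta W0 L : R).
Hypothesis eta_adm : @admissible_kernel R d eta.
Hypotheses (oOm : open Om) (beta0 : 0 < beta) (beta1 : beta <= 1).
Hypothesis rho_cont : forall x, Om x -> {for x, continuous rho}.
Hypothesis rho_bounds : forall x, Om x -> beta <= rho x <= beta^-1.
Hypothesis QE : forall A, measurable A ->
  Q A = (\int[lebesgue_rV d]_(x in A `&` Om) (rho x)%:E)%E.
Hypothesis OmW : forall x i, Om x -> `|x 0 i| <= W0.
Hypothesis HL : forall s t, 0 <= s -> 0 <= t -> `|eta s - eta t| <= L * `|s - t|.
Local Notation al := (ball_volume R d).
Variables (a b om : R).

Let M : R := (eta 0 + 1) * (1 + 2 * b) ^+ 2.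
(** This makes [M * tau * h ^+ d] the second-moment bound for supports of radius [3 * b * h].
    Bernstein's exponent for the deviation [tau * lam * h ^+ d.+1] is then [deviation_rate] times
    [n%:R * h ^+ d * h ^+ 2 * lam ^+ 2]. *)
Definition deviation_scale : R := M * (beta^-1 * al * (3 * b) ^+ d).
Local Notation tau := deviation_scale.
Definition deviation_lipschitz : R := om^-1 + 2 * L * (1 + 2 * b) ^+ 2 / a + 2 * (eta 0 * (1 + 2 * b)).
Definition deviation_rate : R := tau / (8 * M).
(** The two tails, the number of statistics, and the grid for [d] coordinates and one radius,
    stripped of its power of [n]. *)
Definition deviation_count : R :=
  2 * #|{: option (option 'I_d * option 'I_d)}|%:R *
  ((2 * W0 + 2 * b) * (deviation_lipschitz * (d%:R + 1) / tau) + 1) ^+ d.+1.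

Lemma deviation_event (n : nat) (lam h : R) : (0 < n)%N ->
  0 < a -> a <= b -> 1 <= b -> 0 < om -> om <= b -> 0 <= L -> 0 <= W0 -> 0 < lam -> lam <= 1 -> 0 < h -> h <= 1 ->
  n%:R^-1 <= lam * h -> n%:R^-1 <= h ^+ d ->
  exists2 A : set T,
    holds_up_to P (deviation_count * (n%:R ^+ 3) ^+ d.+1 *
      expR (- (deviation_rate * (n%:R * h ^+ d * h ^+ 2 * lam ^+ 2)))) A &
    forall w, A w -> forall l e (x : 'rV[R]_d), Om x -> a * h / 2 <= e <= 2 * b * h ->
    `|\sum_(0 <= j < n) statistic eta (lam * om * h) b h l e (X j w - x)
    - n%:R * \int[Q]_y statistic eta (lam * om * h) b h l e (y - x)|
    <= 3 * (n%:R * (tau * lam * h ^+ d.+1)).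
Proof.
move=> n0 a0 ab b1 om0 omb L0 W00 lam0 lam1 h0 h1 nlh nhd.
have n0' : 0 < n%:R :> R by rewrite ltr0n.
have al0 : 0 < al by apply: ball_volume_gt0.
have E0 : 0 <= eta 0 by exact: (eta_ge0 eta_adm).
have b0 : 0 < b by lra.
have B0 : 0 < 1 + 2 * b by lra.
have M0 : 0 < M by rewrite mulr_gt0 ?exprn_gt0//; lra.
have tau0 : 0 < tau.
  by rewrite mulr_gt0// mulr_gt0 ?exprn_gt0 ?mulr_gt0// invr_gt0.
have CL0 : 0 < deviation_lipschitz.
  rewrite /deviation_lipschitz -addrA ltr_wpDr ?invr_gt0// addr_ge0//.
    by rewrite divr_ge0 ?(ltW a0)// mulr_ge0 ?sqr_ge0// mulr_ge0.
  by rewrite mulr_ge0// mulr_ge0// ltW.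
have hd0 : 0 < h ^+ d by rewrite exprn_gt0.
set t := tau * lam * h ^+ d.+1.
have t0 : 0 < t by apply: mulr_gt0; [exact: mulr_gt0|exact: exprn_gt0].
have lh0 : 0 < lam * h by rewrite mulr_gt0.
pose Lam := deviation_lipschitz / (lam * h).
have Lam0 : 0 < Lam by rewrite divr_gt0.
have d10 : 0 < d%:R + 1 :> R by rewrite ltr_wpDl.
(* The mesh for which passing to the net point changes a statistic by at most [t]. *)
pose s := t / (Lam * (d%:R + 1)).
have s0 : 0 < s by rewrite divr_gt0// mulr_gt0.
pose V := M * tau * h ^+ d.
have V0 : 0 < V := mulr_gt0 (mulr_gt0 M0 tau0) hd0.
have w0 : 0 < lam * om * h by rewrite !mulr_gt0.
have bh0 : 0 < b * h by rewrite mulr_gt0.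
have wb : lam * om * h <= b * h.
  by rewrite ler_pM2r// -[leRHS]mul1r; apply: ler_pM => //; exact: ltW.
have lo0 : 0 < a * h / 2 by rewrite divr_gt0// mulr_gt0.
have ahb : a * h <= b * h by rewrite ler_pM2r.
have h3 : 0 < 3 * b * h by rewrite !mulr_gt0.
have e_gt0 e : a * h / 2 <= e <= 2 * b * h -> 0 < e by move=> /andP[+ _]; exact: lt_le_trans.
have tMV : t * M <= 2 * V.
  rewrite /t /V (_ : tau * lam * h ^+ d.+1 * M = lam * h * (M * tau * h ^+ d)); last by rewrite exprS; ring.
  rewrite -/V; apply: ler_pM => //; [exact: ltW|exact: ltW|].
  apply: (@le_trans _ _ (1 * 1)); last by rewrite mulr1 ler1n.
  by apply: ler_pM => //; exact: ltW.
have W1 : 2 * b * h - a * h / 2 <= 2 * W0 + 2 * b.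
  have : b * h <= b by rewrite ler_piMr// ltW.
  rewrite -(mulrA 2); move: (b * h) (a * h / 2) lo0 => q1 q2 *; lra.
have W2 : 2 * W0 <= 2 * W0 + 2 * b by rewrite lerDl mulr_ge0// ltW.
have Ls : Lam * ((d%:R + 1) * s) <= t.
  by rewrite mulrA /s mulrCA divff ?mulr1// gt_eqF// mulr_gt0.
have psiM (l : option (option 'I_d * option 'I_d)) e (z : 'rV[R]_d) : a * h / 2 <= e <= 2 * b * h -> `|statistic eta (lam * om * h) b h l e z| <= M.
  by move=> /e_gt0 ee; apply: (statistic_bound eta_adm) => //; exact: ltW.
have Lam_ge : (lam * om * h)^-1 + L / (a * h / 2) * (1 + 2 * b) ^+ 2 + 2 * (eta 0 * (1 + 2 * b)) / h <= Lam.
  rewrite /Lam /deviation_lipschitz [leRHS](_ : _ = (lam * om * h)^-1 +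
     lam^-1 * (L / (a * h / 2) * (1 + 2 * b) ^+ 2) + lam^-1 * (2 * (eta 0 * (1 + 2 * b)) / h)); last first.
    by field; rewrite !gt_eqF.
  have l1 : 1 <= lam^-1 by rewrite -invr1 lef_pV2 ?posrE.
  apply: lerD; first rewrite lerD2l.
    rewrite ler_peMl// mulr_ge0 ?sqr_ge0// divr_ge0// ltW//.
  by rewrite ler_peMl// divr_ge0 ?(ltW h0)// mulr_ge0// mulr_ge0// ltW.
have psiL (l : option (option 'I_d * option 'I_d)) e e' (z z' : 'rV[R]_d) : a * h / 2 <= e <= 2 * b * h -> a * h / 2 <= e' <= 2 * b * h ->
    `|statistic eta (lam * om * h) b h l e z - statistic eta (lam * om * h) b h l e' z'| <= Lam * (enorm (z - z') + `|e - e'|).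
  move=> /andP[e1 _] /andP[e2 _].
  apply: le_trans (statistic_lipschitz eta_adm l z z' lo0 e1 e2 L0 w0 h0 (ltW b0) HL) _.
  by rewrite ler_wpM2r// addr_ge0.
have psiV l e (x : 'rV[R]_d) : a * h / 2 <= e <= 2 * b * h ->
    \int[Q]_y (statistic eta (lam * om * h) b h l e (y - x) ^+ 2) <= V.
  move=> He; have ee := e_gt0 e He; have /andP[_ e2] := He.
  have er : e + lam * om * h <= 3 * b * h.
    have := wb; move: e2; rewrite -!(mulrA _ b); move: (b * h) (lam * om * h) => q1 q2; lra.
  have := law_second_moment_le oOm beta0 rho_cont rho_bounds QE x
    (measurable_statistic eta_adm l w0 h0 (ltW b0) ee) (fun z => psiM l e z He)
    (fun z rz => statistic_supp eta_adm b h l w0 ee er rz) h3.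
  move/le_trans; apply; rewrite bvol_scale// [(3 * b * h) ^+ d]exprMn /V /deviation_scale -/M.
  rewrite le_eqVlt; apply/orP; left; apply/eqP; ring.
have lohi : a * h / 2 <= 2 * b * h by lra.
have [A HA HA'] := uniform_deviation XQ X_indep n lohi M0 V0 Lam0 t0 tMV s0 W2 W1 Ls psiM psiL psiV.
exists A; last first.
  move=> w Aw l e x Ox He; apply: HA' => // j; exact: OmW.
apply: (holds_up_to_le HA).
(* The mesh is of order [(lam * h) ^+ 2 * h ^+ d], and each of these three factors is at least
   [n%:R^-1]: this is the origin of the cube of [n]. *)
have sE : s^-1 <= deviation_lipschitz * (d%:R + 1) / tau * n%:R ^+ 3.
  rewrite (_ : s^-1 = deviation_lipschitz * (d%:R + 1) / tau * ((lam * h)^-1 * (lam * h)^-1 * (h ^+ d)^-1)); last first.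
    by rewrite /s /Lam /t exprS; field; rewrite !gt_eqF// exprn_gt0.
  apply: ler_wpM2l.
    by rewrite divr_ge0 ?(ltW tau0)// mulr_ge0 ?(ltW CL0) ?(ltW d10).
  have i1 : (lam * h)^-1 <= n%:R by rewrite invf_ple ?posrE.
  have i2 : (h ^+ d)^-1 <= n%:R by rewrite invf_ple ?posrE.
  rewrite exprS expr2 mulrA; apply: ler_pM => //; rewrite ?mulr_ge0 ?invr_ge0 ?(ltW lh0) ?(ltW hd0)//.
  by apply: ler_pM; rewrite ?invr_ge0 ?(ltW lh0).
have Wp : 0 <= 2 * W0 + 2 * b by rewrite addr_ge0// mulr_ge0// ltW.
have NB := grid_size_poly n0 s0 Wp sE.
rewrite !card_prod card_ffun !card_ord !natrM natrX /deviation_count.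
set N := (grid_size _ _)%:R; rewrite -/N in NB.
set c := _ + 1 in NB *.
rewrite [n%:R * t ^+ 2 / _](_ : _ = deviation_rate * (n%:R * h ^+ d * h ^+ 2 * lam ^+ 2)); last first.
  by rewrite /t /V /deviation_rate [h ^+ d.+1]exprS; field; rewrite !gt_eqF.
set E := expR _; rewrite (mulrC 2 E) mulrA.
have NN : N ^+ d * N <= c ^+ d.+1 * (n%:R ^+ 3) ^+ d.+1.
  by rewrite -exprSr -[leRHS]exprMn; apply: lerXn2r; rewrite ?nnegrE ?(le_trans _ NB).
rewrite [leLHS](_ : _ = 2 * #|{: option (option 'I_d * option 'I_d)}|%:R * (N ^+ d * N) * E); last by rewrite card_option card_prod !card_option; ring.
rewrite ler_wpM2r ?expR_ge0// -[leRHS]mulrA ler_wpM2l ?mulr_ge0//.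
Qed.

Definition filling_rate (c : R) : R := beta * c ^+ d.
Definition filling_count (c : R) : R := (2 * W0 / c + 1) ^+ d.

(** A cell in the domain contains on average at least [n * beta * s ^+ d] points, with [s] equal to
    [c * h] times the root of [lam * h]. In terms of [k] this is a multiple of
    [(k / n) ^ (1 / 2) * k * lam ^ (d / 2)], the first exponent of the theorem. *)
Lemma filling_sample (n : nat) (c lam h : R) : (0 < n)%N ->
  0 < c -> c <= 1 -> 0 <= W0 -> 0 < lam -> lam <= 1 -> 0 < h -> h <= 1 ->
  n%:R^-1 <= lam * h ->
  exists2 A : set T,
    holds_up_to P (filling_count c * (n%:R ^+ 3) ^+ d *
      expR (- (filling_rate c * (n%:R * h ^+ d * Num.sqrt (lam * h) ^+ d)))) A &
    forall w, A w -> forall p, ecball p (d%:R * (c * (h * Num.sqrt (lam * h)))) `<=` Om ->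
      exists2 j, (j < n)%N & enorm (X j w - p) <= d%:R * (c * (h * Num.sqrt (lam * h))).
Proof.
move=> n0 c0 c1 W00 lam0 lam1 h0 h1 nlh.
have n0' : 0 < n%:R :> R by rewrite ltr0n.
have lh0 : 0 < lam * h by rewrite mulr_gt0.
have lh1 : lam * h <= 1 by rewrite -[leRHS]mul1r; apply: ler_pM => //; exact: ltW.
set q := Num.sqrt (lam * h).
have q0 : 0 < q by rewrite sqrtr_gt0.
have q1 : q <= 1 by rewrite -(sqrtr1 R) ler_sqrt.
have lhq : lam * h <= q.
  have := sqr_sqrtr (ltW lh0); rewrite -/q => <-.
  by rewrite expr2 ler_piMl// ltW.
set s := c * (h * q).
have s0 : 0 < s by rewrite !mulr_gt0.
have s1 : s <= 1.
  rewrite -[leRHS]mul1r; apply: ler_pM => //; [exact: ltW|by rewrite ltW// mulr_gt0|].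
  by rewrite -[leRHS]mul1r; apply: ler_pM => //; exact: ltW.
have bs : beta * s ^+ d <= 1.
  rewrite -[leRHS]mul1r; apply: ler_pM => //; [exact: ltW|exact/exprn_ge0/ltW|].
  by apply: exprn_ile1 => //; exact: ltW.
have Q_ge A : measurable A -> A `<=` Om -> (beta%:E * lebesgue_rV d A <= Q A)%E.
  exact: (law_ge oOm beta0 rho_cont rho_bounds QE).
have [A HA HA'] := filling_event XQ X_indep OmW Q_ge n s0 bs.
exists A => //; apply: (holds_up_to_le HA).
have sE : s^-1 <= c^-1 * n%:R ^+ 3.
  have i0 : q^-1 <= n%:R by rewrite invf_ple ?posrE// (le_trans nlh).
  have i1 : h^-1 <= n%:R.
    by rewrite invf_ple ?posrE// (le_trans nlh)// ler_piMl// ltW.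
  rewrite /s !invfM ler_pM2l ?invr_gt0//; apply: (@le_trans _ _ (n%:R * n%:R)).
    by apply: ler_pM; rewrite ?invr_ge0 ?(ltW h0) ?(ltW q0).
  by rewrite !exprS expr0 mulr1 mulrA ler_peMr ?mulr_ge0// ler1n.
have NB := grid_size_poly n0 s0 (mulr_ge0 (ler0n R 2) W00) sE.
rewrite card_ffun !card_ord natrX /filling_count.
rewrite [n%:R * (beta * s ^+ d)](_ : _ = filling_rate c * (n%:R * h ^+ d * q ^+ d)); last first.
  by rewrite /filling_rate /s !exprMn; ring.
rewrite ler_wpM2r ?expR_ge0// -[leRHS]exprMn; apply: lerXn2r; rewrite ?nnegrE ?(le_trans _ NB)//.
Qed.

(** A grid of mesh [s] has of the order of [s ^- d] cells, each shared by two given points with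
    probability of order [s ^+ (2 * d)]. The total is of order [s ^+ d], and nothing ties [s] to the
    other scales. *)
Lemma distinct_sample (n : nat) (delta : R) : 0 < delta -> (0 < d)%N -> 0 <= W0 -> (forall j w, Om (X j w)) ->
  exists2 A : set T, holds_up_to P delta A &
    forall w, A w -> forall i j : 'I_n, X i w = X j w -> i = j.
Proof.
move=> delta0 d0 W00 XO.
pose c := n%:R ^+ 2 * (2 * W0 + 1) ^+ d * beta^-1 ^+ 2.
have c0 : 0 <= c by rewrite mulr_ge0 ?sqr_ge0// mulr_ge0 ?exprn_ge0// ?addr_ge0// mulr_ge0.
pose s := Num.min 1 (delta / (c + 1)).
have c1 : 0 < c + 1 by rewrite ltr_wpDl.
have s0 : 0 < s by rewrite lt_min ltr01 divr_gt0.
have s1 : s <= 1 by rewrite ge_min lexx.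
have Q_le A : measurable A -> (Q A <= (beta^-1)%:E * lebesgue_rV d A)%E.
  exact: (law_le oOm beta0 rho_cont rho_bounds QE).
have [A HA HA'] := distinct_event XQ X_indep OmW Q_le n s0 XO.
exists A => //; apply: (holds_up_to_le HA).
have NB : (grid_size (2 * W0) s)%:R <= (2 * W0 + 1) / s :> R.
  apply: le_trans (grid_size_le s0 (mulr_ge0 (ler0n R 2) W00)) _.
  by rewrite [leRHS]mulrDl lerD2l mul1r invf_ge1.
apply: (@le_trans _ _ (n%:R ^+ 2 * ((2 * W0 + 1) / s) ^+ d * (beta^-1 * s ^+ d) ^+ 2)).
  rewrite ler_wpM2r ?sqr_ge0// ler_wpM2l ?sqr_ge0//; apply: lerXn2r; rewrite ?nnegrE ?(le_trans _ NB)//.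
rewrite [leLHS](_ : _ = c * s ^+ d); last first.
  by rewrite /c expr_div_n exprMn; field; rewrite ?gt_eqF ?exprn_gt0.
apply: (@le_trans _ _ (c * s)).
  by rewrite ler_wpM2l// -[leRHS]expr1; apply: ler_wiXn2l => //; exact: ltW.
apply: (@le_trans _ _ ((c + 1) * s)); first by rewrite ler_wpM2r ?lerDl// ltW.
by rewrite mulrC -ler_pdivlMr// ge_min lexx orbT.
Qed.

End events.

(** * Choice of the parameters *)

Section parameters.
Context {R : realType}.

(** The counts at radii [a * h] and [b * h / 2] must lie on either side of [k], and [om] must keep
    the layer harmless. As [a <= 1 <= b / 2], first powers control the powers of exponent [d], and
    explicit values can be given. *)
Lemma scale_parameters (d : nat) (beta : R) : (0 < d)%N -> 0 < beta ->
  exists a b om : R, [/\ 0 < a, a <= 1, a <= b / 2 & 1 <= b] /\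
    [/\ 0 < om, om <= a,
        beta^-1 * 3 ^+ d * ball_volume R d * om * (2 * b) ^+ d.-1 <= 2^-1,
        beta^-1 * ball_volume R d * a ^+ d <= 4^-1 &
        5%:R / 4 <= beta * ball_volume R d * (b / 2) ^+ d].
Proof.
move=> d0 beta0; set al := ball_volume R d.
have al0 : 0 < al by apply: ball_volume_gt0.
pose a := Num.min 1 (beta / al / 4).
have a0 : 0 < a by rewrite lt_min ltr01 !divr_gt0.
have a1 : a <= 1 by rewrite ge_min lexx.
have a2 : a <= beta / al / 4 by rewrite ge_min lexx orbT.
pose b := 2 * (1 + 5%:R / 4 / (beta * al)).
have q0 : 0 < 5%:R / 4 / (beta * al) by rewrite !divr_gt0// mulr_gt0.
have b2E : b / 2 = 1 + 5%:R / 4 / (beta * al) by rewrite /b mulrC mulKf.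
have b2 : 1 <= b / 2 by rewrite b2E lerDl ltW.
have b1 : 1 <= b by move: b2; lra.
pose c := beta^-1 * 3 ^+ d * al * (2 * b) ^+ d.-1.
have c0 : 0 < c.
  apply: mulr_gt0; last by rewrite exprn_gt0// mulr_gt0// (lt_le_trans ltr01).
  by rewrite mulr_gt0// mulr_gt0 ?exprn_gt0// invr_gt0.
pose om := Num.min a (2^-1 / c).
have om0 : 0 < om by rewrite lt_min a0 divr_gt0.
exists a, b, om; split; split => //.
- exact: le_trans a1 b2.
- by rewrite ge_min lexx.
- rewrite (_ : _ * _ = om * c); last by rewrite /c; ring.
  by rewrite -ler_pdivlMr// ge_min lexx orbT.
- rewrite mulrAC -ler_pdivlMr// mulrC ler_pdivrMr// (le_trans (_ : _ <= a))//.
    by rewrite -[leRHS]expr1; apply: ler_wiXn2l => //; exact: ltW.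
  by apply: le_trans a2 _; rewrite le_eqVlt; apply/orP; left; apply/eqP; field; rewrite gt_eqF.
- rewrite -ler_pdivrMl ?mulr_gt0// mulrC; apply: (@le_trans _ _ (b / 2)); first by rewrite b2E lerDr.
  by rewrite -[leLHS]expr1; apply: ler_weXn2l.
Qed.

Lemma root_scale (d n k : nat) : (0 < d)%N -> (0 < k <= n)%N ->
  let h : R := (k%:R / n%:R) `^ (d%:R^-1) in
  [/\ 0 < h, h <= 1, h ^+ d = k%:R / n%:R & n%:R^-1 <= h ^+ d].
Proof.
move=> d0 /andP[k0 kn] h.
have n0 : (0 < n)%N by exact: leq_trans kn.
have q0 : 0 < k%:R / n%:R :> R by rewrite divr_gt0// ltr0n.
have hd : h ^+ d = k%:R / n%:R.
  by rewrite -powR_mulrn ?powR_ge0// /h -powRrM mulVf ?pnatr_eq0 -?lt0n// powRr1// ltW.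
split => //; first exact: powR_gt0.
  rewrite -(ler_pXn2r (n := d))// ?nnegrE ?powR_ge0// expr1n hd ler_pdivrMr ?ltr0n//.
  by rewrite mul1r ler_nat.
by rewrite hd ler_peMl ?invr_ge0// ler1n.
Qed.

Lemma sqrt_powR (d n k : nat) (lam h : R) : (0 < d)%N -> 0 <= lam -> 0 < h -> h ^+ d = k%:R / n%:R ->
  Num.sqrt (lam * h) ^+ d = (k%:R / n%:R) `^ 2^-1 * lam `^ (d%:R / 2).
Proof.
move=> d0 lam0 h0 <-; rewrite -powR12_sqrt; last by rewrite mulr_ge0// ltW.
rewrite powRM ?(ltW h0)// exprMn mulrC -[h ^+ d]powR_mulrn ?(ltW h0)// -powRrM.
by rewrite -!powR_mulrn ?powR_ge0// -!powRrM [_ * d%:R in X in X * _]mulrC [_ * d%:R in X in _ * X]mulrC.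
Qed.

End parameters.

(** * The event on which consistency holds *)

Section good_sample.
Context {R : realType} {d : nat}.
Variables (eta : R -> R) (Om : set 'rV[R]_d) (rho : 'rV[R]_d -> R) (beta W0 L : R).
Hypothesis d0 : (0 < d)%N.
Hypothesis eta_adm : @admissible_kernel R d eta.
Hypotheses (oOm : open Om) (beta0 : 0 < beta) (beta1 : beta <= 1).
Hypothesis rho_cont : forall x, Om x -> {for x, continuous rho}.
Hypothesis rho_bounds : forall x, Om x -> beta <= rho x <= beta^-1.
Hypotheses (W0_ge0 : 0 <= W0) (OmW : forall x i, Om x -> `|x 0 i| <= W0).
Hypothesis L0 : 0 <= L.
Hypothesis HL : forall s t, 0 <= s -> 0 <= t -> `|eta s - eta t| <= L * `|s - t|.
Variables (a b om c : R).
Hypotheses (a0 : 0 < a) (ab : a <= b) (b1 : 1 <= b) (om0 : 0 < om) (omb : om <= b).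
Hypotheses (c0 : 0 < c) (c1 : c <= 1).
Local Notation tau := (@deviation_scale R d eta beta b).

(** What the pointwise estimate needs to know about the sample; randomness plays no further part.
    The last clause makes the removal of duplicates in [point_cloud] harmless. *)
Definition good_sample (n : nat) (lam h : R) (Q : probability 'rV[R]_d R) (Y : nat -> 'rV[R]_d) : Prop :=
  [/\ forall l e x, Om x -> a * h / 2 <= e <= 2 * b * h ->
      `|\sum_(0 <= j < n) statistic eta (lam * om * h) b h l e (Y j - x)
        - n%:R * \int[Q]_y statistic eta (lam * om * h) b h l e (y - x)|
      <= 3 * (n%:R * (tau * lam * h ^+ d.+1)),
      forall p, ecball p (d%:R * (c * (h * Num.sqrt (lam * h)))) `<=` Om ->
      exists2 j, (j < n)%N & enorm (Y j - p) <= d%:R * (c * (h * Num.sqrt (lam * h))) &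
      forall i j : 'I_n, Y i = Y j -> i = j].

Lemma good_sample_event : exists C2 C3 : R, [/\ 0 < C2, 0 < C3 &
  forall (dT : measure_display) (T : measurableType dT) (P : probability T R)
    (Q : probability 'rV[R]_d R) (X : nat -> {RV P >-> 'rV[R]_d}),
  (forall A, measurable A -> Q A = (\int[lebesgue_rV d]_(x in A `&` Om) (rho x)%:E)%E) ->
  (forall i A, measurable A -> P (X i @^-1` A) = Q A) ->
  (forall (n : nat) (A : nat -> set 'rV[R]_d),
    (forall i, measurable (A i)) -> P (\bigcap_(i < n) (X i @^-1` A i)) = (\prod_(i < n) P (X i @^-1` A i))%E) ->
  (forall j w, Om (X j w)) ->
  forall (n k : nat) (lam : R), (0 < k <= n)%N -> 0 < lam -> lam <= 1 ->
  let X1 := C2 * n%:R ^+ 3 * expR (- (C3 * (k%:R / n%:R) `^ 2^-1 * k%:R * lam `^ (d%:R / 2))) in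
  let X2 := C2 * n%:R ^+ 3 * expR (- (C3 * (k%:R / n%:R) `^ (2 / d%:R) * k%:R * lam ^+ 2)) in
  X1 < 1 -> X2 < 1 ->
  exists2 A : set T, holds_up_to P (X1 + X2) A &
    forall w, A w -> good_sample n lam ((k%:R / n%:R) `^ (d%:R^-1)) Q (fun j => X j w)].
Proof.
have al0 : 0 < ball_volume R d by apply: ball_volume_gt0.
have E0 : 0 <= eta 0 by exact: (eta_ge0 eta_adm).
have b0 : 0 < b by exact: lt_le_trans b1.
have M0 : 0 < (eta 0 + 1) * (1 + 2 * b) ^+ 2.
  by rewrite mulr_gt0 ?ltr_wpDl// exprn_gt0// addr_gt0// mulr_gt0.
have tau0 : 0 < tau.
  by rewrite /deviation_scale mulr_gt0// mulr_gt0 ?exprn_gt0 ?mulr_gt0// invr_gt0.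
set r1 := filling_rate (d := d) beta c; set r2 := @deviation_rate R d eta beta b.
have r10 : 0 < r1 by rewrite mulr_gt0// exprn_gt0.
have r20 : 0 < r2 by rewrite /r2 /deviation_rate divr_gt0// mulr_gt0.
pose B1 := filling_count (d := d) W0 c; pose B2 := deviation_count (d := d) eta beta W0 L a b om.
have B10 : 0 <= B1 by rewrite exprn_ge0// addr_ge0// divr_ge0 ?(ltW c0)// mulr_ge0.
have B20 : 0 <= B2.
  apply: mulr_ge0; first by rewrite mulr_ge0.
  apply: exprn_ge0; apply: addr_ge0 => //; apply: mulr_ge0; first by rewrite addr_ge0 ?mulr_ge0 ?(ltW b0).
  rewrite divr_ge0 ?(ltW tau0)// mulr_ge0 ?addr_ge0 ?invr_ge0 ?(ltW om0)//.
    by rewrite divr_ge0 ?(ltW a0)// mulr_ge0 ?sqr_ge0// mulr_ge0.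
  by rewrite mulr_ge0// mulr_ge0// addr_ge0// mulr_ge0// ltW.
(* The nets have at most the power [d.+1] of [n ^+ 3]; dividing the rates by this exponent is what
   [absorb_polynomial] asks for. *)
pose C3 := Num.min r1 r2 / d.+1%:R.
have C30 : 0 < C3 by rewrite divr_gt0// lt_min r10.
(* The term [expR C3] makes [X2 < 1] impossible unless [F2 > 1]; with [2 * B1] and [2 * B2] each net
   costs at most half of its exponential term. *)
pose C2 := 1 + expR C3 + 2 * B1 + 2 * B2.
have eC := expR_gt0 C3.
have C20 : 0 < C2 by rewrite /C2; move: B10 B20 eC; lra.
exists C2, C3; split => // dT T P Q X QE XQ X_indep XO n k lam kn lam0 lam1.
have [h0 h1 hd nhd] := root_scale (R := R) d0 kn.
set h := (k%:R / n%:R) `^ (d%:R^-1) in h0 h1 hd nhd *.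
have /andP[k0 kn'] := kn.
have n0 : (0 < n)%N by exact: leq_trans kn'.
have n0' : 0 < n%:R :> R by rewrite ltr0n.
have nk : n%:R * h ^+ d = k%:R by rewrite hd mulrCA divff ?mulr1// gt_eqF.
move=> X1 X2.
have X1E : X1 = C2 * n%:R ^+ 3 * expR (- (C3 * (n%:R * h ^+ d * Num.sqrt (lam * h) ^+ d))).
  by rewrite /X1 (sqrt_powR d0 (ltW lam0) h0 hd) nk; congr (_ * expR (- _)); ring.
have X2E : X2 = C2 * n%:R ^+ 3 * expR (- (C3 * (n%:R * h ^+ d * h ^+ 2 * lam ^+ 2))).
  rewrite /X2 nk -hd powR_root ?(ltW h0)// powR_mulrn ?(ltW h0)//.
  by congr (_ * expR (- _)); ring.
move=> X1lt X2lt.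
set F1 := n%:R * h ^+ d * _ in X1E; set F2 := n%:R * h ^+ d * h ^+ 2 * lam ^+ 2 in X2E.
have F10 : 0 <= F1 by rewrite mulr_ge0 ?exprn_ge0 ?sqrtr_ge0// mulr_ge0 ?exprn_ge0// ltW.
have F20 : 0 <= F2 by rewrite mulr_ge0 ?sqr_ge0// mulr_ge0 ?sqr_ge0// mulr_ge0 ?exprn_ge0// ltW.
have n31 : 1 <= n%:R ^+ 3 :> R by rewrite exprn_ege1// ler1n.
(* Otherwise [X2] would be at least [C2 * expR (- C3)], which is at least 1. The bound
   [n%:R^-1 <= lam * h], hence the polynomial size of the nets, rests on this. *)
have F21 : 1 < F2.
  rewrite ltNge; apply/negP => F21; move: X2lt; rewrite X2E ltNge => /negP; apply.
  apply: (@le_trans _ _ (C2 * expR (- C3))).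
    rewrite -[leLHS](expRxMexpNx_1 C3) ler_wpM2r ?expR_ge0//.
    by rewrite /C2; move: B10 B20; lra.
  apply: ler_pM; [exact: ltW|exact: expR_ge0| |].
    by rewrite ler_peMr// ltW.
  by rewrite ler_expR lerN2 ler_piMr// ltW.
have nlh : n%:R^-1 <= lam * h.
  have lh0 : 0 < lam * h by rewrite mulr_gt0.
  rewrite -(ler_pXn2r (n := 2)) ?nnegrE ?invr_ge0 ?(ltW lh0)//.
  apply: (@le_trans _ _ n%:R^-1); first by rewrite expr2 ler_piMr ?invr_ge0// invf_le1// ler1n.
  rewrite -[leLHS]mul1r ler_pdivrMr//; apply: le_trans (ltW F21) _.
  rewrite /F2 (_ : n%:R * h ^+ d * h ^+ 2 * lam ^+ 2 = (lam * h) ^+ 2 * n%:R * h ^+ d); last by ring.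
  rewrite ler_piMr//; first by apply: mulr_ge0 => //; exact: sqr_ge0.
  by apply: exprn_ile1 => //; exact: ltW.
have C21 : 1 <= C2 by rewrite /C2; move: B10 B20 eC; lra.
have C2B1 : 2 * B1 <= C2 by rewrite /C2; move: B20 eC; lra.
have C2B2 : 2 * B2 <= C2 by rewrite /C2; move: B10 eC; lra.
have C3r2 : C3 * d.+1%:R <= r2 by rewrite /C3 divfK// ge_min lexx orbT.
have C3r1 : C3 * d%:R <= r1.
  apply: (@le_trans _ _ (C3 * d.+1%:R)); first by rewrite ler_pM2l// ler_nat.
  by rewrite /C3 divfK// ge_min lexx.
have [A2 HA2 A2P] := deviation_event XQ X_indep eta_adm oOm beta0 rho_cont rho_bounds QE OmW HL
  n0 a0 ab b1 om0 omb L0 W0_ge0 lam0 lam1 h0 h1 nlh nhd.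
have [A1 HA1 A1P] := filling_sample XQ X_indep oOm beta0 beta1 rho_cont rho_bounds QE OmW
  n0 c0 c1 W0_ge0 lam0 lam1 h0 h1 nlh.
have X10 : 0 < 2^-1 * X1 by rewrite mulr_gt0 ?invr_gt0// mulr_gt0 ?expR_gt0// mulr_gt0// exprn_gt0.
have [A0 HA0 A0P] := distinct_sample XQ X_indep oOm beta0 rho_cont rho_bounds QE OmW n X10 d0 W0_ge0 XO.
exists (A0 `&` A1 `&` A2); last by move=> w [[w0 w1] w2]; split; [exact: A2P|exact: A1P|exact: A0P].
have e2 : 0 <= X2 by rewrite /X2 mulr_ge0 ?expR_ge0// mulr_ge0 ?exprn_ge0// ltW.
have l1 : B1 * (n%:R ^+ 3) ^+ d * expR (- (r1 * F1)) <= 2^-1 * X1.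
  have X1lt' := X1lt; rewrite X1E in X1lt'; rewrite X1E.
  exact: (absorb_polynomial d0 B10 F10 (lexx _) C3r1 C21 C2B1 X1lt').
have l2 : B2 * (n%:R ^+ 3) ^+ d.+1 * expR (- (r2 * F2)) <= 2^-1 * X2.
  have X2lt' := X2lt; rewrite X2E in X2lt'; rewrite X2E.
  exact: (absorb_polynomial (ltn0Sn d) B20 F20 (lexx _) C3r2 C21 C2B2 X2lt').
apply: (holds_up_to_le (holds_up_toI (holds_up_toI HA0 HA1) HA2)).
apply: le_trans (lerD (lerD (lexx _) l1) l2) _.
have half2 : 2^-1 + 2^-1 = 1 :> R by field.
by rewrite -mulrDl half2 mul1r lerD2l ler_piMl// invf_le1// ler1n.
Qed.

End good_sample.

Lemma bounded_coord {R : realType} {d : nat} (Om : set 'rV[R]_d) : bounded_set Om ->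
  exists2 W : R, 0 <= W & forall x i, Om x -> `|x 0 i| <= W.
Proof.
case=> M [_ HM]; exists (`|M| + 1) => [|x i Ox]; first exact: addr_ge0.
have := HM (`|M| + 1) _ x Ox; rewrite ltr_pwDr// ?ler_norm// => /(_ isT); apply: le_trans.
have -> : `|x| = mx_norm x by [].
rewrite mx_normrE; exact: (le_bigmax 0 (fun ij => `|x ij.1 ij.2|) (0, i)).
Qed.

Lemma density_le1 {R : realType} (beta r : R) : 0 < beta -> beta <= r <= beta^-1 -> beta <= 1.
Proof.
move=> beta0 /andP[r1 r2]; have := le_trans r1 r2.
rewrite -(ler_pM2l beta0) mulfV ?gt_eqF// => H.
by rewrite -(ler_pXn2r (n := 2)) ?nnegrE ?(ltW beta0)// expr1n expr2.
Qed.

Theorem theorem2p10 (R : realType) (d : nat) (d_gt0 : (0 < d)%N)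
    (Om : set 'rV[R]_d) (rho : 'rV[R]_d -> R) (eta : R -> R) (r0 : R)
    (p : \bar R)
    (Om_domain : smooth_domain Om) (rho_density : C2_density Om rho)
    (eta_kernel : admissible_kernel d eta) (r0_01 : 0 < r0 < 1)
    (p_ge2 : (2%:E <= p)%E) :
  exists C1 C2 C3 c1 c2 : R,
    [/\ 0 < C1, 0 < C2, 0 < C3, 0 < c1 & 0 < c2] /\
    forall (theta : R), 0 < theta -> kernel_peak eta r0 theta ->
    forall (dT : measure_display) (T : measurableType dT)
      (P : probability T R) (X : nat -> {RV P >-> 'rV[R]_d}),
      iid_with_density Om rho X ->
    forall (n k : nat) (lambda : R),
      (1 <= k <= n)%N -> k%:R <= c1 * n%:R -> 0 < lambda <= 4^-1 ->
      has_prob_at_least P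
        (consistency_event (Ordinal d_gt0) Om rho eta r0 theta p X n k
           lambda C1 c2)
        (1 - C2 * n%:R ^+ 3 *
               expR (- (C3 * (k%:R / n%:R) `^ 2^-1 * k%:R
                          * lambda `^ (d%:R / 2)))
           - C2 * n%:R ^+ 3 *
               expR (- (C3 * (k%:R / n%:R) `^ (2 / d%:R) * k%:R
                          * lambda ^+ 2))).
Proof.
have [oOm bOm _ [xne Oxne] _] := Om_domain.
have [rhoC [beta beta0 rho_bounds] _] := rho_density.
have [rhok _ _] := rhoC.
have beta1 : beta <= 1 by exact: density_le1 beta0 (rho_bounds _ Oxne).
have rho_cont x : Om x -> {for x, continuous rho} by exact: (rhok [::]).2.
have [W W0 OmW] := bounded_coord bOm.
have [L L0 HL] := eta_lipschitz eta_kernel.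
have [Cp Cp0 HCp] := eta_peak_lower eta_kernel r0_01.
have [K K0 [rho1 rho2 rho_partial]] := density_taylor oOm bOm rhoC.
have [a [b [om [[a0 a1 ab b1] [om0 oma om_small a_small b_large]]]]] := scale_parameters (R := R) d_gt0 beta0.
have /andP[r00 r01] := r0_01.
have dR : 0 < d%:R :> R by rewrite ltr0n.
have d1R : 1 <= d%:R :> R by rewrite ler1n.
have b0 : 0 < b by exact: lt_le_trans b1.
have ab' : a <= b by move: ab; lra.
have omb : om <= b by exact: le_trans ab'.
(* The filling event works at distance [d%:R] times the side of a cell; dividing by [d%:R] yields
   the coefficient [r0 * a / 2] of [dl]. *)
pose c := r0 * a / 2 / d%:R.
have c0 : 0 < c by rewrite divr_gt0// divr_gt0// mulr_gt0.
have c1 : c <= 1.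
  rewrite ler_pdivrMr// mul1r; apply: le_trans d1R; rewrite ler_pdivrMr// mul1r.
  apply: (@le_trans _ _ (1 * 1)); last by rewrite mulr1 ler1n.
  by apply: ler_pM => //; exact: ltW.
have al0 : 0 < ball_volume R d by apply: ball_volume_gt0.
pose tau := deviation_scale (d := d) eta beta b.
have tau0 : 0 < tau.
  have E0 : 0 <= eta 0 by exact: (eta_ge0 eta_kernel).
  rewrite /tau /deviation_scale mulr_gt0//.
    by rewrite mulr_gt0 ?ltr_wpDl// exprn_gt0// addr_gt0// mulr_gt0.
  by rewrite mulr_gt0 ?exprn_gt0 ?mulr_gt0// invr_gt0.
pose ch := K * (3 * b) ^+ d.+1 * ball_volume R d + 3 * tau.
have ch0 : 0 <= ch.
  apply: addr_ge0; last by rewrite mulr_ge0// ltW.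
  by apply: mulr_ge0; [rewrite mulr_ge0// exprn_ge0// mulr_ge0// ltW|exact: ltW].
pose Cm := moment_const (d := d) eta K K b tau.
(* The threshold below which both smallness conditions on [h] hold; the summands 1 keep the
   denominators positive. *)
pose hs := Num.min 1 (Num.min (8^-1 / (ch + 1)) (beta * a ^+ d / 2 / (`|Cm| + 1))).
have hs0 : 0 < hs.
  rewrite !lt_min ltr01/=; apply/andP; split.
    by rewrite divr_gt0// ltr_wpDl.
  by rewrite divr_gt0 ?ltr_wpDl// divr_gt0// mulr_gt0// exprn_gt0.
have [C2 [C3 [C20 C30 event]]] := good_sample_event d_gt0 eta_kernel oOm beta0 beta1 rho_cont rho_bounds W0 OmW
  (ltW L0) HL a0 ab' b1 om0 omb c0 c1.
pose k1 := rw_const (Ordinal d_gt0) eta beta K a b om tau.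
pose k2 := infty_const1 (d := d) eta beta K b om tau r0 L.
pose k3 := infty_const2 (d := d) eta beta K a b om tau r0 L Cp.
(* None of [k1], [k2] and [k3] involves [theta]; absolute values dispense with their signs. *)
pose C1 := 1 + (`|inv_p p| * `|k1| + `|1 - 2 * inv_p p| * (`|k2| + `|k3|)).
have C10 : 0 < C1 by rewrite ltr_pwDl// addr_ge0// mulr_ge0// addr_ge0.
(* As [h ^+ d = k / n], the condition with [hs ^+ d] says [h <= hs]. The ball of radius [3 * b * h]
   contains the supports of all statistics, whose radii reach [2 * b * h] plus a layer. *)
exists C1, C2, C3, (hs ^+ d), (3 * b); split; first by split => //; [exact: exprn_gt0|exact: mulr_gt0].
move=> theta th0 pk dT T P X [XO Xdist Xind] n k lam kn kc /andP[lam0 lam4].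
have lam4' : 4 * lam <= 1 by rewrite -ler_pdivlMl// mulr1.
have lam1 : lam <= 1 by apply: le_trans lam4'; rewrite ler_peMl ?ler1n// ltW.
pose Q : probability 'rV[R]_d R := distribution P (X 0%N).
have QE A : measurable A -> Q A = (\int[lebesgue_rV d]_(x in A `&` Om) (rho x)%:E)%E by move=> mA; exact: Xdist.
have XQ i A : measurable A -> P (X i @^-1` A) = Q A.
  by move=> mA; rewrite QE// -(Xdist i A mA).
have := event dT T P Q X QE XQ Xind (fun j w => XO j w) n k lam kn lam0 lam1.
set X1 := _ * expR (- (_ * lam `^ _)); set X2 := _ * expR (- (_ * lam ^+ 2)) => /= Hev.
(* If one of the two terms is at least 1, the claimed probability is nonpositive and the empty event
   will do. *)
have [X1lt|X1ge] := ltP X1 1; last first.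
  exists set0; split; [exact: measurable0|exact: sub0set|].
  rewrite measure0 lee_fin; have : 0 <= X2 by rewrite mulr_ge0 ?expR_ge0// mulr_ge0 ?exprn_ge0// ltW.
  by move=> X20; rewrite -addrA -opprD subr_le0 (le_trans X1ge)// lerDl.
have [X2lt|X2ge] := ltP X2 1; last first.
  exists set0; split; [exact: measurable0|exact: sub0set|].
  rewrite measure0 lee_fin; have : 0 <= X1 by rewrite mulr_ge0 ?expR_ge0// mulr_ge0 ?exprn_ge0// ltW.
  by move=> X10; rewrite -addrA -opprD subr_le0 (le_trans X2ge)// lerDr.
have [A HA good] := Hev X1lt X2lt.
exists A; split; [by case: HA| |by have := holds_up_to_ge HA; rewrite opprD addrA].
move=> w Aw u uC x xin _.
have [dev fill dist] := good w Aw.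
have [h0 h1 hk _] := root_scale (R := R) d_gt0 kn.
set h := (k%:R / n%:R) `^ (d%:R^-1) in h0 h1 hk dev fill xin *.
have /andP[k0 kn'] := kn.
have n0 : (0 < n)%N by exact: leq_trans kn'.
have n0' : 0 < n%:R :> R by rewrite ltr0n.
have hhs : h <= hs.
  by rewrite -(ler_pXn2r (n := d))// ?nnegrE ?(ltW h0) ?(ltW hs0)// hk ler_pdivrMr.
have hs1 : h <= 8^-1 / (ch + 1) by apply: le_trans hhs _; rewrite !ge_min lexx orbT.
have hs2 : h <= beta * a ^+ d / 2 / (`|Cm| + 1) by apply: le_trans hhs _; rewrite !ge_min lexx !orbT.
have sm1 : ch * h <= 8^-1.
  apply: (@le_trans _ _ ((ch + 1) * h)); first by rewrite ler_wpM2r ?lerDl// ltW.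
  by rewrite mulrC -ler_pdivlMr// ltr_wpDl.
have sm2 : Cm * h <= beta * a ^+ d / 2.
  apply: (@le_trans _ _ ((`|Cm| + 1) * h)).
    by rewrite ler_wpM2r ?(ltW h0)//; apply: le_trans (ler_norm _) _; rewrite lerDl.
  by rewrite mulrC -ler_pdivlMr// ltr_wpDl.
have xOm : ecball x (3 * b * h) `<=` Om by exact: (inner_domain_ball oOm xin).
have xx : ecball x (3 * b * h) x.
  by rewrite /ecball/= subrr enorm0 mulr_ge0 ?mulr_ge0 ?(ltW h0) ?(ltW b0).
have Omx := xOm _ xx.
(* No two sample points coincide on the good event, so sums over the cloud are sums over the
   indices. *)
have SE : point_cloud X n w = [seq X i w | i <- iota 0 n].
  apply: undup_id; rewrite map_inj_in_uniq ?iota_uniq// => i j.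
  rewrite !mem_iota !add0n /= => ilt jlt ij.
  by have /(congr1 val) := dist (Ordinal ilt) (Ordinal jlt) ij.
rewrite /error_bound -/h; case: ifPn => [_|g0]; first exact: leey.
rewrite lee_fin SE.
have dlE : d%:R * (c * (h * Num.sqrt (lam * h))) = r0 * a / 2 * (h * Num.sqrt (lam * h)).
  by rewrite /c; field; rewrite gt_eqF.
have := L_p_close (Ordinal d_gt0) eta_kernel oOm bOm beta0 rho_cont rho_bounds QE K0 rho1 rho2 rhok rho_partial
  a0 ab b1 om0 oma tau0 om_small a_small b_large n0 k0 hk lam0 lam4' h0 h1 sm1 sm2 xOm
  (fun l e He => dev l e x Omx He) uC r0_01 th0 pk HL (ltW L0) (ltW Cp0) (HCp theta th0 pk) dlE fill g0 p.
move/le_trans; apply; rewrite -/k1 -/k2 -/k3.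
have N30 : 0 <= Ck_norm 3 (ecball x (3 * b * h)) u.
  exact: le_trans (normr_ge0 _) (partials_le_Ck_norm (s := [::]) oOm bOm uC isT xOm xx).
set W1 := Ck_norm 2 _ u ^+ 2 * _ * _ * h; set N3 := Ck_norm 3 _ u in N30 *.
have W10 : 0 <= W1.
  by rewrite /W1 mulr_ge0 ?(ltW h0)// mulr_ge0 ?invr_ge0 ?(ltW th0)// mulr_ge0 ?sqr_ge0// invr_ge0.
have W20 : 0 <= N3 * (lam + h) by rewrite mulr_ge0// addr_ge0// ltW.
rewrite -[k1 * N3 * _]mulrA; move: W1 (N3 * (lam + h)) W10 W20 => {}W1 W2 W10 W20.
apply: (@le_trans _ _ (`|inv_p p| * `|k1| * W2 + `|1 - 2 * inv_p p| * (`|k2| * W1 + `|k3| * W2))).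
  apply: lerD; first by rewrite -mulrA ler_wpM2l// ler_wpM2r// ler_norm.
  by rewrite ler_wpM2l// lerD// ler_wpM2r// ler_norm.
rewrite [leRHS](_ : _ = `|inv_p p| * `|k1| * W2 + `|1 - 2 * inv_p p| * (`|k2| * W1 + `|k3| * W2) +
  (W1 + W2 + `|inv_p p| * `|k1| * W1 + `|1 - 2 * inv_p p| * (`|k3| * W1 + `|k2| * W2))); last by rewrite /C1; ring.
by rewrite lerDl !addr_ge0 ?mulr_ge0 ?addr_ge0 ?mulr_ge0.
Qed.
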